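(* Let $f\colon X\to Y$ be a morphism of schemes, and let $m\in\mathbb N\cup\{\infty\}$. Then there exists a quasi-coherent sheaf $\mathrm{HS}^m_{X/Y}$ of $\mathcal O_X$-algebras such that (i) for each pair of open affines $\operatorname{Spec} A\subseteq Y$ and $\operatorname{Spec} B\subseteq f^{-1}(\operatorname{Spec} A)$, there exists an isomorphism $$\phi_{B/A}\colon\Gamma(\operatorname{Spec} B,\mathrm{HS}^m_{X/Y})\xrightarrow{\ \sim\ }\mathrm{HS}^m_{B/A}$$ of $B$-algebras; and (ii) the various $\phi_{B/A}$ are compatible with the localization isomorphisms $\mathrm{HS}^m_{B/A}\xrightarrow{\sim}\mathrm{HS}^m_{B/S^{-1}A}$ (for multiplicative subsets $S\subseteq A$ such that $A\to B$ factors through $A\to S^{-1}A$) and $S^{-1}\mathrm{HS}^m_{B/A}\xrightarrow{\sim}\mathrm{HS}^m_{S^{-1}B/A}$ (for multiplicative subsets $S\subseteq B$). Moreover, the collection $(\mathrm{HS}^m_{X/Y},(\phi_{B/A})_{A,B})$ is unique up to unique isomorphism.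
   Context: All rings and algebras are commutative with $1$; $\mathbb N$ contains $0$; when $m=\infty$, ''$i=1,\dots,m$'' means all positive integers $i$ (and ''$i=0,\dots,m$'' all $i\ge 0$). For a ring homomorphism $f\colon A\to B$, $\mathrm{HS}^m_{B/A}$ is the quotient of the polynomial algebra $B[x^{(i)}]_{x\in B,\ i=1,\dots,m}$ by the ideal generated by: $(x+y)^{(i)}-x^{(i)}-y^{(i)}$ for $x,y\in B$, $i=1,\dots,m$; $f(a)^{(i)}$ for $a\in A$, $i=1,\dots,m$; and $(xy)^{(k)}-\sum_{i+j=k}x^{(i)}y^{(j)}$ for $x,y\in B$, $k=0,\dots,m$, where $x^{(0)}$ is identified with $x$. Write $d_i x$ for the class of $x^{(i)}$ (so $d_0x=x$). $\mathrm{HS}^m_{B/A}$ is a graded $B$-algebra with $B$ in degree $0$ and $d_ix$ of degree $i$. Localization isomorphisms: if $S\subseteq A$ is multiplicative and $A\to B$ factors through $A\to S^{-1}A$, the identity on $B[x^{(i)}]_{x\in B,\,i=1,\dots,m}$ induces an isomorphism $\mathrm{HS}^m_{B/A}\cong\mathrm{HS}^m_{B/S^{-1}A}$; if $S\subseteq B$ is multiplicative, the obvious map $B[x^{(i)}]_{x\in B}\to S^{-1}B[y^{(i)}]_{y\in S^{-1}B}$ (sending $x^{(i)}$ to $(x/1)^{(i)}$) induces an isomorphism $S^{-1}\mathrm{HS}^m_{B/A}\cong\mathrm{HS}^m_{S^{-1}B/A}$. Compatibility concerns those localizations that correspond to inclusions of open affines of $Y$, respectively of $X$. The morphism $X\to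 Y$ is not assumed separated. *)

(* Defs.v *)
From HB Require Import structures.
From mathcomp Require Import all_boot all_algebra finmap.
From mathcomp Require Import boolp classical_sets topology_structure.
From mathcomp Require Import ring.
From mathcomp.multinomials Require Import monalg.

Set Implicit Arguments.
Unset Strict Implicit.
Unset Printing Implicit Defensive.

Import GRing.Theory.

Local Open Scope quotient_scope.
Local Open Scope classical_set_scope.
Local Open Scope ring_scope.

(* Rings are [comPzRingType]s, so the zero ring (sections over the empty
   open set, stalkwise vanishing quotients) is allowed throughout.            *)

(** * Polynomial algebras *)

(* [polyalg R I] below is the polynomial algebra R[X_i]_{i in I}. The library
   gives [{malg R[K]}] a ring structure only for nonzero R; the same
   convolution product is set up here over an arbitrary commutative ring.     *)
HB.lock Definition pmul (R : comPzRingType) (I : choiceType)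
    (g1 g2 : {malg R[{cmonom I}]}) : {malg R[{cmonom I}]} :=
  \sum_(k1 <- msupp g1) \sum_(k2 <- msupp g2)
    << g1@_k1 * g2@_k2 *g (mmul k1 k2) >>.

Section PolyAlgProduct.
Variables (R : comPzRingType) (I : choiceType).
Local Notation K := {cmonom I}.
Local Notation P := {malg R[K]}.

Implicit Types g : P.

Definition pone : P := << 1 *g (mone : K) >>.

Local Notation pmul := (@pmul R I).

Lemma pmullw (d1 d2 : {fset K}) g1 g2 :
  (msupp g1 `<=` d1)%fset -> (msupp g2 `<=` d2)%fset ->
  pmul g1 g2 = \sum_(k1 <- d1) \sum_(k2 <- d2)
    << g1@_k1 * g2@_k2 *g (mmul k1 k2) >>.
Proof.
move=> le_d1 le_d2; rewrite !pmul.unlock (big_fset_incl _ le_d1) /=.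
  apply/eq_bigr=> k1 _; apply/big_fset_incl => // k _ /mcoeff_outdom ->.
  by rewrite mulr0 monalgU0.
move=> k _ /mcoeff_outdom g1k.
by rewrite big1 => // k' _; rewrite g1k mul0r monalgU0.
Qed.

Lemma pmulC : commutative pmul.
Proof.
move=> g1 g2; rewrite !pmul.unlock exchange_big; apply: eq_bigr => k2 _.
by apply: eq_bigr => k1 _; rewrite mulrC mulmC.
Qed.

Lemma pmul0 : left_zero 0 pmul.
Proof. by move=> g; rewrite !pmul.unlock msupp0 big_seq_fset0. Qed.

Lemma pmulr0 : right_zero 0 pmul.
Proof. by move=> g; rewrite pmulC pmul0. Qed.

Lemma pmulUg c k g :
  pmul << c *g k >> g = \sum_(l <- msupp g) << c * g@_l *g (mmul k l) >>.
Proof.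
rewrite (pmullw msuppU_le (fsubset_refl _)) big_seq_fset1.
by apply/eq_bigr => l _; rewrite mcoeffUU.
Qed.

Lemma pmulgU c k g :
  pmul g << c *g k >> = \sum_(l <- msupp g) << g@_l * c *g (mmul l k) >>.
Proof.
rewrite pmulC pmulUg; apply: eq_bigr => l _.
by rewrite mulrC [mmul _ _]mulmC.
Qed.

Lemma pmulUU c1 c2 k1 k2 :
  pmul << c1 *g k1 >> << c2 *g k2 >> = << c1 * c2 *g (mmul k1 k2) >>.
Proof. by rewrite (pmullw msuppU_le msuppU_le) !big_seq_fset1 !mcoeffUU. Qed.

Lemma pmul1 : left_id pone pmul.
Proof.
move=> g; rewrite pmulUg [RHS]monalgE.
by apply/eq_bigr=> k _; rewrite mul1r mul1m.
Qed.

Lemma pmulDl : left_distributive pmul +%R.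
Proof.
move=> g1 g2 g.
rewrite [in RHS](pmullw (fsubsetUl _ (msupp g2)) (fsubset_refl _)).
rewrite [in RHS](pmullw (fsubsetUr (msupp g1) _) (fsubset_refl _)).
rewrite (pmullw (msuppD_le _ _) (fsubset_refl _)).
rewrite -big_split /=; apply/eq_bigr=> k1 _.
rewrite -big_split /=; apply/eq_bigr=> k2 _.
by rewrite mcoeffD mulrDl monalgUD.
Qed.

Lemma pmulDr : right_distributive pmul +%R.
Proof. by move=> g g1 g2; rewrite ![pmul g _]pmulC pmulDl. Qed.

Lemma malg_indU (Q : P -> Prop) : Q 0 -> (forall x y, Q x -> Q y -> Q (x + y)) ->
  (forall c k, Q << c *g k >>) -> forall g, Q g.
Proof.
by move=> Q0 QD QU g; rewrite [g]monalgE; apply: big_ind => // k _.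
Qed.

Lemma pmulA : associative pmul.
Proof.
move=> g1 g2 g3; elim/malg_indU: g1 => [|x y IHx IHy|c1 k1].
- by rewrite !pmul0.
- by rewrite !pmulDl IHx IHy.
move Eu: << c1 *g k1 >> => u.
elim/malg_indU: g2 => [|x y IHx IHy|c2 k2].
- by rewrite pmul0 pmulr0 pmul0.
- by rewrite pmulDl !pmulDr IHx IHy pmulDl.
move Ev: << c2 *g k2 >> => v.
elim/malg_indU: g3 => [|x y IHx IHy|c3 k3].
- by rewrite (pmulr0 v) (pmulr0 u) (pmulr0 (pmul u v)).
- by rewrite !pmulDr IHx IHy.
move Ew: << c3 *g k3 >> => w.
have -> : pmul v w = << c2 * c3 *g mmul k2 k3 >> by rewrite -Ev -Ew pmulUU.
have -> : pmul u v = << c1 * c2 *g mmul k1 k2 >> by rewrite -Eu -Ev pmulUU.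
by rewrite -Eu -Ew [LHS]pmulUU [RHS]pmulUU mulrA mulmA.
Qed.
End PolyAlgProduct.

Definition polyalg (R : comPzRingType) (I : choiceType) : Type :=
  {malg R[{cmonom I}]}.

HB.lock Definition pconst (R : comPzRingType) (I : choiceType) (b : R) :
  polyalg R I := << b *g (mone : {cmonom I}) >>.
HB.lock Definition pvar (R : comPzRingType) (I : choiceType) (i : I) :
  polyalg R I := << 1 *g (ucm i : {cmonom I}) >>.

Section PolyAlg.
Variables (R : comPzRingType) (I : choiceType).
Local Notation K := {cmonom I}.
Local Notation P := (polyalg R I).

HB.instance Definition _ := GRing.Zmodule.copy P {malg R[K]}.
HB.instance Definition _ := GRing.Zmodule_isComPzRing.Build P
  (@pmulA R I) (@pmulC R I) (@pmul1 R I) (@pmulDl R I).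

Local Notation pconst := (@pconst R I).

Lemma pconst_is_additive : GRing.zmod_morphism pconst.
Proof. by move=> x y; rewrite pconst.unlock monalgUB. Qed.

Lemma pconst_is_multiplicative : GRing.monoid_morphism pconst.
Proof.
by rewrite pconst.unlock; split => // x y; rewrite -[RHS]/(pmul _ _) pmulUU mul1m.
Qed.

HB.instance Definition _ := GRing.isZmodMorphism.Build R P pconst
  pconst_is_additive.
HB.instance Definition _ := GRing.isMonoidMorphism.Build R P pconst
  pconst_is_multiplicative.
End PolyAlg.

Section PolyAlgEval.
Variables (R : comPzRingType) (I : choiceType) (S : comPzRingType).
Variables (f : {rmorphism R -> S}) (v : I -> S).
Local Notation K := {cmonom I}.

Definition meval (k : K) : S := \prod_(i <- finsupp k) v i ^+ k i.

Lemma mevalw (d : {fset I}) (k : K) : (finsupp k `<=` d)%fset ->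
  meval k = \prod_(i <- d) v i ^+ k i.
Proof.
move=> le; rewrite /meval (big_fset_incl _ le) // => i _.
by rewrite -cmE_neq0 negbK => /eqP ->; rewrite expr0.
Qed.

Lemma mevalM (k l : K) : meval (mmul k l) = meval k * meval l.
Proof.
rewrite [meval (mmul k l)]/meval mdomD.
rewrite (mevalw (fsubsetUl (finsupp k) (finsupp l))).
rewrite (mevalw (fsubsetUr (finsupp k) (finsupp l))) -big_split /=.
by apply: eq_bigr => i _; rewrite cmM exprD.
Qed.

Lemma meval1 : meval mone = 1.
Proof. by rewrite /meval mdom1 big_seq_fset0. Qed.

Lemma mevalU i : meval (ucm i) = v i.
Proof. by rewrite /meval mdomU big_seq_fset1 cmUU expr1. Qed.

(* Evaluation: the extension of [f] sending the variable [i] to [v i].        *)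
Definition peval (g : polyalg R I) : S :=
  \sum_(k <- msupp g) f g@_k * meval k.

Lemma pevalw (d : {fset K}) (g : polyalg R I) : (msupp g `<=` d)%fset ->
  peval g = \sum_(k <- d) f g@_k * meval k.
Proof.
move=> le; rewrite [LHS](big_fset_incl _ le) // => x xd /mcoeff_outdom ->.
by rewrite rmorph0 mul0r.
Qed.

Lemma peval_is_additive : GRing.zmod_morphism peval.
Proof.
move=> g1 g2; pose d := (msupp g1 `|` msupp g2 `|` msupp (g1 - g2))%fset.
rewrite !(@pevalw d) /d ?fsubsetUr //.
- rewrite -sumrB; apply/eq_bigr=> k _.
  by rewrite mcoeffB rmorphB mulrBl.
- by rewrite -fsetUA (fsetUCA (msupp g1)) fsubsetUl.
- by rewrite -fsetUA fsubsetUl.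
Qed.

HB.instance Definition _ := GRing.isZmodMorphism.Build (polyalg R I) S peval
  peval_is_additive.

Lemma pevalU c k : peval << c *g k >> = f c * meval k.
Proof. by rewrite (pevalw msuppU_le) big_seq_fset1 mcoeffUU. Qed.

Lemma peval_is_multiplicative : GRing.monoid_morphism peval.
Proof.
split => [|g1 g2]; first by rewrite pevalU rmorph1 meval1 mulr1.
rewrite -[g1 * g2]/(pmul _ _) pmul.unlock raddf_sum mulr_suml; apply: eq_bigr=> i _.
rewrite raddf_sum mulr_sumr; apply: eq_bigr=> j _.
by rewrite [LHS]pevalU rmorphM mevalM mulrACA.
Qed.

HB.instance Definition _ := GRing.isMonoidMorphism.Build (polyalg R I) S peval
  peval_is_multiplicative.

Lemma peval_const c : peval (pconst I c) = f c.
Proof. by rewrite pconst.unlock pevalU meval1 mulr1. Qed.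

Lemma peval_var i : peval (pvar R i) = v i.
Proof. by rewrite pvar.unlock pevalU rmorph1 mul1r mevalU. Qed.
End PolyAlgEval.

(** * Ideals and quotient rings *)

Record ideal (A : comPzRingType) := Ideal {
  ideal_set :> A -> Prop;
  ideal_0 : ideal_set 0;
  ideal_add : forall x y, ideal_set x -> ideal_set y -> ideal_set (x + y);
  ideal_mul : forall a x, ideal_set x -> ideal_set (a * x) }.

Section IdealGen.
Variables (A : comPzRingType) (G : set A).

Definition ideal_gen_set : set A :=
  [set x | forall J : ideal A, (forall y, G y -> J y) -> J x].

Lemma ideal_gen_0 : ideal_gen_set 0.
Proof. by move=> J _; exact: ideal_0. Qed.

Lemma ideal_gen_add x y :
  ideal_gen_set x -> ideal_gen_set y -> ideal_gen_set (x + y).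
Proof. by move=> hx hy J GJ; apply: ideal_add; [exact: hx|exact: hy]. Qed.

Lemma ideal_gen_mul a x : ideal_gen_set x -> ideal_gen_set (a * x).
Proof. by move=> hx J GJ; apply: ideal_mul; exact: hx. Qed.

Definition ideal_gen : ideal A :=
  Ideal ideal_gen_0 ideal_gen_add ideal_gen_mul.
End IdealGen.

Section QuotientRing.
Variables (A : comPzRingType) (J : ideal A).

Definition ideal_pred : {pred A} := fun x => `[< J x >].

Lemma ideal_predE x : (x \in ideal_pred) = `[< J x >]. Proof. by []. Qed.

Lemma ideal_pred_closed : zmod_closed ideal_pred.
Proof.
split=> [|x y]; rewrite !ideal_predE; first exact/asboolP/ideal_0.
move=> /asboolP Jx /asboolP Jy; apply/asboolP.
by apply: ideal_add => //; rewrite -mulN1r; exact: ideal_mul.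
Qed.

HB.instance Definition _ :=
  GRing.isZmodClosed.Build A ideal_pred ideal_pred_closed.

Definition quotring : Type := Quotient.quot ideal_pred.

HB.instance Definition _ := GRing.Zmodule.copy quotring
  (Quotient.quot ideal_pred).

Definition qcls (x : A) : quotring := \pi_(Quotient.quot ideal_pred) x.

Lemma qclsP x y : qcls x = qcls y <-> J (x - y).
Proof.
split=> [/eqP|h]; first by rewrite -Quotient.idealrBE => /asboolP.
by apply/eqP; rewrite -Quotient.idealrBE; exact/asboolP.
Qed.

Lemma qcls_surj (z : quotring) : exists x, z = qcls x.
Proof. by exists (repr z); rewrite /qcls reprK. Qed.

Lemma qclsD x y : qcls x + qcls y = qcls (x + y).
Proof. exact: (esym (Quotient.pi_add _ _ _)). Qed.

Definition qrepr (z : quotring) : A := sval (cid (qcls_surj z)).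

Lemma qreprK z : qcls (qrepr z) = z.
Proof. by rewrite /qrepr; case: cid => x /= ->. Qed.

Definition qone : quotring := qcls 1.
Definition qmul (z w : quotring) : quotring := qcls (qrepr z * qrepr w).

Lemma qclsM x y : qmul (qcls x) (qcls y) = qcls (x * y).
Proof.
apply/qclsP; set x' := qrepr _; set y' := qrepr _.
have -> : x' * y' - x * y = y' * (x' - x) + x * (y' - y).
  by rewrite !mulrBr (mulrC y' x') (mulrC y' x) addrA subrK.
by apply: ideal_add; apply: ideal_mul; apply/qclsP; rewrite qreprK.
Qed.

Lemma qmulA : associative qmul.
Proof.
move=> u v w; have [[x ->] [y ->] [z ->]] :=
  And3 (qcls_surj u) (qcls_surj v) (qcls_surj w).
by rewrite !qclsM mulrA.
Qed.

Lemma qmulC : commutative qmul.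
Proof. by move=> u v; rewrite /qmul mulrC. Qed.

Lemma qmul1 : left_id qone qmul.
Proof. by move=> u; have [x ->] := qcls_surj u; rewrite qclsM mul1r. Qed.

Lemma qmulDl : left_distributive qmul +%R.
Proof.
move=> u v w; have [[x ->] [y ->] [z ->]] :=
  And3 (qcls_surj u) (qcls_surj v) (qcls_surj w).
by rewrite qclsD !qclsM qclsD mulrDl.
Qed.

HB.instance Definition _ := GRing.Zmodule_isComPzRing.Build quotring
  qmulA qmulC qmul1 qmulDl.

Lemma qcls_is_additive : GRing.zmod_morphism qcls.
Proof.
by move=> x y; apply/eqP; rewrite eq_sym subr_eq qclsD subrK.
Qed.

Lemma qcls_is_multiplicative : GRing.monoid_morphism qcls.
Proof. by split => // x y; rewrite -qclsM. Qed.

HB.instance Definition _ := GRing.isZmodMorphism.Build A quotring qcls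
  qcls_is_additive.
HB.instance Definition _ := GRing.isMonoidMorphism.Build A quotring qcls
  qcls_is_multiplicative.
End QuotientRing.

Section QuotientLift.
Variables (A : comPzRingType) (J : ideal A) (S : comPzRingType).
Variables (f : {rmorphism A -> S}) (fJ : forall x, J x -> f x = 0).

Definition qlift of (forall x, J x -> f x = 0) := fun z : quotring J => f (qrepr z).

Lemma qlift_cls x : qlift fJ (qcls J x) = f x.
Proof.
apply/eqP; rewrite -subr_eq0 -rmorphB; apply/eqP/fJ.
by apply/qclsP; rewrite qreprK.
Qed.

Lemma qlift_is_additive : GRing.zmod_morphism (qlift fJ).
Proof.
move=> u v; have [[x ->] [y ->]] := conj (qcls_surj u) (qcls_surj v).
by rewrite -rmorphB !qlift_cls rmorphB.
Qed.

Lemma qlift_is_multiplicative : GRing.monoid_morphism (qlift fJ).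
Proof.
split=> [|u v]; first by rewrite -(rmorph1 (qcls J)) qlift_cls rmorph1.
have [[x ->] [y ->]] := conj (qcls_surj u) (qcls_surj v).
by rewrite -rmorphM !qlift_cls rmorphM.
Qed.

HB.instance Definition _ := GRing.isZmodMorphism.Build (quotring J) S
  (qlift fJ) qlift_is_additive.
HB.instance Definition _ := GRing.isMonoidMorphism.Build (quotring J) S
  (qlift fJ) qlift_is_multiplicative.
End QuotientLift.

(** * Hasse-Schmidt algebras *)

(* [m : option nat] encodes an element of $\mathbb N\cup\{\infty\}$, with
   [None] for $\infty$.                                                       *)
Definition le_order (m : option nat) (k : nat) : bool :=
  if m is Some n then (k <= n)%N else true.

Definition hs_index (m : option nat) : choiceType :=
  {i : nat | (0 < i)%N && le_order m i}.

Section HS.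
Variables (m : option nat) (A B : comPzRingType) (f : {rmorphism A -> B}).

Definition hs_poly : comPzRingType := polyalg B (B * hs_index m)%type.

Definition hs_var (x : B) (i : hs_index m) : hs_poly := pvar B (x, i).

(* The symbol x^(i) for any natural i: the constant x for i = 0, the variable
   for 1 <= i <= m; the value 0 for i > m is never used.                      *)
Definition hs_sym (x : B) (i : nat) : hs_poly :=
  if i == 0%N then pconst (B * hs_index m)%type x
  else if insub i is Some j then hs_var x j else 0.

Definition hs_relations : set hs_poly := [set r |
  [\/ exists x y i, r = hs_var (x + y) i - hs_var x i - hs_var y i,
      exists a i, r = hs_var (f a) i
    | exists x y k, le_order m k /\
        r = hs_sym (x * y) k
            - \sum_(i < k.+1) hs_sym x i * hs_sym y (k - i)%N]].

Definition HS : comPzRingType := quotring (ideal_gen hs_relations).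

(* The structure morphism of the B-algebra HS.                                *)
Definition hs_const : {rmorphism B -> HS} :=
  qcls (ideal_gen hs_relations) \o pconst (B * hs_index m)%type.

Definition hs_d (i : nat) (x : B) : HS :=
  qcls (ideal_gen hs_relations) (hs_sym x i).
End HS.

Section HSTheory.
Variables (m : option nat) (A B : comPzRingType) (f : {rmorphism A -> B}).

Lemma hs_rel0 r : @hs_relations m A B f r ->
  qcls (ideal_gen (@hs_relations m A B f)) r = 0.
Proof.
move=> hr; rewrite -(rmorph0 (qcls _)); apply/qclsP.
by rewrite subr0 => J; apply.
Qed.

Lemma hs_d0 x : hs_d m f 0 x = hs_const m f x. Proof. by []. Qed.

Lemma hs_d_var x (i : hs_index m) :
  hs_d m f (val i) x = qcls (ideal_gen (@hs_relations m A B f)) (hs_var x i).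
Proof.
rewrite /hs_d /hs_sym; case: eqP => [i0|_].
  by exfalso; have := valP i; rewrite i0.
by rewrite valK.
Qed.

Lemma hs_dD (i : hs_index m) x y :
  hs_d m f (val i) (x + y) = hs_d m f (val i) x + hs_d m f (val i) y.
Proof.
rewrite !hs_d_var -rmorphD; apply/eqP; rewrite -subr_eq0 -rmorphB; apply/eqP.
by apply: hs_rel0; apply: Or31; exists x, y, i; rewrite opprD addrA.
Qed.

Lemma hs_d_base (i : hs_index m) a : hs_d m f (val i) (f a) = 0.
Proof. by rewrite hs_d_var; apply: hs_rel0; apply: Or32; exists a, i. Qed.

Lemma hs_dM k x y : le_order m k -> hs_d m f k (x * y)
  = \sum_(i < k.+1) hs_d m f i x * hs_d m f (k - i)%N y.
Proof.
move=> km; apply/eqP; rewrite -subr_eq0.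
rewrite /hs_d; under eq_bigr do rewrite -rmorphM.
rewrite -rmorph_sum -rmorphB; apply/eqP/hs_rel0/Or33.
by exists x, y, k.
Qed.
End HSTheory.

Section HSMap.
Variables (m : option nat) (A B A' B' : comPzRingType).
Variables (f : {rmorphism A -> B}) (f' : {rmorphism A' -> B'}).
Variables (g : {rmorphism A -> A'}) (h : {rmorphism B -> B'}).
Hypothesis sq : forall a, h (f a) = f' (g a).

Definition hs_poly_map : {rmorphism hs_poly m B -> HS m f'} :=
  peval (hs_const m f' \o h) (fun u => hs_d m f' (val u.2) (h u.1)).

Lemma hs_poly_map_var x i : hs_poly_map (hs_var x i) = hs_d m f' (val i) (h x).
Proof. exact: peval_var. Qed.

Lemma hs_poly_map_sym x i : le_order m i ->
  hs_poly_map (hs_sym m x i) = hs_d m f' i (h x).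
Proof.
rewrite /hs_sym => im; case: eqP => [->|/eqP i0]; first exact: peval_const.
have ip : (0 < i)%N && le_order m i by rewrite lt0n i0.
by rewrite (insubT (fun i => (0 < i)%N && le_order m i) ip) hs_poly_map_var.
Qed.

Lemma hs_poly_map_rel r : hs_relations f r -> hs_poly_map r = 0.
Proof.
case=> [[x [y [i ->]]]|[a [i ->]]|[x [y [k [km ->]]]]].
- by rewrite !rmorphB !hs_poly_map_var rmorphD hs_dD addrAC addrK subrr.
- by rewrite hs_poly_map_var sq hs_d_base.
rewrite rmorphB hs_poly_map_sym // rmorphM hs_dM // rmorph_sum.
apply/eqP; rewrite subr_eq0; apply/eqP; apply: eq_bigr => i _.
have le_km j : (j <= k)%N -> le_order m j.
  by move: km; rewrite /le_order; case: (m) => // n kn /leq_trans; apply.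
rewrite rmorphM !hs_poly_map_sym //; first exact/le_km/leq_subr.
by apply: le_km; rewrite -ltnS.
Qed.

Lemma hs_poly_map_ideal r :
  ideal_gen (@hs_relations m A B f) r -> hs_poly_map r = 0.
Proof.
pose kerI : ideal (hs_poly m B) := @Ideal _ [set x | hs_poly_map x = 0]
  (rmorph0 _)
  (fun x y (hx : hs_poly_map x = 0) (hy : hs_poly_map y = 0) =>
     etrans (rmorphD _ x y) (etrans (congr2 _ hx hy) (addr0 _)))
  (fun a x (hx : hs_poly_map x = 0) =>
     etrans (rmorphM _ a x) (etrans (congr1 _ hx) (mulr0 _))).
by move=> /(_ kerI); apply => x; exact: hs_poly_map_rel.
Qed.

(* The morphism HS_{B/A} -> HS_{B'/A'} sending b to h b and d_i x to
   d_i (h x).                                                                 *)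
Definition hs_map : {rmorphism HS m f -> HS m f'} := qlift hs_poly_map_ideal.

Lemma hs_map_d i x : le_order m i ->
  hs_map (hs_d m f i x) = hs_d m f' i (h x).
Proof. by move=> im; rewrite [LHS]qlift_cls hs_poly_map_sym. Qed.

Lemma hs_map_const x : hs_map (hs_const m f x) = hs_const m f' (h x).
Proof. by rewrite -!hs_d0 hs_map_d //; rewrite /le_order; case: m. Qed.
End HSMap.

(** * Localization *)

Record mulset (A : comPzRingType) := MulSet {
  mulset_set :> A -> Prop;
  mulset1 : mulset_set 1;
  mulsetM : forall s t, mulset_set s -> mulset_set t -> mulset_set (s * t) }.

Section LocMod.
Variables (A : comPzRingType) (S : mulset A) (M : lmodType A).

Definition denom : Type := set_type (S : set A).
HB.instance Definition _ := Choice.copy denom (set_type (S : set A)).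

Definition mkden (s : A) (hs : S s) : denom := exist _ s (mem_set hs).
Definition den (s : denom) : A := sval s.
Lemma denP (s : denom) : S (den s). Proof. exact: (set_mem (svalP s)). Qed.

Definition loc_rel (x y : M * denom) : bool :=
  `[< exists u, S u /\
        u *: (den y.2 *: x.1) = u *: (den x.2 *: y.1) >].

Lemma loc_rel_equiv : equiv_class_of loc_rel.
Proof.
split=> [x|x y|y x z].
- by apply/asboolP; exists 1; split => //; exact: mulset1.
- by apply/asboolP/asboolP => -[u [Su e]]; exists u; rewrite e.
move=> /asboolP[u [Su exy]] /asboolP[v [Sv eyz]]; apply/asboolP.
exists (u * v * den y.2); split.
  by apply: mulsetM; [exact: mulsetM|exact: denP].
move: x y z exy eyz => [x s] [y t] [z w] /= exy eyz.
transitivity ((v * den w) *: (u *: (den t *: x))).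
  by rewrite !scalerA; congr (_ *: _); ring.
rewrite exy.
transitivity ((u * den s) *: (v *: (den w *: y))).
  by rewrite !scalerA; congr (_ *: _); ring.
by rewrite eyz !scalerA; congr (_ *: _); ring.
Qed.

Canonical loc_equiv := EquivRelPack loc_rel_equiv.
Canonical loc_enc := defaultEncModRel loc_rel.

(* The module S^{-1}M.                                                        *)
Definition locmod : Type := {eq_quot loc_rel}.
HB.instance Definition _ := Choice.copy locmod {eq_quot loc_rel}.

Definition mfrac (x : M) (s : A) (hs : S s) : locmod :=
  \pi_({eq_quot loc_rel}) (x, mkden hs).

Lemma fracP x s hs y t ht : @mfrac x s hs = @mfrac y t ht <->
  exists u, S u /\ u *: (t *: x) = u *: (s *: y).
Proof.
split=> [/eqmodP/asboolP //|e].
exact/eqmodP/asboolP.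
Qed.

Lemma frac_ex (z : locmod) : exists x s (hs : S s), z = mfrac x hs.
Proof.
have <- := reprK (z : {eq_quot loc_rel}).
case: (repr _) => x s; exists x, (den s), (denP s).
by apply/eqmodP/asboolP; exists 1; split => //; exact: mulset1.
Qed.

Lemma frac_irr x s hs hs' : @mfrac x s hs = @mfrac x s hs'.
Proof. by congr mfrac; exact: Prop_irrelevance. Qed.

Lemma fracE x s hs y t ht : t *: x = s *: y -> @mfrac x s hs = @mfrac y t ht.
Proof. by move=> e; apply/fracP; exists 1; rewrite e; split=> //; exact: mulset1. Qed.

Definition lnum (z : locmod) : M := (repr (z : {eq_quot loc_rel})).1.
Definition lden (z : locmod) : A := den (repr (z : {eq_quot loc_rel})).2.
Lemma ldenP z : S (lden z). Proof. exact: denP. Qed.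
Lemma lreprK z : mfrac (lnum z) (ldenP z) = z.
Proof.
rewrite -[RHS]reprK; apply/eqmodP/asboolP; exists 1.
by split => //; exact: mulset1.
Qed.

Definition ladd (z w : locmod) : locmod :=
  mfrac (lden w *: lnum z + lden z *: lnum w) (mulsetM (ldenP z) (ldenP w)).
Definition lopp (z : locmod) : locmod := mfrac (- lnum z) (ldenP z).
Definition lzero : locmod := mfrac 0 (mulset1 S).

Lemma fracD x s hs y t ht : ladd (@mfrac x s hs) (@mfrac y t ht)
  = mfrac (t *: x + s *: y) (mulsetM hs ht).
Proof.
rewrite /ladd; move: (lreprK (mfrac x hs)) (lreprK (mfrac y ht)).
move: (lnum _) (lden _) (ldenP _) => x' s' hs'.
move: (lnum _) (lden _) (ldenP _) => y' t' ht'.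
move=> /fracP[u [Su eu]] /fracP[v [Sv ev]].
apply/fracP; exists (u * v); split; first exact: mulsetM.
rewrite !scalerDr; congr (_ + _).
- transitivity ((v * t * t') *: (u *: (s *: x'))).
    by rewrite !scalerA; congr (_ *: _); ring.
  by rewrite eu !scalerA; congr (_ *: _); ring.
- transitivity ((u * s * s') *: (v *: (t *: y'))).
    by rewrite !scalerA; congr (_ *: _); ring.
  by rewrite ev !scalerA; congr (_ *: _); ring.
Qed.

Lemma fracN x s hs : lopp (@mfrac x s hs) = mfrac (- x) hs.
Proof.
rewrite /lopp; move: (lreprK (mfrac x hs)).
move: (lnum _) (lden _) (ldenP _) => x' s' hs' /fracP[u [Su eu]].
by apply/fracP; exists u; split => //; rewrite !scalerN eu.
Qed.

Lemma laddC : commutative ladd.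
Proof.
move=> z w; have [x [s [hs ->]]] := frac_ex z; have [y [t [ht ->]]] := frac_ex w.
by rewrite !fracD; apply: fracE; rewrite addrC mulrC.
Qed.

Lemma laddA : associative ladd.
Proof.
move=> z w v; have [x [s [hs ->]]] := frac_ex z.
have [y [t [ht ->]]] := frac_ex w; have [q [r [hr ->]]] := frac_ex v.
rewrite !fracD; apply: fracE; rewrite mulrA; congr (_ *: _).
rewrite !scalerDr !scalerA addrA.
by congr (_ *: _ + _ *: _ + _ *: _); rewrite mulrC.
Qed.

Lemma ladd0 : left_id lzero ladd.
Proof.
move=> z; have [x [s [hs ->]]] := frac_ex z.
by rewrite fracD; apply: fracE; rewrite scaler0 add0r scale1r mul1r.
Qed.

Lemma laddN : left_inverse lzero lopp ladd.
Proof.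
move=> z; have [x [s [hs ->]]] := frac_ex z.
by rewrite fracN fracD; apply: fracE; rewrite scalerN addNr !scaler0.
Qed.

HB.instance Definition _ := GRing.isZmodule.Build locmod laddA laddC ladd0 laddN.
End LocMod.

Arguments locmod {A} S M.

(* The action of S^{-1}A on S^{-1}M; for M = A it is the product of
   S^{-1}A.                                                                   *)
Section LocScale.
Variables (A : comPzRingType) (S : mulset A) (M : lmodType A).

Definition lscale (a : locmod S A^o) (z : locmod S M) : locmod S M :=
  mfrac ((lnum a : A) *: lnum z) (mulsetM (ldenP a) (ldenP z)).

Lemma fracZ (a s : A) hs x t ht : lscale (@mfrac _ S A^o a s hs) (@mfrac _ S M x t ht)
  = mfrac (a *: x) (mulsetM hs ht).
Proof.
rewrite /lscale.
move: (lreprK (@mfrac _ S A^o a s hs)) (lreprK (@mfrac _ S M x t ht)).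
move: (lnum _) (lden _) (ldenP _) => a' s' hs'.
move: (lnum _) (lden _) (ldenP _) => x' t' ht'.
move=> /fracP[u [Su eu]] /fracP[v [Sv ev]].
apply/fracP; exists (u * v); split; first exact: mulsetM.
transitivity ((u * (s * a')) *: (v *: (t *: x'))).
  by rewrite !scalerA; congr (_ *: _); ring.
have -> : u * (s * a') = u * (s' * a) by exact: eu.
by rewrite ev !scalerA; congr (_ *: _); ring.
Qed.

Lemma lscaleDr a : {morph lscale a : z w / z + w}.
Proof.
move=> z w; have [b [r [hr ->]]] := frac_ex a.
have [x [s [hs ->]]] := frac_ex z; have [y [t [ht ->]]] := frac_ex w.
rewrite -[_ + mfrac y ht]/(ladd _ _) fracD !fracZ.
rewrite -[RHS]/(ladd _ _) fracD; apply: fracE.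
by rewrite !scalerDr !scalerA; congr (_ *: _ + _ *: _); ring.
Qed.

Lemma lscaleDl z : {morph lscale^~ z : a b / a + b}.
Proof.
move=> a b; have [x [s [hs ->]]] := frac_ex z.
have [a' [r [hr ->]]] := frac_ex a; have [b' [t [ht ->]]] := frac_ex b.
rewrite -[_ + mfrac b' ht]/(ladd _ _) fracD !fracZ.
rewrite -[RHS]/(ladd _ _) fracD; apply: fracE.
have e (p q : A) : p *: (q : A^o) = p * q by [].
by rewrite !e !scalerDr !scalerA -scalerDl; congr (_ *: _); ring.
Qed.
End LocScale.

Section LocRing.
Variables (A : comPzRingType) (S : mulset A).

(* The ring S^{-1}A.                                                          *)
Definition loc : Type := locmod S A^o.
HB.instance Definition _ := GRing.Zmodule.copy loc (locmod S A^o).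

Definition lone : loc := @mfrac _ S A^o 1 1 (mulset1 S).

Lemma lmulA : associative (@lscale A S A^o).
Proof.
move=> z w v; have [x [s [hs ->]]] := frac_ex z.
have [y [t [ht ->]]] := frac_ex w; have [q [r [hr ->]]] := frac_ex v.
have e (p c : A) : p *: (c : A^o) = p * c by [].
by rewrite !fracZ; apply: fracE; rewrite !e; ring.
Qed.

Lemma lmulC : commutative (@lscale A S A^o).
Proof.
move=> z w; have [x [s [hs ->]]] := frac_ex z.
have [y [t [ht ->]]] := frac_ex w; rewrite !fracZ; apply: fracE.
by congr (_ * _); exact: mulrC.
Qed.

Lemma lmul1 : left_id lone (@lscale A S A^o).
Proof.
move=> z; have [x [s [hs ->]]] := frac_ex z.
by rewrite fracZ; apply: fracE; rewrite scale1r mul1r.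
Qed.

HB.instance Definition _ := GRing.Zmodule_isComPzRing.Build loc
  lmulA lmulC lmul1 (fun x y z => lscaleDl z x y).

Definition loc_frac (a s : A) (hs : S s) : loc := @mfrac _ S A^o a s hs.
Definition loc_const (a : A) : loc := loc_frac a (mulset1 S).

Lemma loc_const_is_additive : GRing.zmod_morphism loc_const.
Proof.
move=> x y; apply/eqP; rewrite eq_sym subr_eq; apply/eqP.
rewrite -[RHS]/(ladd _ _) fracD; apply: fracE.
by rewrite !scale1r subrK mulr1 scale1r.
Qed.

Lemma loc_const_is_multiplicative : GRing.monoid_morphism loc_const.
Proof.
split=> // x y; rewrite -[RHS]/(lscale _ _) fracZ; apply: fracE.
by rewrite mulr1.
Qed.

HB.instance Definition _ := GRing.isZmodMorphism.Build A loc loc_const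
  loc_const_is_additive.
HB.instance Definition _ := GRing.isMonoidMorphism.Build A loc loc_const
  loc_const_is_multiplicative.
End LocRing.

Section LocLift.
Variables (A A' : comPzRingType) (S : mulset A) (g : {rmorphism A -> A'}).

Definition inverts : Prop := forall s, S s -> exists t, g s * t = 1.

Hypothesis gS : inverts.

(* The morphism S^{-1}A -> A' extending g.                                    *)
Definition loc_lift (z : loc S) : A' :=
  g (lnum z : A) * sval (cid (gS (ldenP z))).

Lemma loc_lift_frac (x s : A) (hs : S s) :
  g s * loc_lift (@mfrac _ S A^o x s hs) = g x.
Proof.
rewrite /loc_lift; case: cid => t /=.
move: (lreprK (@mfrac _ S A^o x s hs)).
move: (lnum _) (lden _) (ldenP _) => x' s' hs' /fracP[u [Su eu]] et.
have {eu} : g u * (g s * g x') = g u * (g s' * g x).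
  by rewrite -!rmorphM; congr (g _); exact: eu.
have [v ev] := gS Su => /(congr1 ( *%R v)).
rewrite !mulrA (mulrC v) ev !mul1r => ->.
by rewrite mulrAC et mul1r.
Qed.

Lemma loc_liftP (z : loc S) (x s : A) (hs : S s) y :
  z = @mfrac _ S A^o x s hs -> g s * y = g x -> loc_lift z = y.
Proof.
move=> -> e; have [t et] := gS hs.
have := loc_lift_frac x hs; rewrite -e => /(congr1 ( *%R t)).
by rewrite !mulrA (mulrC t) et !mul1r.
Qed.

Lemma loc_lift_is_additive : GRing.zmod_morphism (loc_lift).
Proof.
have liftD z w : loc_lift (z + w) = loc_lift z + loc_lift w.
  have [x [s [hs ->]]] := frac_ex z; have [y [t [ht ->]]] := frac_ex w.
  apply: (loc_liftP (fracD _ _ _ _)); rewrite mulrDr rmorphM.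
  rewrite -mulrA mulrCA loc_lift_frac -mulrA loc_lift_frac.
  by rewrite -!rmorphM -rmorphD.
move=> z w; apply/eqP; rewrite eq_sym subr_eq -liftD subrK //.
Qed.

Lemma loc_lift_is_multiplicative : GRing.monoid_morphism (loc_lift).
Proof.
split=> [|z w].
  by apply: (loc_liftP (erefl : 1 = lone S)); rewrite rmorph1 mulr1.
have [x [s [hs ->]]] := frac_ex z; have [y [t [ht ->]]] := frac_ex w.
apply: (loc_liftP (fracZ _ _ _ _)); rewrite !rmorphM.
by rewrite mulrACA !loc_lift_frac -rmorphM.
Qed.

HB.instance Definition _ := GRing.isZmodMorphism.Build (loc S) A'
  (loc_lift) loc_lift_is_additive.
HB.instance Definition _ := GRing.isMonoidMorphism.Build (loc S) A'
  (loc_lift) loc_lift_is_multiplicative.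

Lemma loc_lift_const a : loc_lift (loc_const S a) = g a.
Proof. by apply: (loc_liftP erefl); rewrite rmorph1 mul1r. Qed.
End LocLift.

Section MulsetImage.
Variables (A A' : comPzRingType) (g : {rmorphism A -> A'}) (S : mulset A).

Lemma mulset_image1 : exists2 s, S s & g s = 1.
Proof. by exists 1; [exact: mulset1|exact: rmorph1]. Qed.

Lemma mulset_imageM x y : (exists2 s, S s & g s = x) ->
  (exists2 s, S s & g s = y) -> exists2 s, S s & g s = x * y.
Proof.
move=> [s Ss <-] [t St <-]; exists (s * t); first exact: mulsetM.
exact: rmorphM.
Qed.

Definition mulset_image : mulset A' :=
  @MulSet A' (fun x => exists2 s, S s & g s = x) mulset_image1 mulset_imageM.

Definition mulset_image_in s (Ss : S s) : mulset_image (g s) :=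
  ex_intro2 _ _ s Ss erefl.
End MulsetImage.

(* g : A -> A' exhibits A' as S^{-1}A: the induced map S^{-1}A -> A' is an
   isomorphism.                                                               *)
Definition is_localization (A A' : comPzRingType) (S : mulset A)
    (g : {rmorphism A -> A'}) : Prop :=
  exists gS : inverts S g, bijective (loc_lift gS).

Lemma is_localization_inverts (A A' : comPzRingType) (S : mulset A)
  (g : {rmorphism A -> A'}) : is_localization S g -> inverts S g.
Proof. by case. Qed.

(** * Sheaves of commutative rings *)

Record opens (X : topologicalType) := Opens {
  opens_set :> X -> Prop;
  opens_open : open (opens_set : set X) }.

Definition osub (X : topologicalType) (V U : opens X) : Prop :=
  forall x, V x -> U x.
Notation "V ⊆ U" := (osub V U) (at level 70, no associativity).

Lemma osub_refl (X : topologicalType) (U : opens X) : U ⊆ U.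
Proof. by []. Qed.

Lemma osub_trans (X : topologicalType) (U V W : opens X) :
  W ⊆ V -> V ⊆ U -> W ⊆ U.
Proof. by move=> WV VU x /WV /VU. Qed.

Definition ocap (X : topologicalType) (U V : opens X) : opens X :=
  @Opens X ((U : set X) `&` (V : set X)) (openI (opens_open U) (opens_open V)).

Lemma ocapl (X : topologicalType) (U V : opens X) : ocap U V ⊆ U.
Proof. by move=> x []. Qed.

Lemma ocapr (X : topologicalType) (U V : opens X) : ocap U V ⊆ V.
Proof. by move=> x []. Qed.

Record presheaf (X : topologicalType) := Presheaf {
  sections :> opens X -> comPzRingType;
  res : forall U V : opens X, V ⊆ U -> {rmorphism sections U -> sections V};
  res_id : forall (U : opens X) (h : U ⊆ U) s, res h s = s;
  res_comp : forall (U V W : opens X) (h : V ⊆ U) (k : W ⊆ V) (l : W ⊆ U) s,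
    res k (res h s) = res l s }.

Arguments res {X p U V} h.

Definition is_sheaf (X : topologicalType) (F : presheaf X) : Prop :=
  forall (I : Type) (U : opens X) (C : I -> opens X) (CU : forall i, C i ⊆ U),
    (forall x, U x -> exists i, C i x) ->
  forall s : forall i, F (C i),
    (forall i j, res (@ocapl X (C i) (C j)) (s i)
               = res (@ocapr X (C i) (C j)) (s j)) ->
  exists! t : F U, forall i, res (CU i) t = s i.

Record sheaf (X : topologicalType) := Sheaf {
  sheaf_pre :> presheaf X;
  sheafP : is_sheaf sheaf_pre }.

(* The germ of s at x is a unit of the stalk of F at x: since the stalk is the
   direct limit of the F V over the open V containing x, this means that s
   becomes invertible on some such V.                                         *)
Definition germ_unit (X : topologicalType) (F : presheaf X) (U : opens X)
    (s : F U) (x : X) : Prop :=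
  exists (V : opens X) (VU : V ⊆ U), V x /\ exists t, res VU s * t = 1.

(* The stalk of F at x is a local ring: 0 is not a unit, and of two germs whose
   sum is a unit at least one is a unit.                                      *)
Definition local_stalk (X : topologicalType) (F : presheaf X) (x : X) : Prop :=
  forall U : opens X, U x -> ~ germ_unit (0 : F U) x /\
    forall s t : F U, germ_unit (s + t) x -> germ_unit s x \/ germ_unit t x.

Record ringed_space := RingedSpace {
  rspace :> topologicalType;
  struct_sheaf : sheaf rspace }.

Notation "'O_' X" := (struct_sheaf X) (at level 8, X at level 2, format "'O_' X").

Definition opre (X Y : topologicalType) (f : X -> Y) (fc : continuous f)
    (V : opens Y) : opens X :=
  @Opens X (f @^-1` (V : set Y)) (open_comp (fun x _ => fc x) (opens_open V)).

Lemma opreS (X Y : topologicalType) (f : X -> Y) (fc : continuous f)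
  (V W : opens Y) : W ⊆ V -> opre fc W ⊆ opre fc V.
Proof. by move=> WV x; exact: WV. Qed.

Arguments opreS {X Y f} fc {V W} _ _ _.

Record ringed_morphism (X Y : ringed_space) := RingedMorphism {
  rmap :> X -> Y;
  rmap_cont : continuous rmap;
  comorph : forall V : opens Y,
    {rmorphism O_ Y V -> O_ X (opre rmap_cont V)};
  comorph_res : forall (V W : opens Y) (h : W ⊆ V) s,
    comorph W (res h s) = res (opreS rmap_cont h) (comorph V s) }.

Arguments rmap_cont {X Y} r _ _ _.
Arguments comorph {X Y} r V.

Definition rpre (X Y : ringed_space) (f : ringed_morphism X Y) (V : opens Y) :
  opens X := opre (rmap_cont f) V.

(* Isomorphism of X onto an open ringed subspace of Y.                        *)
Definition is_open_immersion (X Y : ringed_space) (i : ringed_morphism X Y) :=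
  [/\ injective i,
      forall U : opens X, open (i @` (U : set X)) &
      forall V : opens Y, (V : set Y) `<=` range i -> bijective (comorph i V)].

(** * Affine schemes *)

Record prime_ideal (A : comPzRingType) := PrimeIdeal {
  prime_ideal_ideal :> ideal A;
  prime_ideal_proper : ~ prime_ideal_ideal 1;
  prime_ideal_prime : forall x y, prime_ideal_ideal (x * y) ->
    prime_ideal_ideal x \/ prime_ideal_ideal y }.

Section Spec.
Variable A : comPzRingType.

Definition spec : Type := prime_ideal A.
HB.instance Definition _ := gen_eqMixin spec.
HB.instance Definition _ := gen_choiceMixin spec.

Definition zariski_open (U : set spec) : Prop :=
  exists E : set A, forall p : spec, U p <-> exists2 a, E a & ~ p a.

Lemma zariski_openT : zariski_open setT.
Proof.
exists setT => p; split=> // _; exists 1 => //; exact: prime_ideal_proper.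
Qed.

Lemma zariski_openI : setI_closed zariski_open.
Proof.
move=> U V [E UE] [F VF].
exists [set c | exists a b, [/\ E a, F b & c = a * b]] => p; split.
  move=> [/UE[a Ea pa] /VF[b Fb pb]]; exists (a * b); first by exists a, b.
  by case/prime_ideal_prime.
move=> [_ [a [b [Ea Fb ->]]] pab]; split.
- by apply/UE; exists a => // pa; apply: pab; rewrite mulrC; exact: ideal_mul.
- by apply/VF; exists b => // pb; apply: pab; exact: ideal_mul.
Qed.

Lemma zariski_open_bigU (I : Type) (U : I -> set spec) :
  (forall i, zariski_open (U i)) -> zariski_open (\bigcup_i U i).
Proof.
move=> oU; pose E i := sval (cid (oU i)).
have UE i p : U i p <-> exists2 a, E i a & ~ p a.
  by rewrite /E; case: cid.
exists (\bigcup_i E i) => p; split.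
  by move=> [i _ /UE[a Ea pa]]; exists a => //; exists i.
by move=> [a [i _ Ea] pa]; exists i => //; apply/UE; exists a.
Qed.

HB.instance Definition _ := isOpenTopological.Build spec
  zariski_openT zariski_openI zariski_open_bigU.

Lemma pcompl1 (p : spec) : ~ p 1.
Proof. exact: prime_ideal_proper. Qed.

Lemma pcomplM (p : spec) s t : ~ p s -> ~ p t -> ~ p (s * t).
Proof. by move=> ps pt /prime_ideal_prime[]. Qed.

(* The complement of p.                                                       *)
Definition pcompl (p : spec) : mulset A := MulSet (@pcompl1 p) (@pcomplM p).
End Spec.

(** ** The sheaf associated with a module *)

Section Tilde.
Variables (A : comPzRingType) (M : lmodType A).

Definition locally_fraction (U : opens (spec A))
    (s : forall p, U p -> locmod (pcompl p) M) : Prop :=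
  forall p, U p -> exists (V : opens (spec A)) (VU : V ⊆ U), V p /\
    exists (x : M) (a : A), forall q (Vq : V q),
      exists qa : pcompl q a, s q (VU q Vq) = mfrac x qa.

(* Sections over U of the sheaf on Spec A associated with M.                  *)
Record tilde (U : opens (spec A)) := Tilde {
  tilde_val :> forall p, U p -> locmod (pcompl p) M;
  tilde_loc : locally_fraction tilde_val }.
End Tilde.

Section TildeTheory.
Variables (A : comPzRingType).

Section Module.
Variable (M : lmodType A).

Lemma tildeP (U : opens (spec A)) (s t : tilde M U) :
  (forall p Up, s p Up = t p Up) -> s = t.
Proof.
case: s t => [s sP] [t tP] /= e.
have est : s = t by apply: functional_extensionality_dep => p; apply: functional_extensionality_dep.
by case: _ / est tP => tP; congr Tilde; exact: Prop_irrelevance.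
Qed.

Lemma tilde_ap (U : opens (spec A)) (s : tilde M U) p Up Up' :
  s p Up = s p Up'.
Proof. by congr (tilde_val s _); exact: Prop_irrelevance. Qed.

End Module.

Section ModuleSections.
Variable (M : lmodType A).

HB.instance Definition _ (U : opens (spec A)) := gen_eqMixin (tilde M U).
HB.instance Definition _ (U : opens (spec A)) := gen_choiceMixin (tilde M U).

Variable U : opens (spec A).

Lemma tzero_local : @locally_fraction A M U (fun p _ => 0).
Proof.
move=> p Up; exists U, (@osub_refl _ U); split=> //; exists 0, 1 => q Vq.
by exists (@pcompl1 _ q); apply: fracE; rewrite !scaler0.
Qed.

Lemma tadd_local (s t : tilde M U) :
  @locally_fraction A M U (fun p Up => s p Up + t p Up).
Proof.
move=> p Up.
have [V [VU [Vp [x [a xa]]]]] := tilde_loc s Up.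
have [W [WU [Wp [y [b yb]]]]] := tilde_loc t Up.
exists (ocap V W), (osub_trans (@ocapl _ V W) VU); split; first by split.
exists (b *: x + a *: y), (a * b) => q [Vq Wq].
have [qa eq] := xa q Vq; have [qb eq'] := yb q Wq.
exists (mulsetM qa qb); rewrite (tilde_ap s _ (VU q Vq)) eq.
by rewrite (tilde_ap t _ (WU q Wq)) eq' -fracD.
Qed.

Lemma topp_local (s : tilde M U) :
  @locally_fraction A M U (fun p Up => - s p Up).
Proof.
move=> p Up; have [V [VU [Vp [x [a xa]]]]] := tilde_loc s Up.
exists V, VU; split => //; exists (- x), a => q Vq.
by have [qa ->] := xa q Vq; exists qa; rewrite -fracN.
Qed.

Lemma tscale_local (a : tilde A^o U) (s : tilde M U) :
  @locally_fraction A M U (fun p Up => lscale (a p Up) (s p Up)).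
Proof.
move=> p Up.
have [V [VU [Vp [x [c xc]]]]] := tilde_loc a Up.
have [W [WU [Wp [y [b yb]]]]] := tilde_loc s Up.
exists (ocap V W), (osub_trans (@ocapl _ V W) VU); split; first by split.
exists ((x : A) *: y), (c * b) => q [Vq Wq].
have [qc eq] := xc q Vq; have [qb eq'] := yb q Wq.
exists (mulsetM qc qb); rewrite (tilde_ap a _ (VU q Vq)) eq.
by rewrite (tilde_ap s _ (WU q Wq)) eq' fracZ.
Qed.

Definition tzero : tilde M U := Tilde tzero_local.
Definition tadd s t : tilde M U := Tilde (tadd_local s t).
Definition topp s : tilde M U := Tilde (topp_local s).

(* The action of the sections of the structure sheaf.                         *)
Definition tscale a s : tilde M U := Tilde (tscale_local a s).

Lemma taddA : associative tadd.
Proof. by move=> s t u; apply: tildeP => p Up /=; rewrite addrA. Qed.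
Lemma taddC : commutative tadd.
Proof. by move=> s t; apply: tildeP => p Up /=; rewrite addrC. Qed.
Lemma tadd0 : left_id tzero tadd.
Proof. by move=> s; apply: tildeP => p Up /=; rewrite add0r. Qed.
Lemma taddN : left_inverse tzero topp tadd.
Proof. by move=> s; apply: tildeP => p Up /=; rewrite addNr. Qed.

HB.instance Definition _ :=
  GRing.isZmodule.Build (tilde M U) taddA taddC tadd0 taddN.

Variables (V : opens (spec A)) (VU : V ⊆ U).

Lemma tres_local (s : tilde M U) :
  @locally_fraction A M V (fun p Vp => s p (VU Vp)).
Proof.
move=> p Vp; have [W [WU [Wp [x [a xa]]]]] := tilde_loc s (VU Vp).
exists (ocap V W), (@ocapl _ V W); split => //; exists x, a => q [Vq Wq].
by have [qa e] := xa q Wq; exists qa; rewrite -e; exact: tilde_ap.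
Qed.

Definition tres (s : tilde M U) : tilde M V := Tilde (tres_local s).
End ModuleSections.

Variable U : opens (spec A).

(* Sections over U of the structure sheaf of Spec A.                          *)
Definition spec_sections : Type := tilde A^o U.
HB.instance Definition _ := GRing.Zmodule.copy spec_sections (tilde A^o U).

Lemma tone_local : @locally_fraction A A^o U (fun p _ => (1 : loc (pcompl p))).
Proof.
move=> p Up; exists U, (@osub_refl _ U); split=> //; exists 1, 1 => q Vq.
by exists (@pcompl1 _ q); apply: fracE.
Qed.

Definition tone : spec_sections := Tilde tone_local.

Lemma tmulA : associative (@tscale A^o U).
Proof. by move=> s t u; apply: tildeP => p Up /=; rewrite lmulA. Qed.
Lemma tmulC : commutative (@tscale A^o U).
Proof. by move=> s t; apply: tildeP => p Up /=; rewrite lmulC. Qed.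
Lemma tmul1 : left_id tone (@tscale A^o U).
Proof. by move=> s; apply: tildeP => p Up /=; rewrite lmul1. Qed.
Lemma tmulDl : left_distributive (@tscale A^o U) +%R.
Proof. by move=> s t u; apply: tildeP => p Up /=; rewrite lscaleDl. Qed.

HB.instance Definition _ := GRing.Zmodule_isComPzRing.Build spec_sections
  tmulA tmulC tmul1 tmulDl.
End TildeTheory.

Section SpecSheaf.
Variable A : comPzRingType.

Section Res.
Variables (U V : opens (spec A)) (VU : V ⊆ U).

Definition spec_res : spec_sections U -> spec_sections V := @tres A A^o U V VU.

Lemma spec_res_is_additive : GRing.zmod_morphism spec_res.
Proof. by move=> s t; apply: tildeP. Qed.

Lemma spec_res_is_multiplicative : GRing.monoid_morphism spec_res.
Proof. by split=> [|s t]; apply: tildeP. Qed.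

HB.instance Definition _ := GRing.isZmodMorphism.Build
  (spec_sections U) (spec_sections V) spec_res spec_res_is_additive.
HB.instance Definition _ := GRing.isMonoidMorphism.Build
  (spec_sections U) (spec_sections V) spec_res spec_res_is_multiplicative.
End Res.

Lemma spec_res_id (U : opens (spec A)) (h : U ⊆ U) s : spec_res h s = s.
Proof. by apply: tildeP => p Up; exact: (tilde_ap s (h p Up) Up). Qed.

Lemma spec_res_comp (U V W : opens (spec A)) (h : V ⊆ U) (k : W ⊆ V)
  (l : W ⊆ U) s : spec_res k (spec_res h s) = spec_res l s.
Proof.
by apply: tildeP => p Wp; exact: (tilde_ap s (h p (k p Wp)) (l p Wp)).
Qed.

Definition spec_presheaf : presheaf (spec A) :=
  @Presheaf (spec A) (fun U => spec_sections U : comPzRingType)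
    (fun U V VU => spec_res VU : {rmorphism _ -> _})
    spec_res_id spec_res_comp.

Lemma spec_presheaf_is_sheaf : is_sheaf spec_presheaf.
Proof.
move=> I U C CU cov s agree.
pose ix p (Up : U p) : I := sval (cid (cov p Up)).
have ixP p (Up : U p) : C (ix p Up) p by rewrite /ix; case: cid.
have eqs i j p (Cip : C i p) (Cjp : C j p) :
    (s i : tilde A^o (C i)) p Cip = (s j : tilde A^o (C j)) p Cjp.
  have /(congr1 (fun t : tilde A^o (ocap (C i) (C j)) => t p (conj Cip Cjp))) :=
    agree i j.
  rewrite /= => e; rewrite (tilde_ap _ _ (ocapl (conj Cip Cjp))) e.
  exact: tilde_ap.
pose t0 p (Up : U p) := (s (ix p Up) : tilde A^o _) p (ixP p Up).
have t0P : locally_fraction t0.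
  move=> p Up.
  have [W [WC [Wp [x [a xa]]]]] :=
    tilde_loc (s (ix p Up) : tilde A^o _) (ixP p Up).
  exists W, (osub_trans WC (CU _)); split=> //; exists x, a => q Wq.
  by have [qa e] := xa q Wq; exists qa; rewrite -e; exact: eqs.
exists (Tilde t0P : spec_sections U); split.
  by move=> i; apply: tildeP => p Cp; exact: eqs.
move=> t tP; apply: tildeP => p Up /=.
rewrite /t0 -(tP (ix p Up)).
exact: (tilde_ap (t : tilde A^o U) (CU _ _ (ixP p Up)) Up).
Qed.

Definition Spec : ringed_space :=
  @RingedSpace (spec A) (Sheaf spec_presheaf_is_sheaf).
End SpecSheaf.

(** * Schemes *)

Record scheme := Scheme {
  scheme_space :> ringed_space;
  scheme_local : forall x : scheme_space, local_stalk O_ scheme_space x;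
  scheme_affine : forall x : scheme_space,
    exists (A : comPzRingType) (i : ringed_morphism (Spec A) scheme_space),
      is_open_immersion i /\ range i x }.

(* A morphism of locally ringed spaces: the homomorphisms induced on stalks
   are local.                                                                 *)
Record scheme_morphism (X Y : scheme) := SchemeMorphism {
  smor :> ringed_morphism X Y;
  smor_local : forall (x : X) (V : opens Y) (s : O_ Y V), V (smor x) ->
    germ_unit (comorph smor V s) x -> germ_unit s (smor x) }.

(* For U affine, the ring A with U = Spec A is O_X(U).                        *)
Definition affine_open (X : scheme) (U : opens X) : Prop :=
  exists (A : comPzRingType) (i : ringed_morphism (Spec A) X),
    is_open_immersion i /\ range i = U.

(* The homomorphism O_Y(U) -> O_X(V) defined by f when f(V) is in U.          *)
Definition ring_map (X Y : scheme) (f : scheme_morphism X Y)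
    (U : opens Y) (V : opens X) (h : V ⊆ rpre f U) :
  {rmorphism O_ Y U -> O_ X V} := res h \o comorph f U.

(** * Quasi-coherent sheaves of algebras *)

Record sheaf_alg (X : scheme) := SheafAlg {
  alg_sheaf :> sheaf X;
  alg_const : forall U : opens X, {rmorphism O_ X U -> alg_sheaf U};
  alg_const_res : forall (U V : opens X) (h : V ⊆ U) a,
    alg_const V (res h a) = res h (alg_const U a) }.

(* The restriction of F to the image of i : Spec A -> X is, as a sheaf of
   modules, the sheaf associated with M. The isomorphism is written as an
   O_X-linear morphism from F to the direct image of that sheaf, bijective on
   the opens contained in the image of i.                                     *)
Definition restriction_is_tilde (X : scheme) (F : sheaf_alg X)
    (A : comPzRingType) (i : ringed_morphism (Spec A) X) (M : lmodType A) :=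
  exists psi : forall W : opens X, F W -> tilde M (rpre i W),
    [/\ forall W : opens X, (W : set X) `<=` range i -> bijective (psi W),
        forall W s t, psi W (s + t) = psi W s + psi W t,
        forall W (a : O_ X W) s, psi W (alg_const F W a * s)
          = tscale (comorph i W a) (psi W s) &
        forall (W W' : opens X) (h : W' ⊆ W) s,
          psi W' (res h s) = tres (opreS (rmap_cont i) h) (psi W s)].

Definition quasi_coherent (X : scheme) (F : sheaf_alg X) : Prop :=
  forall x : X, exists (A : comPzRingType) (i : ringed_morphism (Spec A) X)
    (M : lmodType A), [/\ is_open_immersion i, range i x &
                          restriction_is_tilde F i M].

Record alg_iso (X : scheme) (F G : sheaf_alg X) := AlgIso {
  aiso : forall U : opens X, {rmorphism F U -> G U};
  aiso_bij : forall U, bijective (aiso U);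
  aiso_const : forall U a, aiso U (alg_const F U a) = alg_const G U a;
  aiso_res : forall (U V : opens X) (h : V ⊆ U) s,
    aiso V (res h s) = res h (aiso U s) }.

(** * The sheaf HS_{X/Y} *)

Section RingMapTheory.
Variables (X Y : scheme) (f : scheme_morphism X Y).

Lemma ring_map_base (U U' : opens Y) (V : opens X) (U'U : U' ⊆ U)
  (h : V ⊆ rpre f U) (h' : V ⊆ rpre f U') a :
  idfun (ring_map h a) = ring_map h' (res U'U a).
Proof. by rewrite /= comorph_res (res_comp _ h' h). Qed.

Lemma ring_map_loc (U : opens Y) (V V' : opens X) (V'V : V' ⊆ V)
  (h : V ⊆ rpre f U) (h' : V' ⊆ rpre f U) a :
  res V'V (ring_map h a) = ring_map h' (idfun a).
Proof. by rewrite /= (res_comp _ _ h'). Qed.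

Variables (m : option nat) (F : sheaf_alg X).
Variables (U : opens Y) (V V' : opens X) (V'V : V' ⊆ V).
Variables (h : V ⊆ rpre f U) (h' : V' ⊆ rpre f U).
Variables (S : mulset (O_ X V)) (VS : is_localization S (res V'V)).

Lemma hs_inverts : inverts (mulset_image (hs_const m (ring_map h)) S)
  (hs_map m (ring_map_loc V'V h h')).
Proof.
move=> _ [s Ss <-]; have [t e] := is_localization_inverts VS Ss.
exists (hs_const m (ring_map h') t).
by rewrite hs_map_const -rmorphM e rmorph1.
Qed.

Lemma sections_inverts : inverts (mulset_image (alg_const F V) S) (res V'V).
Proof.
move=> _ [s Ss <-]; have [t e] := is_localization_inverts VS Ss.
by exists (alg_const F V' t); rewrite -alg_const_res -rmorphM e rmorph1.
Qed.

(* The isomorphism S^{-1} HS_{B/A} -> HS_{S^{-1}B/A}, for V' = Spec S^{-1}B in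
   V = Spec B; S^{-1} HS_{B/A} is formed with the image of S in HS_{B/A}.     *)
Definition hs_loc_map :
  {rmorphism loc (mulset_image (hs_const m (ring_map h)) S)
             -> HS m (ring_map h')} := loc_lift hs_inverts.

(* Likewise S^{-1} F(V) -> F(V').                                             *)
Definition sections_loc_map :
  {rmorphism loc (mulset_image (alg_const F V) S) -> F V'} :=
  loc_lift sections_inverts.
End RingMapTheory.

Section HSSheaf.
Variables (m : option nat) (X Y : scheme) (f : scheme_morphism X Y).

(* A family (phi_{B/A}), indexed by the affine opens U = Spec A of Y and
   V = Spec B of X with f(V) in U.                                            *)
Definition hs_charts (F : sheaf_alg X) : Type :=
  forall (U : opens Y) (V : opens X), affine_open U -> affine_open V ->
  forall h : V ⊆ rpre f U, {rmorphism F V -> HS m (ring_map h)}.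

(* Each phi_{B/A} is an isomorphism of B-algebras.                            *)
Definition hs_charts_iso (F : sheaf_alg X) (phi : hs_charts F) : Prop :=
  forall U V (aU : affine_open U) (aV : affine_open V) (h : V ⊆ rpre f U),
    bijective (phi U V aU aV h) /\
    forall b, phi U V aU aV h (alg_const F V b) = hs_const m (ring_map h) b.

(* Compatibility with HS_{B/A} -> HS_{B/S^{-1}A}, for U' = Spec S^{-1}A in
   U = Spec A.                                                                *)
Definition hs_charts_base (F : sheaf_alg X) (phi : hs_charts F) : Prop :=
  forall (U U' : opens Y) (V : opens X)
    (aU : affine_open U) (aU' : affine_open U') (aV : affine_open V)
    (h : V ⊆ rpre f U) (h' : V ⊆ rpre f U') (U'U : U' ⊆ U)
    (S : mulset (O_ Y U)),
    is_localization S (res U'U) ->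
  forall z : F V,
    hs_map m (ring_map_base U'U h h') (phi U V aU aV h z)
    = phi U' V aU' aV h' z.

(* Compatibility with S^{-1} HS_{B/A} -> HS_{S^{-1}B/A}, for
   V' = Spec S^{-1}B in V = Spec B: the fraction z/s of S^{-1} F(V) has the
   same image along both sides of the square.                                 *)
Definition hs_charts_loc (F : sheaf_alg X) (phi : hs_charts F) : Prop :=
  forall (U : opens Y) (V V' : opens X)
    (aU : affine_open U) (aV : affine_open V) (aV' : affine_open V')
    (h : V ⊆ rpre f U) (h' : V' ⊆ rpre f U) (V'V : V' ⊆ V)
    (S : mulset (O_ X V)) (VS : is_localization S (res V'V))
    (z : F V) (s : O_ X V) (Ss : S s),
  hs_loc_map m h h' VS
    (loc_frac (phi U V aU aV h z) (mulset_image_in _ Ss))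
  = phi U V' aU aV' h'
      (sections_loc_map F VS (loc_frac z (mulset_image_in _ Ss))).

Definition is_hs_sheaf (F : sheaf_alg X) (phi : hs_charts F) : Prop :=
  [/\ quasi_coherent F, hs_charts_iso phi, hs_charts_base phi
    & hs_charts_loc phi].

Definition hs_iso_compatible (F G : sheaf_alg X) (phi : hs_charts F)
    (psi : hs_charts G) (theta : alg_iso F G) : Prop :=
  forall U V (aU : affine_open U) (aV : affine_open V) (h : V ⊆ rpre f U) z,
    psi U V aU aV h (aiso theta V z) = phi U V aU aV h z.
End HSSheaf.

(* Main.v *)
From HB Require Import structures.
Require Import Defs.
From mathcomp Require Import all_boot all_algebra finmap.
From mathcomp Require Import boolp classical_sets topology_structure.
From mathcomp Require Import ring.
From mathcomp.multinomials Require Import monalg.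

(** Call an open V of X good when it is affine and f maps it into some affine
    open U of Y. Good opens form a basis of X, and on a good V the isomorphisms
    phi_{B/A} prescribe the sections: so the sheaf is the one that extends the
    prescribed values from a basis, and two solutions are compared on good opens
    and glued. Two facts about Hasse-Schmidt algebras make this work.

    The algebra does not depend on U. Replace O_Y(U) by the ring of those
    sections over V that come locally from Y ([base_ring]); the algebra
    HSV V = HS_{O_X(V) / base_ring V} involves no open of Y and is functorial in
    V. For affine U and V, HS_{O_X(V) / O_Y(U)} -> HSV V is an isomorphism
    ([hsv_chart_bij]). It is onto because both sides have the same generators; it
    is injective because d_i c = 0 already in the source when c comes locally
    from Y: near a point, a^n c comes from O_Y(U) for some a in O_Y(U) that is
    invertible there, whence a^n d_i c = d_i (a^n c) = 0.

    The algebra commutes with localization of B ([hs_away]). A Hasse-Schmidt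
    derivation of B with values in R is a ring homomorphism from B to the power
    series over R truncated at order m, and such a series is invertible as soon
    as its constant term is. Hence a derivation of B extends to B_b when b becomes
    invertible in R, which provides the inverse of the localization map.

    Consequently V |-> HSV V has, on a good V, the gluing property along covers
    by basic opens ([hsv_glue]), by the partition of unity argument that also
    computes the sections of the structure sheaf of Spec A ([glue_fractions],
    [sec_away]). The sheaf [hs_alg] takes W to the compatible families of elements
    of HSV V, for V good in W. If W is good it is the largest such V, and
    evaluation at W followed by the inverse of [hsv_chart] is the chart. Since
    restriction to basic opens of a good V is localization, the sheaf is there
    the one associated with its module of sections over V: the germ of s at p
    is x / a whenever a s = x near p ([restriction_germs]).

    For uniqueness, the charts of any solution F give isomorphisms from F(V) to
    HSV V. The compatibility conditions only speak of localizations, but two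
    affine opens around a point contain a common affine open that is reached from
    both by basic opens; so these isomorphisms do not depend on U ([chart_indep])
    and are natural in V ([hs_model_of_charts]). Two sheaves with the same values
    on a basis are isomorphic, and the isomorphism is determined by its values
    there ([hs_model_iso], [matches_uniq]). *)

Set Implicit Arguments.
Unset Strict Implicit.
Unset Printing Implicit Defensive.

Import GRing.Theory.

Local Open Scope classical_set_scope.
Local Open Scope ring_scope.

(** * Prime ideals and gluing of fractions *)

Section PrimeAvoidance.
Variables (A : comPzRingType) (b : A).

(** The closure conditions of an ideal on a bare set, the form in which Zorn's
    lemma for sets is applied. *)
Definition ideal_like (X : set A) : Prop :=
  [/\ X 0, forall x y, X x -> X y -> X (x + y) & forall a x, X x -> X (a * x)].

(** An ideal maximal among those that contain J and no power of b is prime: if x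
    and y lie outside it, adjoining either one reaches a power of b, and the
    product of these two powers would lie in the ideal as soon as x y does. *)
Lemma exists_prime (J : ideal A) : (forall n, ~ J (b ^+ n)) ->
  exists p : spec A, (forall x, J x -> p x) /\ ~ p b.
Proof.
move=> Jb.
(* Stated for X `|` J and not for X, so that the union of the empty chain
   satisfies it. *)
pose P (X : set A) := ideal_like (X `|` (J : set A)) /\
  forall n, ~ (X `|` (J : set A)) (b ^+ n).
have [F FP Ftot|Q [[[Q0 QD QM] Qb] Qmax]] := @Zorn_bigcup A P.
  split; last by move=> n [[X /FP[_ /(_ n) h] Xn]|/Jb//]; apply: h; left.
  split; first by right; exact: ideal_0.
  - have aux X Y x y : F X -> F Y -> X `<=` Y -> X x -> Y y ->
        ((\bigcup_(X in F) X) `|` (J : set A)) (x + y).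
      move=> FX FY XY Xx Yy; have [[_ h _] _] := FP _ FY.
      case: (h x y); [by left; exact: XY|by left|by left; exists Y|by right].
    have aux1 X x y : F X -> X x -> J y ->
        ((\bigcup_(X in F) X) `|` (J : set A)) (x + y).
      move=> FX Xx Jy; have [[_ h _] _] := FP _ FX.
      case: (h x y); [by left|by right|by left; exists X|by right].
    move=> x y [[X FX Xx]|Jx] [[Y FY Yy]|Jy].
    + have [/= XY|/= YX] := Ftot _ _ FX FY; first exact: (aux X Y).
      by rewrite addrC; exact: (aux Y X).
    + exact: aux1 Xx Jy.
    + by rewrite addrC; exact: aux1 Yy Jx.
    + by right; exact: ideal_add.
  move=> a x [[X FX Xx]|Jx]; last by right; exact: ideal_mul.
  have [[_ _ h] _] := FP _ FX.
  by case: (h a x); [by left|by left; exists X|by right].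
set QJ := (Q `|` (J : set A)) in Q0 QD QM Qb Qmax.
pose K := Ideal Q0 QD QM.
(* maximality: adjoining an element outside K reaches a power of b *)
have grow z : ~ K z -> exists n a k, K k /\ b ^+ n = k + a * z.
  move=> Kz; apply: contrapT => no.
  pose Z : set A := [set w | exists a k, K k /\ w = k + a * z].
  have ZJ : Z `|` (J : set A) = Z.
    apply/seteqP; split=> [w [//|Jw]|w]; last by left.
    by exists 0, w; split; [right|rewrite mul0r addr0].
  have QZ : QJ `<=` Z by move=> w Kw; exists 0, w; rewrite mul0r addr0.
  apply: (Qmax Z).
    split; first by move=> w Qw; apply: QZ; left.
    move=> ZQ; apply: Kz; left; apply: ZQ; exists 1, 0.
    by split; [exact: (ideal_0 K)|rewrite add0r mul1r].
  split; rewrite ZJ; last first.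
    by move=> n [a [k [Kk e]]]; apply: no; exists n, a, k.
  split; first exact: QZ.
    move=> _ _ [a [k [Kk ->]]] [a' [k' [Kk' ->]]]; exists (a + a'), (k + k').
    by split; [exact: (ideal_add (i := K))|rewrite mulrDl addrACA].
  move=> c _ [a [k [Kk ->]]]; exists (c * a), (c * k).
  by split; [exact: (ideal_mul (i := K))|rewrite mulrDr mulrA].
have K1 : ~ K 1 by exact: (Qb 0%N).
have Kprime x y : K (x * y) -> K x \/ K y.
  move=> Kxy; apply: contrapT => /not_orP[/grow[n [a [k [Kk e]]]]].
  move=> /grow[n' [a' [k' [Kk' e']]]]; apply: (Qb (n + n')%N).
  rewrite exprD e e'.
  have -> : (k + a * x) * (k' + a' * y) =
     (k' + a' * y) * k + ((a * x) * k' + (a * a') * (x * y)) by ring.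
  apply: (ideal_add (i := K)); first exact: (ideal_mul (i := K)).
  by apply: (ideal_add (i := K)); exact: (ideal_mul (i := K)).
exists (PrimeIdeal K1 Kprime); split; first by move=> x Jx; right.
exact: (Qb 1%N).
Qed.
End PrimeAvoidance.

Lemma ideal1P (A : comPzRingType) (J : ideal A) :
  (forall p : spec A, exists2 x, J x & ~ p x) -> J 1.
Proof.
move=> h; apply: contrapT => J1.
have [|p [Jp _]] := @exists_prime A 1 J; first by move=> n; rewrite expr1n.
by have [x /Jp px] := h p.
Qed.

Section Combinations.
Variables (A : comPzRingType) (T : choiceType) (g : T -> A) (Q : T -> Prop).

(** The ideal generated by the values of g on Q, as explicit finite
    combinations: finiteness of the supports is the quasi-compactness of Spec A. *)
Definition comb_set : set A := [set x | exists2 s : seq (A * T),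
  (forall u, u \in s -> Q u.2) & x = \sum_(u <- s) u.1 * g u.2].

Lemma comb_0 : comb_set 0.
Proof. by exists [::] => //; rewrite big_nil. Qed.

Lemma comb_add x y : comb_set x -> comb_set y -> comb_set (x + y).
Proof.
move=> [s Gs ->] [t Gt ->]; exists (s ++ t); last by rewrite big_cat.
by move=> u; rewrite mem_cat => /orP[/Gs|/Gt].
Qed.

Lemma comb_mul c x : comb_set x -> comb_set (c * x).
Proof.
move=> [s Gs ->]; exists [seq (c * u.1, u.2) | u <- s].
  by move=> _ /mapP[u us ->]; exact: (Gs _ us).
by rewrite big_map mulr_sumr; apply: eq_bigr => u _; rewrite mulrA.
Qed.

Definition comb_ideal : ideal A := Ideal comb_0 comb_add comb_mul.

Lemma comb_ideal_in t : Q t -> comb_ideal (g t).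
Proof.
move=> Qt; exists [:: (1, t)]; last by rewrite big_seq1 mul1r.
by move=> u; rewrite inE => /eqP ->.
Qed.
End Combinations.

Lemma ideal_sum (A : comPzRingType) (J : ideal A) (I : eqType) (s : seq I)
    (F : I -> A) : (forall i, i \in s -> J (F i)) -> J (\sum_(i <- s) F i).
Proof.
elim: s => [|i s IH] h; first by rewrite big_nil; exact: ideal_0.
rewrite big_cons; apply: ideal_add; first by apply: h; rewrite mem_head.
by apply: IH => j js; apply: h; rewrite inE js orbT.
Qed.

Lemma prime_exp (A : comPzRingType) (p : spec A) x n : p (x ^+ n) -> p x.
Proof.
elim: n => [/prime_ideal_proper//|n IH]; rewrite exprS.
by case/prime_ideal_prime.
Qed.

Lemma seq_bound (I : eqType) (s : seq I) (P : I -> nat -> Prop) :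
  (forall i, i \in s -> exists N, forall M, (N <= M)%N -> P i M) ->
  exists N, forall i, i \in s -> forall M, (N <= M)%N -> P i M.
Proof.
elim: s => [|i s IH] h; first by exists 0%N.
have [N hN] := h i (mem_head i s).
have [|N' hN'] := IH; first by move=> j js; apply: h; rewrite inE js orbT.
exists (maxn N N') => j; rewrite inE => /orP[/eqP ->|js] M; rewrite geq_max.
  by move=> /andP[/hN].
by move=> /andP[_ /(hN' _ js)].
Qed.

Lemma expr_kill (R : comPzRingType) (x z : R) N M :
  (N <= M)%N -> x ^+ N * z = 0 -> x ^+ M * z = 0.
Proof.
by move=> /subnK <- e; rewrite exprD -mulrA e mulr0.
Qed.

Section Glue.
Variables (A R : comPzRingType) (c : {rmorphism A -> R}).
Variables (G : A -> R -> Prop) (a : A).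
Hypothesis Gcov : forall p : spec A, ~ p a -> exists b x, G b x /\ ~ p b.
Hypothesis Gcomp : forall b x b' x', G b x -> G b' x' ->
  exists N, c ((b * b') ^+ N) * (c b' * x - c b * x') = 0.

(** A pair (b, x) of G stands for the fraction x / b on D(b), and the fractions
    agree on overlaps. Finitely many of the D(b) cover D(a), so a power a^n is a
    combination of the b^(N+1), where N is large enough to make the agreement
    b'^(N+1) (b^N x) = b^(N+1) (b'^N x') exact for the pairs involved. The same
    combination of the elements b^N x is then a^n times the glued section. *)
Lemma glue_fractions : exists n z, forall p : spec A, ~ p a -> exists b x,
  [/\ G b x, ~ p b & exists N, c (b ^+ N) * (c b * z - c (a ^+ n) * x) = 0].
Proof.
pose G2 (t : A * R) := G t.1 t.2.
have [n0 [s Gs es]] : exists n, comb_ideal fst G2 (a ^+ n).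
  apply: contrapT => /forallNP /exists_prime[p [Jp pa]].
  have [b [x [Gbx pb]]] := Gcov pa; apply: pb; apply: Jp.
  exact: (@comb_ideal_in _ _ fst G2 (b, x)).
pose l := [seq u.2 | u <- s].
have Gl t : t \in l -> G t.1 t.2 by move=> /mapP[u us ->]; exact: Gs.
(* finitely many pairs, hence a common exponent *)
have [N hN] : exists N, forall t t', t \in l -> t' \in l ->
    c ((t.1 * t'.1) ^+ N) * (c t'.1 * t.2 - c t.1 * t'.2) = 0.
  have [|N hN] := @seq_bound _ l (fun t M => forall t', t' \in l ->
     c ((t.1 * t'.1) ^+ M) * (c t'.1 * t.2 - c t.1 * t'.2) = 0); last first.
    by exists N => t t' tl t'l; exact: hN (leqnn N) _ t'l.
  move=> t tl; have [|N hN] := @seq_bound _ l (fun t' M =>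
     c ((t.1 * t'.1) ^+ M) * (c t'.1 * t.2 - c t.1 * t'.2) = 0); last first.
    by exists N => M NM t' t'l; exact: hN.
  move=> t' t'l; have [N hN] := Gcomp (Gl _ tl) (Gl _ t'l).
  by exists N => M NM; rewrite rmorphXn; apply: (expr_kill NM); rewrite -rmorphXn.
have prl p : ~ (p : spec A) a -> exists2 t, t \in l & ~ p t.1.
  move=> pa; apply: contrapT => no; apply: pa; apply: (@prime_exp _ _ _ n0).
  rewrite es; apply: ideal_sum => u us; apply: ideal_mul; apply: contrapT => pu.
  by apply: no; exists u.2 => //; exact: map_f.
have [n [s' ls' es']] : exists n,
    comb_ideal (fun t : A * R => t.1 ^+ N.+1) (fun t => t \in l) (a ^+ n).
  apply: contrapT => /forallNP /exists_prime[p [Jp pa]].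
  have [t tl pt] := prl _ pa; apply: pt; apply: (@prime_exp _ _ _ N.+1).
  by apply: Jp; exact: (@comb_ideal_in _ _ (fun t : A * R => t.1 ^+ N.+1)).
exists n, (\sum_(u <- s') c (u.1 * u.2.1 ^+ N) * u.2.2) => p pa.
have [t tl pt] := prl _ pa; exists t.1, t.2; split=> //; [exact: Gl|exists N].
rewrite es' rmorph_sum mulr_sumr mulr_suml -sumrB mulr_sumr big_seq big1 //.
move=> u /ls' ul; have := hN _ _ ul tl.
rewrite !rmorphM !rmorphXn !rmorphM => /(congr1 ( *%R (c u.1))); rewrite mulr0.
move=> e; rewrite -[RHS]e exprMn exprS; ring.
Qed.
End Glue.

(** * Localization at one element *)

Section Away.
Variables (A A' : comPzRingType) (b : A) (g : {rmorphism A -> A'}).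

(** A' is the localization of A at the powers of b. In this elementwise form the
    property can be checked on rings of sections and on Hasse-Schmidt algebras,
    and carried along isomorphisms. *)
Definition away : Prop :=
  [/\ exists t, g b * t = 1,
      forall a, g a = 0 -> exists n, b ^+ n * a = 0 &
      forall y, exists n a, g (b ^+ n) * y = g a].

Lemma unit_exp_cancel (R : comPzRingType) (x v : R) n y z :
  x * v = 1 -> x ^+ n * y = x ^+ n * z -> y = z.
Proof.
move=> e /(congr1 ( *%R (v ^+ n))).
by rewrite !mulrA -!exprMn (mulrC v) e expr1n !mul1r.
Qed.

Hypothesis ag : away.

Variables (R : comPzRingType) (h : {rmorphism A -> R}).
Hypothesis hb : exists v, h b * v = 1.

Let inv : R := sval (cid hb).

Lemma away_invP : h b * inv = 1. Proof. by rewrite /inv; case: cid. Qed.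

Let fr (y : A') : exists u : nat * A, g (b ^+ u.1) * y = g u.2.
Proof. by have [_ _ /(_ y)[n [a e]]] := ag; exists (n, a). Qed.

(** The fraction a / b^n representing y is an arbitrary choice;
    [away_lift_frac] shows that the value does not depend on it. *)
Definition away_lift_fun (y : A') : R :=
  let u := sval (cid (fr y)) in h u.2 * inv ^+ u.1.

Lemma away_lift_frac n a y : g (b ^+ n) * y = g a ->
  h b ^+ n * away_lift_fun y = h a.
Proof.
move=> e; rewrite /away_lift_fun; case: cid => -[n' a'] /= e'.
have [_ ker _] := ag; have [|k ek] := ker (b ^+ n * a' - b ^+ n' * a).
  by rewrite rmorphB !(rmorphM g) -e -e'; ring.
move/(congr1 h): ek; rewrite rmorph0 rmorphM rmorphB !rmorphM !rmorphXn.
move=> /(congr1 ( *%R (inv ^+ k))); rewrite mulr0 mulrA -exprMn.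
rewrite (mulrC inv) away_invP expr1n mul1r => /eqP; rewrite subr_eq0 => /eqP ek.
by rewrite mulrA ek mulrAC -exprMn away_invP expr1n mul1r.
Qed.

Lemma away_lift_eq n a y z : g (b ^+ n) * y = g a -> h b ^+ n * z = h a ->
  away_lift_fun y = z.
Proof.
move=> /away_lift_frac ey ez; apply: (@unit_exp_cancel _ _ _ n _ _ away_invP).
by rewrite ey ez.
Qed.

Lemma away_lift_is_additive : GRing.zmod_morphism away_lift_fun.
Proof.
move=> y z; have [[n a] /= ea] := fr y; have [[k c] /= ec] := fr z.
apply: (@away_lift_eq (n + k) (b ^+ k * a - b ^+ n * c)).
  by rewrite exprD rmorphB !(rmorphM g) -ea -ec; ring.
rewrite rmorphB !(rmorphM h) -(away_lift_frac ea) -(away_lift_frac ec).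
by rewrite !rmorphXn exprD; ring.
Qed.

Lemma away_lift_is_multiplicative : GRing.monoid_morphism away_lift_fun.
Proof.
split=> [|y z].
  by apply: (@away_lift_eq 0 1); rewrite expr0 ?mul1r ?rmorph1 ?mulr1.
have [[n a] /= ea] := fr y; have [[k c] /= ec] := fr z.
apply: (@away_lift_eq (n + k) (a * c)).
  by rewrite exprD !(rmorphM g) -ea -ec; ring.
rewrite !(rmorphM h) -(away_lift_frac ea) -(away_lift_frac ec).
by rewrite exprD; ring.
Qed.

HB.instance Definition _ := GRing.isZmodMorphism.Build A' R away_lift_fun
  away_lift_is_additive.
HB.instance Definition _ := GRing.isMonoidMorphism.Build A' R away_lift_fun
  away_lift_is_multiplicative.

Definition away_lift : {rmorphism A' -> R} := away_lift_fun.

Lemma away_lift_val a : away_lift (g a) = h a.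
Proof. by apply: (@away_lift_eq 0 a); rewrite expr0 ?rmorph1 mul1r. Qed.
End Away.

Lemma inj_surj_bijective (S T : Type) (f : S -> T) :
  injective f -> (forall y, exists x, f x = y) -> bijective f.
Proof.
move=> inj surj; exists (fun y => sval (cid (surj y))) => [x|y].
  by apply: inj; case: cid.
by case: cid.
Qed.

Definition powers (A : comPzRingType) (b : A) : mulset A :=
  @MulSet A [set x | exists n, x = b ^+ n]
    (ex_intro _ 0%N (esym (expr0 b)))
    (fun x y hx hy => let: ex_intro n ex := hx in let: ex_intro k ey := hy in
       ex_intro _ (n + k)%N
         (etrans (congr2 *%R ex ey) (esym (exprD b n k)))).

Lemma away_localization (A A' : comPzRingType) (b : A) (g : {rmorphism A -> A'}) :
  away b g -> is_localization (powers b) g.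
Proof.
move=> [[t et] ker frac].
have gS : inverts (powers b) g.
  by move=> _ [n ->]; exists (t ^+ n); rewrite rmorphXn -exprMn et expr1n.
exists gS; apply: inj_surj_bijective; last first.
  move=> y; have [n [a e]] := frac y.
  exists (loc_frac a (ex_intro _ n erefl : powers b (b ^+ n))).
  exact: (loc_liftP gS erefl e).
move=> z w; have [x [s [hs ->]]] := frac_ex z.
have [y [t' [ht ->]]] := frac_ex w => e.
have := loc_lift_frac gS x hs; have := loc_lift_frac gS y ht.
rewrite e => ey ex; have [|j ej] := ker (t' * x - s * y).
  by rewrite rmorphB !(rmorphM g) -ex -ey; ring.
apply/fracP; exists (b ^+ j); split; first by exists j.
by apply/eqP; rewrite -subr_eq0 -scalerBr; apply/eqP.
Qed.

Lemma loc_away (A : comPzRingType) (b : A) : away b (loc_const (powers b)).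
Proof.
have bP : powers b b by exists 1%N; rewrite expr1.
split.
- exists (loc_frac 1 bP); rewrite -[LHS]/(lscale _ _) fracZ.
  by apply: fracE; rewrite mul1r scale1r.
- move=> a /fracP[_ [[n ->] e]]; exists n; move: e.
  by rewrite !scale1r scaler0.
move=> y; have [a [s [hs ->]]] := frac_ex y; have [n es] := hs.
exists n, a; rewrite -[LHS]/(lscale _ _) fracZ; apply: fracE.
by rewrite mul1r scale1r es.
Qed.

(** * Truncated power series *)

Definition pser (R : comPzRingType) : Type := nat -> R.

Section PowerSeries.
Variable R : comPzRingType.
HB.instance Definition _ := gen_eqMixin (pser R).
HB.instance Definition _ := gen_choiceMixin (pser R).
Implicit Types p q r : pser R.

Definition psadd p q : pser R := fun k => p k + q k.
Definition psopp p : pser R := fun k => - p k.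
Definition ps0 : pser R := fun _ => 0.
Definition ps1 : pser R := fun k => (k == 0%N)%:R.
Definition psmul p q : pser R := fun k => \sum_(i < k.+1) p i * q (k - i)%N.

Lemma psaddA : associative psadd.
Proof. by move=> p q r; apply: funext => k; exact: addrA. Qed.
Lemma psaddC : commutative psadd.
Proof. by move=> p q; apply: funext => k; exact: addrC. Qed.
Lemma psadd0 : left_id ps0 psadd.
Proof. by move=> p; apply: funext => k; exact: add0r. Qed.
Lemma psaddN : left_inverse ps0 psopp psadd.
Proof. by move=> p; apply: funext => k; exact: addNr. Qed.

HB.instance Definition _ :=
  GRing.isZmodule.Build (pser R) psaddA psaddC psadd0 psaddN.

Lemma psmulC : commutative psmul.
Proof.
move=> p q; apply: funext => k; rewrite /psmul (reindex_inj rev_ord_inj) /=.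
apply: eq_bigr => i _; rewrite mulrC subSS subKn //.
by rewrite -ltnS ltn_ord.
Qed.

Lemma psmul_rev p q : psmul p q = fun k => \sum_(i < k.+1) p (k - i)%N * q i.
Proof.
rewrite psmulC; apply: funext => k; rewrite /psmul.
by apply: eq_bigr => i _; rewrite mulrC.
Qed.

Lemma psmulA : associative psmul.
Proof.
move=> p q r; apply: funext => i; rewrite (psmul_rev (psmul p q)) {1}/psmul.
pose F j k := p j * (q (i - j - k)%N * r k).
transitivity (\sum_(j < i.+1) \sum_(k < i.+1 | (k <= i - j)%N) F j k).
  apply: eq_bigr => /= j _; rewrite psmul_rev big_distrr /=.
  by rewrite (big_ord_narrow_leq (leq_subr _ _)).
rewrite (exchange_big_dep predT) //=; apply: eq_bigr => k _.
transitivity (\sum_(j < i.+1 | (j <= i - k)%N) F j k).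
  apply: eq_bigl => j; rewrite -ltnS -(ltnS j) -!subSn ?leq_ord //.
  by rewrite -subn_gt0 -(subn_gt0 j) -!subnDA addnC.
rewrite (big_ord_narrow_leq (leq_subr _ _)) /psmul big_distrl /=.
by apply: eq_bigr => j _; rewrite /F -!subnDA addnC mulrA.
Qed.

Lemma psmul1 : left_id ps1 psmul.
Proof.
move=> p; apply: funext => k; rewrite /psmul big_ord_recl subn0 mul1r.
by rewrite big1 ?addr0 // => i _; rewrite mul0r.
Qed.

Lemma psmulDl : left_distributive psmul psadd.
Proof.
move=> p q r; apply: funext => k; rewrite /psmul /psadd -big_split /=.
by apply: eq_bigr => i _; rewrite mulrDl.
Qed.

HB.instance Definition _ := GRing.Zmodule_isComPzRing.Build (pser R)
  psmulA psmulC psmul1 psmulDl.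

Lemma psmulE p q k : (p * q : pser R) k = \sum_(i < k.+1) p i * q (k - i)%N.
Proof. by []. Qed.
Lemma psaddE p q k : (p + q : pser R) k = p k + q k. Proof. by []. Qed.
Lemma psoppE p k : (- p : pser R) k = - p k. Proof. by []. Qed.
Lemma ps1E k : (1 : pser R) k = (k == 0%N)%:R. Proof. by []. Qed.

Definition psconst (a : R) : pser R := fun k => if k == 0%N then a else 0.

Lemma psconstM a p k : (psconst a * p) k = a * p k.
Proof.
rewrite psmulE big_ord_recl subn0 big1 ?addr0 // => i _.
by rewrite /psconst mul0r.
Qed.

Lemma psexp_small p n k : p 0%N = 0 -> (k < n)%N -> (p ^+ n) k = 0.
Proof.
move=> p0; elim: n k => // n IH k kn; rewrite exprS psmulE big1 // => i _.
have [->|i0] := posnP i; first by rewrite p0 mul0r.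
rewrite IH ?mulr0 //; move: kn (ltn_ord i); rewrite !ltnS => kn ik.
by apply: leq_trans kn; rewrite ltn_subrL i0 (leq_trans i0 ik).
Qed.

(** The inverse is v times the geometric series in N = 1 - v p. As N has no
    constant term, only the first k + 1 powers of N contribute to the coefficient
    of t^k, so the series needs no notion of convergence. *)
Lemma ps_unit p v : p 0%N * v = 1 -> exists q, p * q = 1.
Proof.
move=> pv; pose N := 1 - psconst v * p; pose Q k := \sum_(j < k.+1) N ^+ j.
have N0 : N 0%N = 0.
  by rewrite /N psaddE psoppE ps1E psconstM mulrC pv subrr.
have QE n k : (k <= n)%N -> Q n k = Q k k.
  move=> /subnK <-; elim: (n - k)%N => [|d IH]; first by rewrite add0n.
  rewrite addSn /Q big_ord_recr /= psaddE -/(Q _) IH.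
  by rewrite psexp_small ?addr0 // ltnS leq_addl.
exists (psconst v * ((fun k => Q k k) : pser R)).
rewrite mulrA (mulrC p); have -> : psconst v * p = 1 - N.
  by rewrite /N opprB addrCA subrr addr0.
apply: funext => k; transitivity (((1 - N) * Q k) k).
  by rewrite !psmulE; apply: eq_bigr => i _; rewrite (QE k) ?leq_subr.
have -> : (1 - N) * Q k = 1 - N ^+ k.+1.
  by rewrite -[RHS]opprB subrX1 -[RHS]mulNr (opprB N).
by rewrite psaddE psoppE psexp_small ?subr0.
Qed.
End PowerSeries.

Lemma le_order_trans m i k : (i <= k)%N -> le_order m k -> le_order m i.
Proof. by case: m => //= n ik /(leq_trans ik). Qed.

Section Truncated.
Variables (m : option nat) (R : comPzRingType).

Definition ps_vanish : set (pser R) := [set p | forall i, le_order m i -> p i = 0].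

Lemma ps_vanish0 : ps_vanish 0. Proof. by []. Qed.
Lemma ps_vanishD p q : ps_vanish p -> ps_vanish q -> ps_vanish (p + q).
Proof. by move=> hp hq i im; rewrite psaddE hp // hq // addr0. Qed.
Lemma ps_vanishM p q : ps_vanish q -> ps_vanish (p * q).
Proof.
move=> hq k km; rewrite psmulE big1 // => i _.
by rewrite hq ?mulr0 //; apply: le_order_trans km; exact: leq_subr.
Qed.

(** R[[t]] / (t^(m+1)), which is R[[t]] when m is infinite. *)
Definition tser : comPzRingType := quotring (Ideal ps_vanish0 ps_vanishD ps_vanishM).
Definition tcls (p : pser R) : tser := qcls _ p.

(** A coefficient of an arbitrary representative, hence meaningful up to order m
    only. *)
Definition tcoef (i : nat) (z : tser) : R := qrepr z i.

Lemma tcoef_cls i p : le_order m i -> tcoef i (tcls p) = p i.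
Proof.
move=> im; have /qclsP/(_ i im) := qreprK (tcls p).
by rewrite psaddE psoppE => /eqP; rewrite subr_eq0 => /eqP.
Qed.

Lemma tserP z w : (forall i, le_order m i -> tcoef i z = tcoef i w) -> z = w.
Proof.
move=> e; rewrite -(qreprK z) -(qreprK w); apply/qclsP => i im.
by rewrite psaddE psoppE -/(tcoef i z) e // subrr.
Qed.

Lemma tcoefB i z w : le_order m i -> tcoef i (z - w) = tcoef i z - tcoef i w.
Proof.
by move=> im; rewrite -{1}(qreprK z) -{1}(qreprK w) -rmorphB tcoef_cls.
Qed.

Lemma tcoefD i z w : le_order m i -> tcoef i (z + w) = tcoef i z + tcoef i w.
Proof.
by move=> im; rewrite -{1}(qreprK z) -{1}(qreprK w) -rmorphD tcoef_cls.
Qed.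

Lemma tcoefM k z w : le_order m k ->
  tcoef k (z * w) = \sum_(i < k.+1) tcoef i z * tcoef (k - i)%N w.
Proof.
by move=> im; rewrite -{1}(qreprK z) -{1}(qreprK w) -rmorphM tcoef_cls.
Qed.

Lemma tcoef1 i : le_order m i -> tcoef i 1 = (i == 0%N)%:R.
Proof. by move=> im; rewrite -[1](rmorph1 (qcls _)) tcoef_cls. Qed.

Lemma le_order0 : le_order m 0. Proof. by case: m. Qed.

Lemma tcoef0_is_additive : GRing.zmod_morphism (tcoef 0).
Proof. by move=> z w; exact/tcoefB/le_order0. Qed.
Lemma tcoef0_is_multiplicative : GRing.monoid_morphism (tcoef 0).
Proof.
split=> [|z w]; first exact/tcoef1/le_order0.
by rewrite tcoefM ?le_order0 // big_ord1.
Qed.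
HB.instance Definition _ := GRing.isZmodMorphism.Build tser R (tcoef 0)
  tcoef0_is_additive.
HB.instance Definition _ := GRing.isMonoidMorphism.Build tser R (tcoef 0)
  tcoef0_is_multiplicative.

Lemma tser_unit (z : tser) v : tcoef 0 z * v = 1 -> exists w, z * w = 1.
Proof.
move=> e; have [q eq] := @ps_unit _ (qrepr z) v e.
by exists (tcls q); rewrite -(qreprK z) -rmorphM eq rmorph1.
Qed.
End Truncated.

(** * Universal property and localization of Hasse-Schmidt algebras *)

Lemma cmonom_ind (I : choiceType) (P : {cmonom I} -> Prop) : P mone ->
  (forall i k, P k -> P (mmul (ucm i) k)) -> forall k, P k.
Proof.
move=> P1 PM k; have [n] := ubnP (mdeg k); elim: n k => // n IH k /ltnSE dk.
have [->//|k1] := pselect (k = mone).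
have [i ki] : exists i, k i != 0%N.
  apply: contrapT => /forallNP no; apply: k1; apply/eqP/cmP => i.
  by rewrite cm1; have /negP/negPn/eqP := no i.
have ek : k = mmul (ucm i) (divcm k (ucm i)).
  apply/eqP/cmP => j; rewrite cmM divcmE cmU.
  by case: eqVneq => [<-|_]; [rewrite subnKC // lt0n|rewrite subn0].
rewrite ek; apply/PM/IH; apply: leq_trans dk.
by rewrite [in ltnRHS]ek mdegM mdegU.
Qed.

Lemma polyalg_ind (R : comPzRingType) (I : choiceType) (P : polyalg R I -> Prop) :
  (forall x y, P x -> P y -> P (x + y)) ->
  (forall x y, P x -> P y -> P (x * y)) ->
  (forall c, P (pconst I c)) -> (forall i, P (pvar R i)) -> forall g, P g.
Proof.
move=> PD PM PC PV; apply: malg_indU => // [|c k].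
  by have := PC 0; rewrite rmorph0.
elim/cmonom_ind: k => [|i k Pk]; first by have := PC c; rewrite pconst.unlock.
have := PM _ _ (PV i) Pk; rewrite pvar.unlock.
by rewrite -[_ * _]/(pmul _ _) pmulUU mul1r.
Qed.

Section HSUniversal.
Variables (m : option nat) (A B : comPzRingType) (f : {rmorphism A -> B}).
Local Notation H := (HS m f).

Lemma hs_dB i x y : le_order m i ->
  hs_d m f i (x - y) = hs_d m f i x - hs_d m f i y.
Proof.
move=> im; have hD u v : hs_d m f i (u + v) = hs_d m f i u + hs_d m f i v.
  have [->|i0] := posnP i; first by rewrite !hs_d0 rmorphD.
  have im' : (0 < i)%N && le_order m i by rewrite i0.
  exact: (@hs_dD m A B f (Sub i im') u v).
by apply/eqP; rewrite eq_sym subr_eq -hD subrK.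
Qed.

Lemma hs_d_base0 i a : (0 < i)%N -> le_order m i -> hs_d m f i (f a) = 0.
Proof.
move=> i0 im; have im' : (0 < i)%N && le_order m i by rewrite i0.
exact: (@hs_d_base m A B f (Sub i im') a).
Qed.

(** The polynomial algebra of which HS is a quotient is generated by its
    constants, which are the x^(0), and its variables, the other x^(i). *)
Lemma hs_ind (P : H -> Prop) :
  (forall x y, P x -> P y -> P (x + y)) ->
  (forall x y, P x -> P y -> P (x * y)) ->
  (forall i x, le_order m i -> P (hs_d m f i x)) -> forall z, P z.
Proof.
move=> PD PM PG z; have [g ->] := qcls_surj z.
elim/polyalg_ind: g => [x y|x y|c|[x i]].
- by rewrite rmorphD; exact: PD.
- by rewrite rmorphM; exact: PM.
- exact/(PG 0%N)/le_order0.
rewrite -[qcls _ _](@hs_d_var m A B f x i); apply: PG.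
by have /andP[] := valP i.
Qed.

Lemma hs_ext (R : comPzRingType) (u v : {rmorphism H -> R}) :
  (forall i x, le_order m i -> u (hs_d m f i x) = v (hs_d m f i x)) ->
  forall z, u z = v z.
Proof.
move=> e; elim/hs_ind => [x y ex ey|x y ex ey|//].
  by rewrite !rmorphD ex ey.
by rewrite !rmorphM ex ey.
Qed.

(** A ring homomorphism out of HS is a Hasse-Schmidt derivation, here packaged
    as a ring homomorphism from B into truncated power series. *)
Section Series.
Variables (R : comPzRingType) (phi : {rmorphism H -> R}).
Definition hs_series (b : B) : tser m R := tcls m (fun i => phi (hs_d m f i b)).

Lemma hs_series_coef i b : le_order m i ->
  tcoef i (hs_series b) = phi (hs_d m f i b).
Proof. exact: tcoef_cls. Qed.

Lemma hs_series_is_additive : GRing.zmod_morphism hs_series.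
Proof.
move=> x y; apply: tserP => i im.
by rewrite tcoefB // !hs_series_coef // hs_dB // rmorphB.
Qed.
Lemma hs_series_is_multiplicative : GRing.monoid_morphism hs_series.
Proof.
split=> [|x y]; apply: tserP => i im; rewrite hs_series_coef //.
  rewrite tcoef1 //; have [->|i0] := posnP i; first by rewrite hs_d0 !rmorph1.
  by rewrite -(rmorph1 f) hs_d_base0 // rmorph0.
rewrite hs_dM // tcoefM // rmorph_sum; apply: eq_bigr => j _; rewrite rmorphM.
rewrite !hs_series_coef //; apply: le_order_trans im; first exact: leq_subr.
by rewrite -ltnS.
Qed.
HB.instance Definition _ := GRing.isZmodMorphism.Build B (tser m R) hs_series
  hs_series_is_additive.
HB.instance Definition _ := GRing.isMonoidMorphism.Build B (tser m R) hs_series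
  hs_series_is_multiplicative.
End Series.

Variables (R : comPzRingType) (D : {rmorphism B -> tser m R}).
Hypothesis DA : forall i a, (0 < i)%N -> le_order m i -> tcoef i (D (f a)) = 0.

(** Conversely, a ring homomorphism D from B to truncated power series gives a
    homomorphism out of HS that sends d_i x to the coefficient of t^i in D x:
    multiplicativity of D is the Leibniz rule. *)
Definition hs_poly_lift : {rmorphism hs_poly m B -> R} :=
  peval (@tcoef m R 0 \o D) (fun u => tcoef (val u.2) (D u.1)).

Lemma hs_poly_lift_sym x i : le_order m i ->
  hs_poly_lift (hs_sym m x i) = tcoef i (D x).
Proof.
rewrite /hs_sym => im; case: eqP => [->|/eqP i0]; first exact: peval_const.
have ip : (0 < i)%N && le_order m i by rewrite lt0n i0.
rewrite (insubT (fun i => (0 < i)%N && le_order m i) ip); exact: peval_var.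
Qed.

Lemma hs_poly_lift_rel r : hs_relations f r -> hs_poly_lift r = 0.
Proof.
have V x (i : hs_index m) : hs_poly_lift (hs_var x i) = tcoef (val i) (D x).
  exact: peval_var.
have im (i : hs_index m) : le_order m (val i) by have /andP[] := valP i.
case=> [[x [y [i ->]]]|[a [i ->]]|[x [y [k [km ->]]]]].
- rewrite !rmorphB !V rmorphD tcoefD //.
  by rewrite addrAC addrK subrr.
- by rewrite V DA //; have /andP[] := valP i.
rewrite rmorphB hs_poly_lift_sym // rmorphM tcoefM // rmorph_sum.
apply/eqP; rewrite subr_eq0; apply/eqP; apply: eq_bigr => i _.
rewrite rmorphM !hs_poly_lift_sym //; apply: le_order_trans km.
  exact: leq_subr.
by rewrite -ltnS.
Qed.

Lemma hs_poly_lift_ideal r :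
  ideal_gen (@hs_relations m A B f) r -> hs_poly_lift r = 0.
Proof.
have kD x y : hs_poly_lift x = 0 -> hs_poly_lift y = 0 -> hs_poly_lift (x + y) = 0.
  by move=> hx hy; rewrite rmorphD hx hy addr0.
have kM a x : hs_poly_lift x = 0 -> hs_poly_lift (a * x) = 0.
  by move=> hx; rewrite rmorphM hx mulr0.
move=> /(_ (@Ideal _ [set x | hs_poly_lift x = 0] (rmorph0 _) kD kM)); apply.
exact: hs_poly_lift_rel.
Qed.

Definition hs_lift : {rmorphism H -> R} := qlift hs_poly_lift_ideal.

Lemma hs_lift_d i x : le_order m i -> hs_lift (hs_d m f i x) = tcoef i (D x).
Proof. by move=> im; rewrite [LHS]qlift_cls hs_poly_lift_sym. Qed.
End HSUniversal.

Lemma common_denominator (R : comPzRingType) (p q z w x y : R) :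
  p * z = x -> q * w = y -> p * q * (z + w) = q * x + p * y.
Proof. by move=> <- <-; ring. Qed.

Section HSAway.
Variables (m : option nat) (A B B' : comPzRingType).
Variables (f : {rmorphism A -> B}) (f' : {rmorphism A -> B'}).
Variables (h : {rmorphism B -> B'}) (sq : forall a, h (f a) = f' (idfun a)).
Variables (b : B) (ah : away b h).

Local Notation H := (HS m f).
Local Notation H' := (HS m f').
Local Notation cb := (hs_const m f b).
Let hm : {rmorphism H -> H'} := hs_map m sq.

(** z is a fraction with numerator in H and a power of b as denominator. *)
Let bounded (z : H') : Prop := exists n w, hm (cb ^+ n) * z = hm w.

Let boundedM z w : bounded z -> bounded w -> bounded (z * w).
Proof.
move=> [n [x ex]] [k [y ey]]; exists (n + k)%N, (x * y).
by rewrite exprD !rmorphM -ex -ey mulrACA.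
Qed.

Let bounded_exp k z : bounded (hm (cb ^+ k) * z) -> bounded z.
Proof.
move=> [n [x ex]]; exists (n + k)%N, x.
by rewrite exprD rmorphM -mulrA.
Qed.

Let bounded_im w : bounded (hm w).
Proof. by exists 0%N, w; rewrite expr0 rmorph1 mul1r. Qed.

Let boundedD z w : bounded z -> bounded w -> bounded (z + w).
Proof.
move=> [n [x ex]] [k [y ey]]; exists (n + k)%N, (cb ^+ k * x + cb ^+ n * y).
rewrite exprD (rmorphM hm) (rmorphD hm) !(rmorphM hm).
exact: common_denominator.
Qed.

(** Leibniz' rule expresses b^k d_i x through d_i (b^k x) and the d_j x with
    j < i. *)
Let bounded_d i x : le_order m i -> bounded (hs_d m f' i x).
Proof.
have [n] := ubnP i; elim: n i => // n IH i /ltnSE ni im.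
have [_ _ /(_ x)[k [a e]]] := ah; apply: (@bounded_exp k).
have := hs_dM f' (h (b ^+ k)) x im; rewrite e big_ord_recl subn0 hs_d0.
rewrite -(hs_map_d sq) // -/hm -(@hs_map_const m _ _ _ _ _ _ _ _ sq) -/hm rmorphXn => E.
have -> : hm (cb ^+ k) * hs_d m f' i x = hm (hs_d m f i a) +
    - \sum_(j < i) hs_d m f' (bump 0 j) (h (b ^+ k)) * hs_d m f' (i - bump 0 j) x.
  by rewrite E addrK.
apply: boundedD => //; rewrite -sumrN; apply: (big_ind bounded) => //.
  by rewrite -(rmorph0 hm).
move=> j _; have jm : le_order m (bump 0 j) by apply: le_order_trans im.
rewrite -(hs_map_d sq) // -/hm -mulNr -rmorphN; apply: boundedM => //.
apply: IH; last by apply: le_order_trans im; exact: leq_subr.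
apply: leq_trans ni; rewrite ltn_subrL /bump /=; exact: leq_ltn_trans (ltn_ord j).
Qed.

(** Hasse-Schmidt algebras commute with localization of B. The universal
    derivation of B, with values in the localization L of H at b, sends b to a
    series with invertible constant term; that series is invertible, so the
    derivation extends to B'. The homomorphism H' -> L obtained in this way
    shows that an element of H which vanishes in H' already vanishes in L. *)
Lemma hs_away : away cb hm.
Proof.
have [[t et] _ _] := ah; split.
- by exists (hs_const m f' t); rewrite /hm hs_map_const -rmorphM et rmorph1.
- pose phi : {rmorphism H -> loc (powers cb)} := @loc_const H (powers cb).
  have [[v ev] ker _] := loc_away cb.
  have Db : exists w, (hs_series phi : {rmorphism B -> _}) b * w = 1.
    by apply: (@tser_unit _ _ _ v); rewrite hs_series_coef ?le_order0.
  have DA i a : (0 < i)%N -> le_order m i -> tcoef i (away_lift ah Db (f' a)) = 0.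
    move=> i0 im; rewrite -[f' a]/(f' (idfun a)) -sq away_lift_val.
    by rewrite hs_series_coef // hs_d_base0 // rmorph0.
  have E z : hs_lift DA (hm z) = phi z.
    apply: (@hs_ext _ _ _ _ _ (hs_lift DA \o hm : {rmorphism _ -> _}) phi) => i x im.
    rewrite -[LHS]/(hs_lift DA (hs_map m sq (hs_d m f i x))).
    rewrite hs_map_d // hs_lift_d // away_lift_val.
    exact: hs_series_coef.
  by move=> z /(congr1 (hs_lift DA)); rewrite E rmorph0 => /ker.
by move=> z; elim/hs_ind: z => //; exact: bounded_d.
Qed.
End HSAway.

(** * Sections of the structure sheaf of a spectrum *)

Section SpecBasics.
Variable A : comPzRingType.
Implicit Types (p q : spec A) (a b : A) (U V : opens (spec A)).

Lemma basic_open_open b : open ([set p : spec A | ~ p b] : set (spec A)).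
Proof.
by exists [set b] => p; split=> [pb|[a -> //]]; exists b.
Qed.
Definition basic_open b : opens (spec A) := Opens (basic_open_open b).

Lemma basic_open_basis U p : U p -> exists2 a, ~ p a & basic_open a ⊆ U.
Proof.
have [E EU] := opens_open U => /EU[a Ea pa]; exists a => // q qa.
by apply/EU; exists a.
Qed.

(** The annihilator of x is contained in no prime of D(b), so it contains a
    power of b. *)
Lemma locally_killed (M : lmodType A) (x : M) b :
  (forall p, ~ p b -> exists u, ~ p u /\ u *: x = 0) -> exists n, b ^+ n *: x = 0.
Proof.
move=> h; apply: contrapT => /forallNP no.
have annD u v : u *: x = 0 -> v *: x = 0 -> (u + v) *: x = 0.
  by move=> eu ev; rewrite scalerDl eu ev addr0.
have annM a u : u *: x = 0 -> (a * u) *: x = 0.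
  by move=> eu; rewrite -scalerA eu scaler0.
have [p [Jp pb]] := @exists_prime A b (Ideal (scale0r x) annD annM) no.
by have [u [pu /Jp]] := h p pb.
Qed.

Lemma mfrac_eqP (M : lmodType A) p (x y : M) a b (pa : pcompl p a) (pb : pcompl p b) :
  mfrac x pa = mfrac y pb <-> exists u, ~ p u /\ u *: (b *: x - a *: y) = 0.
Proof.
split=> [/fracP[u [pu e]]|[u [pu e]]].
  by exists u; rewrite scalerBr e subrr.
apply/fracP; exists u; split=> //; apply/eqP; rewrite -subr_eq0 -scalerBr.
exact/eqP.
Qed.

Section Sections.
Variable U : opens (spec A).

Lemma sec_local a : @locally_fraction A A^o U (fun p _ => (loc_const (pcompl p) a : loc _)).
Proof.
move=> p Up; exists U, (@osub_refl _ U); split=> //; exists a, 1 => q Uq.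
by exists (@pcompl1 _ q); exact: frac_irr.
Qed.
(** The section a / 1 over U. *)
Definition sec a : spec_sections U := Tilde (sec_local a).

Lemma sec_is_additive : GRing.zmod_morphism sec.
Proof. by move=> a b; apply: tildeP => p Up; exact: (rmorphB (@loc_const A (pcompl p))). Qed.
Lemma sec_is_multiplicative : GRing.monoid_morphism sec.
Proof.
split=> [|a b]; apply: tildeP => p Up //.
exact: (rmorphM (@loc_const A (pcompl p))).
Qed.
HB.instance Definition _ := GRing.isZmodMorphism.Build A (spec_sections U) sec
  sec_is_additive.
HB.instance Definition _ := GRing.isMonoidMorphism.Build A (spec_sections U) sec
  sec_is_multiplicative.

Lemma sec_unit b : (forall p, U p -> ~ p b) -> exists t, sec b * t = 1.
Proof.
move=> Ub.
have loc : @locally_fraction A A^o U (fun p Up => @mfrac _ (pcompl p) A^o 1 b (Ub p Up)).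
  move=> p Up; exists U, (@osub_refl _ U); split=> //; exists 1, b => q Uq.
  exists (Ub q Uq); exact: frac_irr.
exists (Tilde loc); apply: tildeP => p Up.
rewrite -[LHS]/(lscale _ _) fracZ; apply: fracE.
by rewrite mul1r scale1r.
Qed.

(** The sections over D(b) are the fractions over the powers of b. Locally a
    section is x / a; on a smaller basic open D(g) it is also g x / (g a), and
    D(g a) = D(g) there, so it is a fraction whose denominator defines its
    domain. Such fractions are glued by [glue_fractions]. *)
Lemma sec_away b : (forall p, U p <-> ~ p b) -> away b sec.
Proof.
move=> UE; split.
- by apply: sec_unit => p /UE.
- move=> a /(congr1 (fun s : tilde A^o U => tilde_val s)) e.
  have [|n en] := @locally_killed A^o a b; last by exists n.
  move=> p /UE Up; have /(congr1 (fun s => s p Up)) := e.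
  move=> /mfrac_eqP[u [pu eu]]; exists u; split=> //.
  by move: eu; rewrite scaler0 subr0 scale1r.
move=> s; pose G (g x : A) := basic_open g ⊆ U /\
  forall p (Up : U p) (pg : pcompl p g), (s : tilde A^o U) p Up = @mfrac _ _ A^o x _ pg.
have [||n [z zP]] := @glue_fractions A A idfun G b.
- move=> p /UE Up; have [V [VU [Vp [x [a xa]]]]] := tilde_loc (s : tilde A^o U) Up.
  have [g pg gV] := basic_open_basis Vp; exists (g * a), (g * x); split; last first.
    by have [pa _] := xa p Vp; case/prime_ideal_prime.
  split=> [q|q Uq] /= qga.
    by apply/VU/gV => qg; apply: qga; rewrite mulrC; exact: ideal_mul.
  have Vq : V q by apply: gV => qg; apply: qga; rewrite mulrC; exact: ideal_mul.
  have [qa eq] := xa q Vq; rewrite (tilde_ap _ Uq (VU q Vq)) eq.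
  apply: fracE; rewrite -[LHS]/(g * a * x) -[RHS]/(a * (g * x)); ring.
- move=> g x g' x' [gU gx] [gU' gx'].
  have [|n en] := @locally_killed A^o (g' * x - g * x') (g * g'); last by exists n.
  move=> p pgg; have pg : ~ p g by move=> pg; apply: pgg; rewrite mulrC; exact: ideal_mul.
  have pg' : ~ p g' by move=> pg'; apply: pgg; exact: ideal_mul.
  by apply/mfrac_eqP; rewrite -(gx p (gU p pg) pg); exact: gx'.
exists n, z; apply: tildeP => p Up; have [g [x [[gU gx] pg [N eN]]]] := zP p ((UE p).1 Up).
rewrite -[LHS]/(lscale (loc_const (pcompl p) (b ^+ n)) ((s : tilde A^o U) p Up)).
rewrite (gx p Up pg) fracZ; apply/mfrac_eqP; exists (g ^+ N).
split; first by move/prime_exp.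
rewrite scale1r -[LHS]/(g ^+ N * (b ^+ n * x - 1 * g * z)) mul1r.
have e : g ^+ N * (g * z - b ^+ n * x) = 0 by exact: eN.
by rewrite -opprB mulrN e oppr0.
Qed.

End Sections.

Lemma sec_res U V (VU : V ⊆ U) a : spec_res VU (sec U a) = sec V a.
Proof. exact: tildeP. Qed.

Lemma sec_germ_unit U p a : U p ->
  germ_unit (sec U a : spec_presheaf A U) p <-> ~ p a.
Proof.
move=> Up; split=> [[V [VU [Vp [t /= et]]]] pa|pa].
  move: et; rewrite sec_res => /(congr1 (fun s : tilde A^o V => s p Vp)).
  rewrite -[LHS]/(lscale (loc_const (pcompl p) a) ((t : tilde A^o V) p Vp)).
  have [x [c [pc ->]]] := frac_ex ((t : tilde A^o V) p Vp).
  rewrite fracZ => /mfrac_eqP[u [pu]].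
  rewrite scale1r -[LHS]/(u * (a * x - 1 * c * 1)) mul1r mulr1 => e.
  have : p (u * c).
    have -> : u * c = u * x * a by apply/eqP; rewrite eq_sym -subr_eq0 -e; apply/eqP; ring.
    exact: ideal_mul.
  by case/prime_ideal_prime.
exists (ocap U (basic_open a)), (@ocapl _ _ _); split=> //.
have [q [_ qa]//|t et] := @sec_unit (ocap U (basic_open a)) a.
by exists t; rewrite /= sec_res.
Qed.
End SpecBasics.

(** * Basic opens of a spectrum are spectra *)

Lemma spec_ext (A : comPzRingType) (p q : spec A) : (forall a, p a <-> q a) -> p = q.
Proof.
case: p q => [[p p0 pD pM] p1 pP] [[q q0 qD qM] q1 qP] /= e.
have epq : p = q by apply: funext => a; exact/propext.
case: _ / epq in q0 qD qM q1 qP e *; move: p1 pP q1 qP {e}.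
rewrite (Prop_irrelevance p0 q0) (Prop_irrelevance pD qD) (Prop_irrelevance pM qM).
by move=> p1 pP q1 qP; congr PrimeIdeal; exact: Prop_irrelevance.
Qed.

Section SpecMap.
Variables (A A' : comPzRingType) (g : {rmorphism A -> A'}).

Section Preimage.
Variable q : spec A'.
Lemma pre_ideal0 : q (g 0). Proof. by rewrite rmorph0; exact: ideal_0. Qed.
Lemma pre_idealD x y : q (g x) -> q (g y) -> q (g (x + y)).
Proof. by rewrite rmorphD; exact: ideal_add. Qed.
Lemma pre_idealM a x : q (g x) -> q (g (a * x)).
Proof. by rewrite rmorphM; exact: ideal_mul. Qed.
Lemma pre_ideal1 : ~ q (g 1). Proof. by rewrite rmorph1; exact: prime_ideal_proper. Qed.
Lemma pre_idealP x y : q (g (x * y)) -> q (g x) \/ q (g y).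
Proof. by rewrite rmorphM; exact: prime_ideal_prime. Qed.
(** The contraction of q along g. *)
Definition spec_map : spec A := @PrimeIdeal A
  (@Ideal A [set a | q (g a)] pre_ideal0 pre_idealD pre_idealM) pre_ideal1 pre_idealP.
End Preimage.

Lemma spec_map_cont : continuous spec_map.
Proof.
apply/continuousP => U [E EU]; exists (g @` E) => q; split.
  by move=> /EU[a Ea qa]; exists (g a) => //; exists a.
by move=> [_ [a Ea <-] qa]; apply/EU; exists a.
Qed.

Section Stalk.
Variable q : spec A'.
Let gq : {rmorphism A -> loc (pcompl q)} := @loc_const A' (pcompl q) \o g.

Lemma stalk_inverts : inverts (pcompl (spec_map q)) gq.
Proof.
move=> s qs; exists (@loc_frac A' (pcompl q) 1 (g s) qs).
rewrite -[LHS]/(lscale _ _) fracZ; apply: fracE.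
by rewrite mul1r scale1r.
Qed.

Definition stalk_map : {rmorphism loc (pcompl (spec_map q)) -> loc (pcompl q)} :=
  loc_lift stalk_inverts.

Lemma stalk_map_frac x a (pa : pcompl (spec_map q) a) :
  stalk_map (@mfrac _ _ A^o x a pa) = @mfrac _ (pcompl q) A'^o (g x) (g a) pa.
Proof.
apply: (loc_liftP _ erefl); rewrite -[LHS]/(lscale _ _) fracZ; apply: fracE.
by rewrite mul1r scale1r.
Qed.
End Stalk.

Section Comorph.
Variable V : opens (spec A).
Let V' := opre spec_map_cont V.

Lemma spec_comorph_local (s : tilde A^o V) :
  @locally_fraction A' A'^o V' (fun q Vq => stalk_map q (s (spec_map q) Vq)).
Proof.
move=> q Vq; have [W [WV [Wq [x [a xa]]]]] := tilde_loc s Vq.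
exists (opre spec_map_cont W), (opreS _ WV); split=> //; exists (g x), (g a) => r Wr.
have [ra er] := xa _ Wr; exists ra.
by rewrite (tilde_ap s _ (WV _ Wr)) er stalk_map_frac.
Qed.

Definition spec_comorph_fun (s : spec_sections V) : spec_sections V' :=
  Tilde (spec_comorph_local s).

Lemma spec_comorph_is_additive : GRing.zmod_morphism spec_comorph_fun.
Proof. by move=> s t; apply: tildeP => q Vq; exact: (rmorphB (stalk_map q)). Qed.
Lemma spec_comorph_is_multiplicative : GRing.monoid_morphism spec_comorph_fun.
Proof.
split=> [|s t]; apply: tildeP => q Vq; first exact: (rmorph1 (stalk_map q)).
exact: (rmorphM (stalk_map q)).
Qed.
HB.instance Definition _ := GRing.isZmodMorphism.Build (spec_sections V)
  (spec_sections V') spec_comorph_fun spec_comorph_is_additive.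
HB.instance Definition _ := GRing.isMonoidMorphism.Build (spec_sections V)
  (spec_sections V') spec_comorph_fun spec_comorph_is_multiplicative.
End Comorph.

Lemma spec_comorph_res (V W : opens (spec A)) (h : W ⊆ V) (s : spec_sections V) :
  spec_comorph_fun (spec_res h s) =
  spec_res (opreS spec_map_cont h) (spec_comorph_fun s).
Proof.
apply: tildeP => q Wq; congr (stalk_map q _).
exact: (tilde_ap (s : tilde A^o V)).
Qed.

Definition spec_mor : ringed_morphism (Spec A') (Spec A) :=
  @RingedMorphism (Spec A') (Spec A) spec_map spec_map_cont
    (fun V => @spec_comorph_fun V : {rmorphism _ -> _}) spec_comorph_res.
End SpecMap.

Section AwayImmersion.
Variables (A A' : comPzRingType) (b : A) (g : {rmorphism A -> A'}).
Hypothesis ag : away b g.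
Local Notation phi := (spec_map g).

(** As b is invertible in A', a prime of A' is determined by the numerators of
    its elements. *)
Lemma away_primeE (q : spec A') n y a : g (b ^+ n) * y = g a -> q y <-> phi q a.
Proof.
have [[t et] _ _] := ag => e; split=> [qy|qa].
  by rewrite /= -e; exact: ideal_mul.
have -> : y = t ^+ n * g a.
  by rewrite -e mulrA rmorphXn -exprMn mulrC (mulrC t) et expr1n mulr1.
exact: ideal_mul.
Qed.

Lemma away_prime_b (q : spec A') : ~ phi q b.
Proof.
have [[t et] _ _] := ag => qb; apply: (@prime_ideal_proper _ q).
by rewrite -et mulrC; exact: ideal_mul.
Qed.

Lemma spec_map_inj : injective phi.
Proof.
move=> q r e; apply: spec_ext => y; have [_ _ /(_ y)[n [a ey]]] := ag.
by rewrite (away_primeE q ey) (away_primeE r ey) e.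
Qed.

Lemma spec_map_range (p : spec A) : ~ p b -> exists q, phi q = p.
Proof.
move=> pb; have [[t et] ker frac] := ag.
pose Q (y : A') := exists n a, g (b ^+ n) * y = g a /\ p a.
have cancel a : Q (g a) -> p a.
  move=> [n [c [e pc]]]; have [|k ek] := ker (b ^+ n * a - c).
    by rewrite rmorphB rmorphM e subrr.
  have : p (b ^+ (k + n) * a).
    have -> : b ^+ (k + n) * a = b ^+ k * c.
      by apply/eqP; rewrite -subr_eq0 exprD -mulrA -mulrBr ek.
    exact: ideal_mul.
  by case/prime_ideal_prime => // /prime_exp.
have Q0 : Q 0 by exists 0%N, 0; rewrite mulr0 rmorph0; split=> //; exact: ideal_0.
have QD y z : Q y -> Q z -> Q (y + z).
  move=> [n [a [e pa]]] [k [c [e' pc]]]; exists (n + k)%N, (b ^+ k * a + b ^+ n * c).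
  split; first by rewrite exprD !rmorphD !(rmorphM g) -e -e'; ring.
  by apply: ideal_add; exact: ideal_mul.
have QM z y : Q y -> Q (z * y).
  move=> [n [a [e pa]]]; have [k [c e']] := frac z; exists (n + k)%N, (c * a).
  split; first by rewrite exprD !(rmorphM g) -e -e'; ring.
  exact: ideal_mul.
have Q1 : ~ Q 1 by rewrite -(rmorph1 g) => /cancel; exact: prime_ideal_proper.
have QP y z : Q (y * z) -> Q y \/ Q z.
  have [n [a e]] := frac y; have [k [c e']] := frac z.
  move=> /(QM (g (b ^+ n) * g (b ^+ k))); rewrite mulrACA e e' -rmorphM.
  by move=> /cancel /prime_ideal_prime[pa|pc]; [left; exists n, a|right; exists k, c].
exists (@PrimeIdeal A' (Ideal Q0 QD QM) Q1 QP); apply: spec_ext => a.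
split; first exact: cancel.
by exists 0%N, a; rewrite expr0 rmorph1 mul1r.
Qed.

Lemma spec_map_open (U : opens (spec A')) : open (phi @` (U : set _)).
Proof.
exists [set e | forall p : spec A, ~ p e -> (phi @` (U : set _)) p] => p; split.
  move=> [q Uq <-]; have [c qc cU] := basic_open_basis Uq.
  have [_ _ /(_ c)[n [a e]]] := ag; exists (b * a).
    move=> r rba; have rb : ~ r b by move=> rb; apply: rba; rewrite mulrC; exact: ideal_mul.
    have [s es] := spec_map_range rb; exists s => //; apply: cU => /(away_primeE s e).
    by rewrite es => ra; apply: rba; exact: ideal_mul.
  by case/prime_ideal_prime => [/away_prime_b//|/(away_primeE q e)].
by move=> [e he pe]; exact: he.
Qed.

Lemma stalk_map_inj (q : spec A') : injective (stalk_map g q).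
Proof.
have [_ ker frac] := ag.
move=> z w; have [x [a [pa ->]]] := frac_ex z; have [y [c [pc ->]]] := frac_ex w.
rewrite !stalk_map_frac => /mfrac_eqP[u [qu e]]; apply/mfrac_eqP.
have [n [d ed]] := frac u.
have {}e : g (d * (c * x - a * y)) = 0.
  rewrite rmorphM -ed -mulrA; move: e; rewrite -[X in X = _ -> _]/(u * _).
  by rewrite rmorphB !rmorphM => e; rewrite [X in _ * X]e mulr0.
have [k ek] := ker _ e; exists (b ^+ k * d); split; last by rewrite -scalerA.
case/prime_ideal_prime; last by move/(away_primeE q ed).
by move/(@prime_exp _ (phi q)); exact: away_prime_b.
Qed.

(** The stalk maps are bijective, and a fraction over A' becomes a fraction over
    A when numerator and denominator are multiplied by powers of b; so a section
    over Spec A' defines stalkwise a section over Spec A. *)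
Lemma spec_comorph_bij (V : opens (spec A)) : (V : set _) `<=` range phi ->
  bijective (@spec_comorph_fun _ _ g V).
Proof.
move=> Vr; apply: inj_surj_bijective.
  move=> s t e; apply: tildeP => p Vp; have [q _ eq] := Vr p Vp.
  case: _ / eq in Vp *; apply: (@stalk_map_inj q).
  exact: (congr1 (fun s : tilde A'^o (opre (@spec_map_cont _ _ g) V) => s q Vp) e).
move=> t; have [_ _ frac] := ag.
pose T q Vq := (t : tilde A'^o (opre (@spec_map_cont _ _ g) V)) q Vq.
have TE q Vq Vq' : T q Vq = T q Vq' by exact: tilde_ap.
(* mu in the stalk at p and nu in the stalk at q have a common expression as
   a fraction over A; unlike nu = stalk_map mu this makes sense before p is known
   to be the image of q. *)
pose rel p (mu : loc (pcompl p)) q (nu : loc (pcompl q)) :=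
  exists x a (pa : pcompl p a) (qa : pcompl q (g a)),
    mu = @mfrac _ _ A^o x a pa /\ nu = @mfrac _ _ A'^o (g x) (g a) qa.
have ex p (Vp : V p) : exists mu, forall q (e : phi q = p) (Vq : V (phi q)),
    rel p mu q (T q Vq).
  have [q _ eq] := Vr p Vp; case: _ / eq in Vp *.
  have [y [c [qc ec]]] := frac_ex (T q Vp).
  have [n [x ex]] := frac y; have [k [a ea]] := frac c.
  have pa : pcompl (phi q) (b ^+ n * a).
    case/prime_ideal_prime; last by move/(away_primeE q ea).
    by move/(@prime_exp _ (phi q)); exact: away_prime_b.
  exists (@mfrac _ _ A^o (b ^+ k * x) _ pa) => r er Vr'.
  have er' := spec_map_inj er; case: _ / (esym er') in Vr' er *.
  exists (b ^+ k * x), (b ^+ n * a), pa, pa; split=> //.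
  rewrite (TE q Vr' Vp) ec; apply: fracE.
  rewrite -[LHS]/(g (b ^+ n * a) * y) -[RHS]/(c * g (b ^+ k * x)).
  by rewrite !(rmorphM g) -ex -ea; ring.
pose s0 p Vp := sval (cid (ex p Vp)).
have s0P p Vp : forall q (e : phi q = p) (Vq : V (phi q)), rel p (s0 p Vp) q (T q Vq).
  by rewrite /s0; case: cid.
have s0loc : @locally_fraction A A^o V s0.
  move=> p Vp; have [q _ eq] := Vr p Vp; case: _ / eq in Vp *.
  have [W [WV [Wq [y [c yc]]]]] := tilde_loc (t : tilde A'^o _) (Vp : opre _ V q).
  have [n [x ex']] := frac y; have [k [a ea]] := frac c.
  pose W' : opens (spec A) := Opens (spec_map_open W).
  have W'V : W' ⊆ V by move=> _ [r Wr <-]; exact: (WV r).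
  exists W', W'V; split; first by exists q.
  exists (b ^+ k * x), (b ^+ n * a) => p' W'p'; have [r Wr er] := W'p'.
  case: _ / er in W'p' *.
  have [rc ec] := yc r Wr.
  have pa : pcompl (phi r) (b ^+ n * a).
    case/prime_ideal_prime; last by move/(away_primeE r ea).
    by move/(@prime_exp _ (phi r)); exact: away_prime_b.
  exists pa; apply: (@stalk_map_inj r).
  have [x' [a' [pa' [qa' [-> e2]]]]] := s0P _ (W'V _ W'p') r erefl (WV r Wr).
  rewrite !stalk_map_frac; transitivity (T r (WV r Wr)).
    by rewrite e2; exact: frac_irr.
  rewrite /T ec; apply: fracE.
  rewrite -[LHS]/(g (b ^+ n * a) * y) -[RHS]/(c * g (b ^+ k * x)).
  by rewrite !(rmorphM g) -ex' -ea; ring.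
exists (Tilde s0loc); apply: tildeP => q Vq /=.
have [x [a [pa [qa [-> e2]]]]] := s0P _ Vq q erefl Vq.
by rewrite stalk_map_frac -/(T q Vq) e2; exact: frac_irr.
Qed.

Lemma spec_mor_open_immersion : is_open_immersion (spec_mor g).
Proof. by split; [exact: spec_map_inj|exact: spec_map_open|exact: spec_comorph_bij]. Qed.

End AwayImmersion.

(** * Gluing, units and composition *)

Lemma inverse_rmorphism (R S : comPzRingType) (u : {rmorphism R -> S}) :
  bijective u -> exists v : {rmorphism S -> R}, cancel u v /\ cancel v u.
Proof.
case=> v uv vu; have inj := can_inj uv.
have vB : GRing.zmod_morphism v by move=> x y; apply: inj; rewrite rmorphB !vu.
have vM : GRing.monoid_morphism v.
  by split=> [|x y]; apply: inj; rewrite ?rmorph1 ?rmorphM !vu.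
pose va := GRing.isZmodMorphism.Build S R v vB.
pose vm := GRing.isMonoidMorphism.Build S R v vM.
pose w : {rmorphism S -> R} := HB.pack v va vm.
by exists w.
Qed.

Lemma opens_ext (X : topologicalType) (U V : opens X) :
  (forall x, U x <-> V x) -> U = V.
Proof.
case: U V => [U oU] [V oV] /= e.
have eUV : U = V by apply: funext => x; exact/propext.
by case: _ / eUV in oV e *; congr Opens; exact: Prop_irrelevance.
Qed.

Section SheafTools.
Variables (X : topologicalType) (F : sheaf X).

Lemma sheaf_sep (U : opens X) (s t : F U) :
  (forall x, U x -> exists (W : opens X) (h : W ⊆ U), W x /\ res h s = res h t) ->
  s = t.
Proof.
move=> loc; pose I := {W : opens X | exists h : W ⊆ U, res h s = res h t}.
pose C (i : I) : opens X := sval i.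
have CU i : C i ⊆ U by case: (svalP i).
have [||r [_ ru]] := @sheafP _ F I U C CU _ (fun i => res (CU i) s).
- by move=> x /loc[W [h [Wx e]]]; exists (exist _ W (ex_intro _ h e)).
- by move=> i j; rewrite !(res_comp _ _ (osub_trans (@ocapl _ _ _) (CU i))).
rewrite -(ru s) // -(ru t) // => i; have [h e] := svalP i.
by rewrite (Prop_irrelevance (CU i) h).
Qed.

(** The gluing property for sections singled out by a predicate Q, all of them
    at once, instead of an indexed family; agreement is only asked locally. *)
Lemma sheaf_glue (U : opens X) (Q : forall W : opens X, F W -> Prop) :
  (forall x, U x -> exists (W : opens X) (s : F W), [/\ W ⊆ U, W x & Q W s]) ->
  (forall W W' (s : F W) (s' : F W'), Q W s -> Q W' s' -> forall x, W x -> W' x ->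
     exists (W2 : opens X) (h : W2 ⊆ W) (h' : W2 ⊆ W'), W2 x /\ res h s = res h' s') ->
  exists t : F U, forall W (h : W ⊆ U) s, Q W s -> res h t = s.
Proof.
move=> cov comp.
pose I := {u : {W : opens X & F W} | projT1 u ⊆ U /\ Q (projT1 u) (projT2 u)}.
pose C (i : I) : opens X := projT1 (sval i).
have CU i : C i ⊆ U by case: (svalP i).
have [||r [rP _]] := @sheafP _ F I U C CU _ (fun i => projT2 (sval i)).
- move=> x /cov[W [s [h Wx Qs]]].
  by exists (exist _ (existT (fun W : opens X => F W) W s) (conj h Qs)).
- move=> i j; apply: sheaf_sep => x [Cix Cjx].
  have [_ Qi] := svalP i; have [_ Qj] := svalP j.
  have [W [h [h' [Wx e]]]] := comp _ _ _ _ Qi Qj x Cix Cjx.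
  have hW : W ⊆ ocap (C i) (C j) by move=> y Wy; split; [exact: (h y)|exact: (h' y)].
  exists W, hW; split=> //.
  by rewrite (res_comp _ hW h) (res_comp _ hW h').
exists r => W h s Qs.
have := rP (exist _ (existT (fun W : opens X => F W) W s) (conj h Qs)).
by rewrite /= => <-; congr (res _ r); exact: Prop_irrelevance.
Qed.
End SheafTools.

Section UnitLocus.
Variables (X : topologicalType) (F : presheaf X) (V : opens X) (b : F V).

Lemma unit_locus_open : open ([set x | germ_unit b x] : set X).
Proof.
have -> : [set x | germ_unit b x] =
    \bigcup_(W in [set W : opens X | exists h : W ⊆ V, exists t, res h b * t = 1])
       (W : set X).
  apply/seteqP; split=> [x [W [h [Wx tW]]]|x [W [h tW] Wx]]; first by exists W => //; exists h.
  by exists W, h.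
by apply: bigcup_open => W _; exact: opens_open.
Qed.

Definition unit_locus : opens X := Opens unit_locus_open.

Lemma unit_locus_sub : unit_locus ⊆ V.
Proof. by move=> x [W [h [Wx _]]]; exact: h. Qed.

Lemma germ_unit_res (W : opens X) (h : W ⊆ V) x : W x ->
  germ_unit (res h b) x <-> germ_unit b x.
Proof.
move=> Wx; split=> [[T [k [Tx [t e]]]]|[T [k [Tx [t e]]]]].
  by exists T, (osub_trans k h); split=> //; exists t; rewrite -(res_comp h k).
exists (ocap W T), (@ocapl _ _ _); split=> //; exists (res (@ocapr _ W T) t).
rewrite (res_comp h _ (osub_trans (@ocapl _ W T) h)).
by rewrite -(res_comp k (@ocapr _ W T)) -rmorphM e rmorph1.
Qed.

Lemma germ_unitM (c : F V) x :
  germ_unit (b * c) x <-> germ_unit b x /\ germ_unit c x.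
Proof.
split=> [[W [h [Wx [t]]]]|[[W [h [Wx [t e]]]] [W' [h' [W'x [t' e']]]]]].
  rewrite rmorphM => e; split; exists W, h; split=> //.
    by exists (res h c * t); rewrite mulrA.
  by exists (res h b * t); rewrite mulrCA mulrA.
have hh := osub_trans (@ocapl _ W W') h.
exists (ocap W W'), hh; split=> //.
exists (res (@ocapl _ W W') t * res (@ocapr _ W W') t').
rewrite rmorphM -{1}(res_comp h (@ocapl _ W W') hh) -(res_comp h' (@ocapr _ W W') hh).
by rewrite mulrACA -!rmorphM e e' !rmorph1 mulr1.
Qed.

Lemma germ_unitX n x : germ_unit (b ^+ n.+1) x <-> germ_unit b x.
Proof.
elim: n => [|n IH]; first by rewrite expr1.
by rewrite exprS germ_unitM IH; split=> [[]|].
Qed.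
End UnitLocus.

(** Inverses are unique, so the local inverses of b agree and glue. *)
Lemma germ_unit_global (X : topologicalType) (F : sheaf X) (V W : opens X)
  (h : W ⊆ V) (b : F V) : (forall x, W x -> germ_unit b x) ->
  exists t, res h b * t = 1.
Proof.
move=> gb.
have [||t tP] := @sheaf_glue _ F W
    (fun T t => exists k : T ⊆ W, res (osub_trans k h) b * t = 1).
- move=> x Wx; have [T [k [Tx [t e]]]] := (germ_unit_res b h Wx).2 (gb x Wx).
  by exists T, t; split=> //; exists k; rewrite -(res_comp h k).
- move=> T T' t t' [k e] [k' e'] x Tx T'x.
  exists (ocap T T'), (@ocapl _ _ _), (@ocapr _ _ _); split=> //.
  have hTT := osub_trans (@ocapl _ T T') (osub_trans k h).
  move/(congr1 (res (@ocapl _ T T'))): e; move/(congr1 (res (@ocapr _ T T'))): e'.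
  rewrite !rmorphM !rmorph1 !(res_comp _ _ hTT) => e' e.
  by rewrite -[LHS]mulr1 -e' mulrCA mulrA e mul1r.
exists t; apply: sheaf_sep => x Wx.
have [T [k [Tx [u e]]]] := (germ_unit_res b h Wx).2 (gb x Wx).
exists T, k; split=> //; rewrite rmorphM rmorph1 (tP T k u) //.
by exists k; rewrite -(res_comp h k).
Qed.

Section Comp.
Variables (X Y Z : ringed_space) (j : ringed_morphism X Y) (i : ringed_morphism Y Z).

Lemma comp_cont : continuous (i \o j).
Proof. by move=> x; apply: continuous_comp; exact: rmap_cont. Qed.

Lemma comp_sub (V : opens Z) : opre comp_cont V ⊆ rpre j (rpre i V).
Proof. by []. Qed.

Definition comp_comorph (V : opens Z) :
    {rmorphism O_ Z V -> O_ X (opre comp_cont V)} :=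
  res (@comp_sub V) \o (comorph j (rpre i V) \o comorph i V).

Lemma comp_comorph_res (V W : opens Z) (h : W ⊆ V) s :
  comp_comorph W (res h s) = res (opreS comp_cont h) (comp_comorph V s).
Proof.
rewrite /comp_comorph /= !comorph_res.
have hh : opre comp_cont W ⊆ rpre j (rpre i V) by move=> x; exact: (h _).
by rewrite !(res_comp _ _ hh).
Qed.

Definition comp_mor : ringed_morphism X Z :=
  @RingedMorphism X Z (i \o j) comp_cont comp_comorph comp_comorph_res.

Lemma comp_immersion : is_open_immersion j -> is_open_immersion i ->
  is_open_immersion comp_mor.
Proof.
move=> [jinj jop jbij] [iinj iop ibij]; split.
- exact: inj_comp.
- move=> U; have -> : comp_mor @` (U : set X) = i @` (j @` (U : set X)).
    by rewrite image_comp.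
  exact: (iop (Opens (jop U))).
move=> V Vr.
have Vi : (V : set Z) `<=` range i by move=> z /Vr[x _ <-]; exists (j x).
have Vj : (rpre i V : set Y) `<=` range j.
  by move=> y /Vr[x _ /iinj <-]; exists x.
apply: bij_comp; last first.
  exact: (bij_comp (jbij _ Vj) (ibij _ Vi)).
have sup : rpre j (rpre i V) ⊆ opre comp_cont V by [].
by exists (res sup) => s; rewrite (res_comp _ _ (@osub_refl _ _)) res_id.
Qed.
End Comp.

(** * Affine opens of a scheme *)

Section Chart.
Variables (X : scheme) (A : comPzRingType) (i : ringed_morphism (Spec A) X).
Hypothesis iim : is_open_immersion i.
Variable V : opens X.
Hypothesis iV : range i = (V : set X).

Lemma chart_in p : V (i p).
Proof. by rewrite -[V _]/((V : set X) _) -iV; exists p. Qed.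

Lemma chart_point x : V x -> exists p, i p = x.
Proof.
move=> Vx; have [p _ <-] : range i x by rewrite iV.
by exists p.
Qed.

Lemma chart_comorph_bij (W : opens X) : W ⊆ V -> bijective (comorph i W).
Proof.
by case: iim => _ _ bij WV; apply: bij => x Wx; rewrite iV; exact: (WV x).
Qed.

(** A is the ring of global sections of Spec A, hence that of V. *)
Lemma chart_ring : exists alpha : {rmorphism A -> O_ X V},
  bijective alpha /\ forall a, comorph i V (alpha a) = sec (rpre i V) a.
Proof.
have sec_bij : bijective (sec (rpre i V)).
  have [_ ker frac] : away 1 (sec (rpre i V)).
    apply: sec_away => p; split=> _; first exact: prime_ideal_proper.
    exact: chart_in.
  apply: inj_surj_bijective => [a b e|s].
    have [|n] := ker (a - b); first by apply/eqP; rewrite rmorphB subr_eq0; exact/eqP.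
    by rewrite expr1n mul1r => /eqP; rewrite subr_eq0 => /eqP.
  by have [n [a]] := frac s; rewrite expr1n rmorph1 mul1r => ->; exists a.
have [v [cv vc]] := inverse_rmorphism (chart_comorph_bij (@osub_refl _ V)).
exists (v \o sec (rpre i V) : {rmorphism _ -> _}); split; last by move=> a; exact: vc.
by apply: bij_comp => //; exists (comorph i V).
Qed.

Variable alpha : {rmorphism A -> O_ X V}.
Hypothesis alphaE : forall a, comorph i V (alpha a) = sec (rpre i V) a.

Lemma comorph_alpha_res (W : opens X) (h : W ⊆ V) a :
  comorph i W (res h (alpha a)) = sec (rpre i W) a.
Proof. by rewrite comorph_res alphaE; exact: sec_res. Qed.

Lemma chart_open (N : opens (spec A)) : open (i @` (N : set _)).
Proof. by case: iim => _ op _; exact: op. Qed.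
Definition chart_image (N : opens (spec A)) : opens X := Opens (chart_open N).

Lemma chart_image_sub N : chart_image N ⊆ V.
Proof. by move=> _ [p _ <-]; exact: chart_in. Qed.

Lemma chart_image_pre N p : rpre i (chart_image N) p -> N p.
Proof. by case: iim => inj _ _ [q Nq /inj <-]. Qed.

Lemma chart_germ_unit a p : germ_unit (alpha a) (i p) <-> ~ p a.
Proof.
have Vp := chart_in p.
split=> [[W [h [Wp [t e]]]]|pa].
  apply/(@sec_germ_unit _ (rpre i V)) => //.
  exists (rpre i W), (opreS _ h); split=> //; exists (comorph i W t).
  transitivity (comorph i W (res h (alpha a) * t)); last by rewrite e rmorph1.
  by rewrite rmorphM comorph_res alphaE.
pose W := chart_image (basic_open a); have WV : W ⊆ V := @chart_image_sub _.
have [t et] : exists t, sec (rpre i W) a * t = 1.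
  by apply: sec_unit => q /chart_image_pre.
have [v vu uv] := chart_comorph_bij WV.
exists W, WV; split; first by exists p.
exists (v t); apply: (bij_inj (chart_comorph_bij WV)).
by rewrite rmorphM comorph_alpha_res uv et rmorph1.
Qed.

Lemma chart_away a (W : opens X) (h : W ⊆ V) :
  (forall x, W x <-> germ_unit (alpha a) x) -> away (alpha a) (@res _ _ _ _ h).
Proof.
move=> WE; have [v vu uv] := chart_comorph_bij h.
have inj := can_inj vu.
have [[t et] ker frac] : away a (sec (rpre i W)).
  by apply: sec_away => p; rewrite -chart_germ_unit; exact: WE.
have inj1 : injective (comorph i V) := bij_inj (chart_comorph_bij (@osub_refl _ V)).
have [beta [bb bE]] := chart_ring.
have surj y : exists c, y = alpha c.
  have [b0 b1 b2] := bb; exists (b0 y); apply: inj1.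
  by rewrite alphaE -bE b2.
split.
- exists (v t); apply: inj.
  by rewrite rmorphM comorph_alpha_res uv et rmorph1.
- move=> y; have [c ->] := surj y => /(congr1 (comorph i W)).
  rewrite comorph_alpha_res rmorph0 => /ker[n e]; exists n.
  by rewrite -rmorphXn -rmorphM e rmorph0.
move=> y; have [n [c e]] := frac (comorph i W y); exists n, (alpha c).
by apply: inj; rewrite -rmorphXn rmorphM !comorph_alpha_res.
Qed.

Lemma chart_basis (W : opens X) x : V x -> W x ->
  exists a, germ_unit (alpha a) x /\ unit_locus (alpha a) ⊆ W.
Proof.
move=> /chart_point[p <-] Wp; have [a pa aW] := @basic_open_basis _ (rpre i W) p Wp.
exists a; split; first exact/chart_germ_unit.
move=> y; have [/chart_point[q <-]|Vy] := pselect (V y).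
  by move/chart_germ_unit; exact: aW.
by move/unit_locus_sub.
Qed.

(** D(a) in Spec A is the spectrum of the localization of A at a. *)
Lemma chart_affine a : affine_open (unit_locus (alpha a)).
Proof.
have ag := loc_away a.
exists (loc (powers a)), (comp_mor (spec_mor (@loc_const A (powers a))) i); split.
  by apply: comp_immersion => //; exact: (spec_mor_open_immersion ag).
apply/seteqP; split=> [_ [q _ <-]|x].
  exact/chart_germ_unit/(away_prime_b ag).
move=> ux; have [p ep] := chart_point (unit_locus_sub ux).
move: ux; rewrite -ep => /chart_germ_unit/(spec_map_range ag)[q <-].
by exists q.
Qed.
End Chart.

Section AffineOpens.
Variables (X : scheme).
Implicit Types (V W : opens X).

Lemma affine_away V W (aV : affine_open V) (b : O_ X V) (h : W ⊆ V) :
  (forall x, W x <-> germ_unit b x) -> away b (@res _ _ _ _ h).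
Proof.
have [A [i [im iV]]] := aV; have [al [[ga ? gal] alE]] := chart_ring im iV.
by rewrite -(gal b); exact: (chart_away im iV alE).
Qed.

Lemma affine_unit_locus V (aV : affine_open V) (b : O_ X V) :
  affine_open (unit_locus b).
Proof.
have [A [i [im iV]]] := aV; have [al [[ga ? gal] alE]] := chart_ring im iV.
by rewrite -(gal b); exact: (chart_affine im iV alE).
Qed.

Lemma affine_basis V W x (aV : affine_open V) : V x -> W x ->
  exists b : O_ X V, germ_unit b x /\ unit_locus b ⊆ W.
Proof.
have [A [i [im iV]]] := aV; have [al [_ alE]] := chart_ring im iV.
by move=> Vx Wx; have [a h] := chart_basis im iV alE Vx Wx; exists (al a).
Qed.

(** Points of V are the prime ideals of O_X(V). Together with [ideal1P] this
    turns a local statement on V into the assertion that an ideal contains 1. *)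
Lemma affine_prime_point V (aV : affine_open V) (P : spec (O_ X V)) :
  exists2 x, V x & forall b : O_ X V, germ_unit b x <-> ~ P b.
Proof.
have [A [i [im iV]]] := aV; have [al [[ga ? gal] alE]] := chart_ring im iV.
exists (i (spec_map al P)); first exact: (chart_in iV).
by move=> b; rewrite -(gal b) (chart_germ_unit im iV alE).
Qed.

Lemma affine_point_prime V (aV : affine_open V) x : V x ->
  exists P : spec (O_ X V), forall b : O_ X V, germ_unit b x <-> ~ P b.
Proof.
have [A [i [im iV]]] := aV; have [al [bal alE]] := chart_ring im iV.
have [ga [alga gaal]] := inverse_rmorphism bal.
move=> /(chart_point iV)[p <-]; exists (spec_map ga p) => b.
by rewrite -{1}(gaal b) (chart_germ_unit im iV alE).
Qed.

Lemma affine_nbhd (x : X) W : W x -> exists V, [/\ affine_open V, V x & V ⊆ W].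
Proof.
move=> Wx; have [A [i [im ix]]] := scheme_affine x.
have op : open (range i).
  by case: im => _ op _; exact: (op (@Opens (spec A) setT openT)).
pose V0 : opens X := Opens op.
have aV0 : affine_open V0 by exists A, i.
have [b [ub bW]] := affine_basis aV0 (ix : V0 x) Wx.
by exists (unit_locus b); split=> //; exact: affine_unit_locus.
Qed.
End AffineOpens.

(** * The Hasse-Schmidt algebra of an open set *)

Section Base.
Variables (X Y : scheme) (f : scheme_morphism X Y).

Section BaseRing.
Variable V : opens X.

(** These b are the sections over V of the image of the inverse image of O_Y in
    O_X. *)
Definition from_base (b : O_ X V) : Prop := forall x, V x ->
  exists (W : opens X) (h : W ⊆ V) (U : opens Y) (k : W ⊆ rpre f U) (a : O_ Y U),
    W x /\ res h b = ring_map k a.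

Lemma ring_map_res (W W' : opens X) (U U' : opens Y) (k : W ⊆ rpre f U)
  (k' : W' ⊆ rpre f U') (h : W' ⊆ W) (g : U' ⊆ U) a :
  res h (ring_map k a) = ring_map k' (res g a).
Proof.
have kU : W ⊆ rpre f U := k.
rewrite /= comorph_res (res_comp _ _ (osub_trans h k)).
by rewrite (res_comp _ _ (osub_trans h k)).
Qed.

(** Two local expressions are compared over the intersection of the two opens of
    Y; op stands for subtraction and for multiplication. *)
Lemma from_base_op2 (op : forall R : comPzRingType, R -> R -> R) b c :
  (forall (R S : comPzRingType) (u : {rmorphism R -> S}) x y,
     u (op R x y) = op S (u x) (u y)) ->
  from_base b -> from_base c -> from_base (op _ b c).
Proof.
move=> opP hb hc x Vx.
have [W [h [U [k [a [Wx ea]]]]]] := hb x Vx.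
have [W' [h' [U' [k' [a' [W'x ea']]]]]] := hc x Vx.
have hh := osub_trans (@ocapl _ W W') h.
have kk : ocap W W' ⊆ rpre f (ocap U U').
  by move=> y [Wy W'y]; split; [exact: (k y)|exact: (k' y)].
exists (ocap W W'), hh, (ocap U U'), kk.
exists (op _ (res (@ocapl _ U U') a) (res (@ocapr _ U U') a')); split=> //.
rewrite !opP -(res_comp h (@ocapl _ W W') hh) ea.
have hh' := osub_trans (@ocapr _ W W') h'.
rewrite (Prop_irrelevance hh hh') -(res_comp h' (@ocapr _ W W') hh') ea'.
by rewrite (ring_map_res k kk _ (@ocapl _ U U')) (ring_map_res k' kk _ (@ocapr _ U U')).
Qed.

Lemma from_base_ring_map (U : opens Y) (k : V ⊆ rpre f U) a :
  from_base (ring_map k a).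
Proof. by move=> x Vx; exists V, (@osub_refl _ V), U, k, a; rewrite res_id. Qed.

Definition base_pred : {pred O_ X V} := fun b => `[< from_base b >].

Lemma base_pred_subring : GRing.subring_closed base_pred.
Proof.
split=> [|b c /asboolP hb /asboolP hc|b c /asboolP hb /asboolP hc]; apply/asboolP.
- have k : V ⊆ rpre f (Opens (@openT Y)) by [].
  by rewrite -(rmorph1 (ring_map k)); exact: from_base_ring_map.
- apply: (@from_base_op2 (fun R x y => x - y)) => // R S u x y; exact: rmorphB.
- apply: (@from_base_op2 (fun R x y => x * y)) => // R S u x y; exact: rmorphM.
Qed.

HB.instance Definition _ :=
  GRing.isSubringClosed.Build (O_ X V) base_pred base_pred_subring.

Record base_ring := BaseRing { base_val : O_ X V; _ : base_val \in base_pred }.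
HB.instance Definition _ := [isSub for base_val].
HB.instance Definition _ := [Choice of base_ring by <:].
HB.instance Definition _ := GRing.SubChoice_isSubComPzRing.Build _ _ base_ring
  base_pred_subring.

Definition base_incl : {rmorphism base_ring -> O_ X V} := val.
End BaseRing.

Lemma base_inclP V (c : base_ring V) : from_base (base_incl V c).
Proof. exact/asboolP/(valP c). Qed.

Definition base_mk V (b : O_ X V) (hb : from_base b) : base_ring V :=
  Sub b (introT (asboolP _) hb).

Lemma base_mkK V (b : O_ X V) (hb : from_base b) : base_incl V (base_mk hb) = b.
Proof. exact: SubK. Qed.

Lemma base_incl_inj V : injective (base_incl V).
Proof. exact: val_inj. Qed.

Lemma base_factor (R : comPzRingType) V (u : {rmorphism R -> O_ X V}) :
  (forall a, from_base (u a)) ->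
  exists v : {rmorphism R -> base_ring V}, forall a, base_incl V (v a) = u a.
Proof.
move=> hu; pose v a := base_mk (hu a).
have vE a : base_incl V (v a) = u a by exact: base_mkK.
have vB : GRing.zmod_morphism v.
  by move=> x y; apply: base_incl_inj; rewrite rmorphB !vE rmorphB.
have vM : GRing.monoid_morphism v.
  by split=> [|x y]; apply: base_incl_inj; rewrite ?rmorph1 ?rmorphM !vE ?rmorph1 ?rmorphM.
pose va := GRing.isZmodMorphism.Build R (base_ring V) v vB.
pose vm := GRing.isMonoidMorphism.Build R (base_ring V) v vM.
by exists (HB.pack v va vm : {rmorphism R -> base_ring V}).
Qed.

Lemma from_base_res V W (h : W ⊆ V) (b : O_ X V) : from_base b -> from_base (res h b).
Proof.
move=> hb x Wx; have [T [k [U [l [a [Tx e]]]]]] := hb x (h x Wx).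
have lW : ocap W T ⊆ rpre f U by move=> y [_ Ty]; exact: (l y).
exists (ocap W T), (@ocapl _ _ _), U, lW, a; split=> //.
rewrite (res_comp h _ (osub_trans (@ocapl _ W T) h)).
rewrite -(res_comp k (@ocapr _ W T)) e.
by rewrite (ring_map_res l lW _ (@osub_refl _ U)) res_id.
Qed.

Definition base_res_spec V W (h : W ⊆ V) :
  {u : {rmorphism base_ring V -> base_ring W} |
     forall a, base_incl W (u a) = res h (base_incl V a)} :=
  cid (base_factor (u := @res _ _ _ _ h \o base_incl V)
        (fun a => from_base_res h (base_inclP a))).
Definition base_res V W (h : W ⊆ V) := sval (base_res_spec h).
Lemma base_resE V W (h : W ⊆ V) a : res h (base_incl V a) = base_incl W (base_res h a).
Proof. by rewrite (svalP (base_res_spec h)). Qed.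

Definition base_of_spec (U : opens Y) V (k : V ⊆ rpre f U) :
  {u : {rmorphism O_ Y U -> base_ring V} |
     forall a, base_incl V (u a) = ring_map k a} :=
  cid (base_factor (u := ring_map k) (from_base_ring_map k)).
Definition base_of (U : opens Y) V (k : V ⊆ rpre f U) := sval (base_of_spec k).
Lemma base_ofE (U : opens Y) V (k : V ⊆ rpre f U) a :
  idfun (ring_map k a) = base_incl V (base_of k a).
Proof. by rewrite (svalP (base_of_spec k)). Qed.

Variable m : option nat.

(** HS of O_X(V) over the sections that come locally from Y: it involves no open
    set of Y, and it is functorial in V. *)
Definition HSV V : comPzRingType := HS m (base_incl V).
Definition hsv_const V : {rmorphism O_ X V -> HSV V} := hs_const m (base_incl V).
Definition hsv_res V W (h : W ⊆ V) : {rmorphism HSV V -> HSV W} :=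
  hs_map m (base_resE h).
(** Both algebras are quotients of the same polynomial algebra. *)
Definition hsv_chart (U : opens Y) V (k : V ⊆ rpre f U) :
  {rmorphism HS m (ring_map k) -> HSV V} := hs_map m (base_ofE k).

Lemma hsv_res_const V W (h : W ⊆ V) b :
  hsv_res h (hsv_const V b) = hsv_const W (res h b).
Proof. exact: hs_map_const. Qed.

Lemma hsv_res_id V (h : V ⊆ V) z : hsv_res h z = z.
Proof.
apply: (@hs_ext _ _ _ _ _ (hsv_res h) idfun) => i x im.
by rewrite hs_map_d // res_id.
Qed.

Lemma hsv_res_comp V W T (h : W ⊆ V) (k : T ⊆ W) (l : T ⊆ V) z :
  hsv_res k (hsv_res h z) = hsv_res l z.
Proof.
apply: (@hs_ext _ _ _ _ _ (hsv_res k \o hsv_res h : {rmorphism _ -> _})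
   (hsv_res l)) => i x im.
rewrite -[LHS]/(hsv_res k (hsv_res h (hs_d m (base_incl V) i x))).
by rewrite !hs_map_d // (res_comp _ _ l).
Qed.

Lemma hsv_chart_const (U : opens Y) V (k : V ⊆ rpre f U) b :
  hsv_chart k (hs_const m (ring_map k) b) = hsv_const V b.
Proof. exact: hs_map_const. Qed.

Lemma hsv_chart_loc (U : opens Y) V W (k : V ⊆ rpre f U) (l : W ⊆ rpre f U)
  (h : W ⊆ V) z :
  hsv_res h (hsv_chart k z) = hsv_chart l (hs_map m (ring_map_loc h k l) z).
Proof.
apply: (@hs_ext _ _ _ _ _ (hsv_res h \o hsv_chart k : {rmorphism _ -> _})
   (hsv_chart l \o hs_map m (ring_map_loc h k l) : {rmorphism _ -> _})) => i x im.
rewrite -[LHS]/(hsv_res h (hsv_chart k (hs_d m _ i x))).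
rewrite -[RHS]/(hsv_chart l (hs_map m (ring_map_loc h k l) (hs_d m _ i x))).
by rewrite !hs_map_d.
Qed.

Lemma hsv_chart_base (U U' : opens Y) V (k : V ⊆ rpre f U) (l : V ⊆ rpre f U')
  (h : U' ⊆ U) z :
  hsv_chart l (hs_map m (ring_map_base h k l) z) = hsv_chart k z.
Proof.
apply: (@hs_ext _ _ _ _ _
   (hsv_chart l \o hs_map m (ring_map_base h k l) : {rmorphism _ -> _})
   (hsv_chart k)) => i x im.
rewrite -[LHS]/(hsv_chart l (hs_map m (ring_map_base h k l) (hs_d m _ i x))).
by rewrite !hs_map_d.
Qed.
End Base.

(** * Independence of the base, localization and gluing *)

Lemma away_iso (A A' B B' : comPzRingType) (b : A) (g : {rmorphism A -> A'})
  (g' : {rmorphism B -> B'}) (u : {rmorphism A -> B}) (u' : {rmorphism A' -> B'}) :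
  bijective u -> bijective u' -> (forall a, g' (u a) = u' (g a)) ->
  away b g -> away (u b) g'.
Proof.
move=> [v uv vu] bu' sq [[t et] ker frac]; have inj' := bij_inj bu'.
have [v' uv' vu'] := bu'; split.
- by exists (u' t); rewrite sq -rmorphM et rmorph1.
- move=> y; rewrite -(vu y) sq -(rmorph0 u') => /inj' /ker[n e]; exists n.
  by rewrite -rmorphXn -rmorphM e rmorph0.
move=> y; rewrite -(vu' y); have [n [a e]] := frac (v' y); exists n, (u a).
by rewrite -rmorphXn !sq -rmorphM e.
Qed.

(** The annihilator of z in O_X(V) is contained in no prime. *)
Lemma affine_local_zero (X : scheme) (V : opens X) (aV : affine_open V)
  (R : comPzRingType) (c : {rmorphism O_ X V -> R}) (z : R) :
  (forall x, V x -> exists b : O_ X V, germ_unit b x /\ exists n, c b ^+ n * z = 0) ->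
  z = 0.
Proof.
move=> loc.
have J0 : c 0 * z = 0 by rewrite rmorph0 mul0r.
have JD a b : c a * z = 0 -> c b * z = 0 -> c (a + b) * z = 0.
  by move=> ea eb; rewrite rmorphD mulrDl ea eb addr0.
have JM a b : c b * z = 0 -> c (a * b) * z = 0.
  by move=> eb; rewrite rmorphM -mulrA eb mulr0.
have : c 1 * z = 0; last by rewrite rmorph1 mul1r.
apply: (@ideal1P _ (@Ideal _ [set a | c a * z = 0] J0 JD JM)) => P.
have [x Vx xP] := affine_prime_point aV P; have [b [/xP Pb [n e]]] := loc x Vx.
by exists (b ^+ n); [rewrite /= rmorphXn|move/prime_exp].
Qed.

Lemma hs_d_linear (m : option nat) (A B : comPzRingType) (f : {rmorphism A -> B})
  i a x : le_order m i -> hs_d m f i (f a * x) = hs_const m f (f a) * hs_d m f i x.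
Proof.
move=> im; rewrite hs_dM // big_ord_recl subn0 hs_d0 big1 ?addr0 // => j _.
rewrite hs_d_base0 ?mul0r //; apply: (le_order_trans _ im); exact: leq_ord.
Qed.

Section Good.
Variables (X Y : scheme) (f : scheme_morphism X Y) (m : option nat).
Implicit Types (V W : opens X).

Section ChartIso.
Variables (U : opens Y) (V : opens X) (k : V ⊆ rpre f U).
Hypotheses (aU : affine_open U) (aV : affine_open V).

(** Near any point b = f^#(a') with a' defined on some D(al) in U, and there
    al^n a' = a with a a section over U. By [hs_d_linear],
    f^#(al)^n d_i b = d_i f^#(a) = 0, where f^#(al) is invertible; so d_i b
    vanishes locally, hence vanishes. *)
Lemma hs_d_from_base i b : (0 < i)%N -> le_order m i -> from_base f b ->
  hs_d m (ring_map k) i b = 0.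
Proof.
move=> i0 im hb; apply: (affine_local_zero aV (c := hs_const m (ring_map k))) => x Vx.
have [W [h [U' [k' [a' [Wx ea']]]]]] := hb x Vx.
have Ufx : U (f x) := @k x Vx.
have [al [alx alU']] := affine_basis aU Ufx (k' x Wx : U' (f x)).
have alU := @unit_locus_sub _ _ _ al.
have ag := @affine_away _ _ (unit_locus al) aU al alU (fun _ => conj id id).
have [[t et] _ /(_ (res alU' a'))[n [a ea]]] := ag.
have [c [cx cW]] := @affine_basis _ _ (ocap W (rpre f (unit_locus al))) x aV Vx (conj Wx alx).
exists c; split=> //; set W2 := unit_locus c in cW *.
have W2V : W2 ⊆ V := @unit_locus_sub _ _ _ c.
have W2W : W2 ⊆ W := osub_trans cW (@ocapl _ _ _).
have k2 : W2 ⊆ rpre f U := osub_trans W2V k.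
have k2' : W2 ⊆ rpre f (unit_locus al) := osub_trans cW (@ocapr _ _ _).
have [_ ker _] := hs_away m (ring_map_loc W2V k k2)
  (@affine_away _ _ W2 aV c W2V (fun _ => conj id id)).
apply: ker; rewrite hs_map_d //.
have eb : res W2V b = ring_map k2' (res alU' a').
  by rewrite -(res_comp h W2W) ea' (ring_map_res k' k2' W2W alU').
have base a0 : ring_map k2 a0 = ring_map k2' (res alU a0).
  by rewrite -(ring_map_res k k2' W2V alU) (ring_map_res k k2 W2V (@osub_refl _ U)) res_id.
have lin := hs_d_linear (ring_map k2) (al ^+ n) (res W2V b) im.
rewrite [ring_map k2 (al ^+ n)]base eb -rmorphM ea -base hs_d_base0 // in lin.
have ealt : hs_const m (ring_map k2) (ring_map k2' (res alU al)) *
    hs_const m (ring_map k2) (ring_map k2' t) = 1 by rewrite -!rmorphM et !rmorph1.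
apply: (@unit_exp_cancel _ _ _ n _ _ ealt).
by rewrite mulr0 eb lin !rmorphXn.
Qed.

(** By [hs_d_from_base] the universal derivation over O_Y(U) kills everything
    that comes locally from Y, so it is also one over [base_ring f V]. *)
Lemma hsv_chart_bij : bijective (hsv_chart m k).
Proof.
have DA i c : (0 < i)%N -> le_order m i ->
    tcoef i (hs_series (f := ring_map k) (m := m) idfun (base_incl f V c)) = 0.
  by move=> i0 im; rewrite hs_series_coef // hs_d_from_base //; exact: base_inclP.
exists (hs_lift DA) => z.
- apply: (@hs_ext _ _ _ _ _ (hs_lift DA \o hsv_chart m k : {rmorphism _ -> _}) idfun).
  move=> i x im; rewrite -[LHS]/(hs_lift DA (hsv_chart m k (hs_d m _ i x))).
  by rewrite hs_map_d // hs_lift_d // hs_series_coef.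
apply: (@hs_ext _ _ _ _ _ (hsv_chart m k \o hs_lift DA : {rmorphism _ -> _}) idfun).
move=> i x im; rewrite -[LHS]/(hsv_chart m k (hs_lift DA (hs_d m _ i x))).
by rewrite hs_lift_d // hs_series_coef // [LHS]hs_map_d.
Qed.
End ChartIso.

(** The opens V on which the statement prescribes the sections. *)
Definition good (V : opens X) : Prop :=
  affine_open V /\ exists U : opens Y, affine_open U /\ V ⊆ rpre f U.

Lemma good_unit_locus V (b : O_ X V) : good V -> good (unit_locus b).
Proof.
move=> [aV [U [aU k]]]; split; first exact: affine_unit_locus.
by exists U; split=> //; apply: osub_trans k; exact: unit_locus_sub.
Qed.

Lemma good_nbhd (x : X) (W : opens X) : W x -> exists V, [/\ good V, V x & V ⊆ W].
Proof.
move=> Wx; have [U [aU Ux _]] := @affine_nbhd Y (f x) (Opens (@openT Y)) I.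
have [V [aV Vx VW]] := @affine_nbhd X x (ocap W (rpre f U)) (conj Wx Ux).
exists V; split=> //; last exact: osub_trans VW (@ocapl _ _ _).
by split=> //; exists U; split=> //; exact: osub_trans VW (@ocapr _ _ _).
Qed.

Lemma good_basis V W x : good V -> V x -> W x ->
  exists b : O_ X V, [/\ germ_unit b x, good (unit_locus b) & unit_locus b ⊆ W].
Proof.
move=> gV Vx Wx; have [b [bx bW]] := affine_basis gV.1 Vx Wx.
by exists b; split=> //; exact: good_unit_locus.
Qed.

(** Here goodness of V enters: with an affine U available, [hs_away] applies to
    the fixed base ring O_Y(U) and is carried over by [hsv_chart_bij]. *)
Lemma hsv_away V W (h : W ⊆ V) (b : O_ X V) : good V ->
  (forall x, W x <-> germ_unit b x) -> away (hsv_const f m V b) (hsv_res f m h).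
Proof.
move=> [aV [U [aU k]]] WE; pose k' := osub_trans h k.
have eW : affine_open W.
  have -> : W = unit_locus b by exact: opens_ext.
  exact: affine_unit_locus.
rewrite -(hsv_chart_const m k).
have sq z : hsv_res f m h (hsv_chart m k z) =
    hsv_chart m k' (hs_map m (ring_map_loc h k k') z) by exact: hsv_chart_loc.
have bk := hsv_chart_bij k aU aV.
have bk' := hsv_chart_bij k' aU eW.
apply: (away_iso bk bk' sq).
by apply: hs_away; exact: (affine_away aV).
Qed.

Lemma hsv_sep V (z : HSV f m V) : good V ->
  (forall x, V x -> exists W (h : W ⊆ V), W x /\ hsv_res f m h z = 0) -> z = 0.
Proof.
move=> gV loc; apply: (affine_local_zero gV.1 (c := hsv_const f m V)) => x Vx.
have [W [h [Wx e]]] := loc x Vx; have [b [bx gb bW]] := good_basis gV Vx Wx.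
exists b; split=> //.
have [_ ker _] := hsv_away (@unit_locus_sub _ _ _ b) gV (fun _ => conj id id).
by apply: ker; rewrite -(hsv_res_comp h bW) e rmorph0.
Qed.

Lemma hsv_sep2 V (z w : HSV f m V) : good V ->
  (forall x, V x -> exists W (h : W ⊆ V), W x /\ hsv_res f m h z = hsv_res f m h w) ->
  z = w.
Proof.
move=> gV loc; apply/eqP; rewrite -subr_eq0; apply/eqP/hsv_sep => // x /loc[W [h [Wx e]]].
by exists W, h; rewrite rmorphB e subrr.
Qed.

(** The elements given by Q, on a sieve of good opens that covers V, glue: over
    a basic open D(b) the given element is a fraction by [hsv_away], and
    fractions are glued by [glue_fractions]. *)
Lemma hsv_glue V (Q : forall W : opens X, HSV f m W -> Prop) : good V ->
  (forall x, V x -> exists2 W : opens X, W x &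
     forall W', W' ⊆ W -> W' ⊆ V -> good W' -> exists s, Q W' s) ->
  (forall W W' (h : W' ⊆ W) s, good W -> good W' -> Q W s -> Q W' (hsv_res f m h s)) ->
  (forall W s s', good W -> Q W s -> Q W s' -> s = s') ->
  exists z : HSV f m V, forall W (h : W ⊆ V) s, good W -> Q W s -> hsv_res f m h z = s.
Proof.
move=> gV cov Qres Quniq.
(* pairs (a, y) such that y / a is the given element on D(a) *)
pose G (a : O_ X V) (y : HSV f m V) := exists W (h : W ⊆ V) s,
  [/\ good W, forall x, W x <-> germ_unit a x, Q W s &
     hsv_const f m W (res h a) * s = hsv_res f m h y].
have [||n [z zP]] := @glue_fractions _ _ (hsv_const f m V) G 1.
- move=> P P1; have [x Vx xP] := affine_prime_point gV.1 P.
  have [W Wx Wc] := cov x Vx.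
  have [b [bx gb bW]] := good_basis gV Vx Wx.
  have bV := @unit_locus_sub _ _ _ b.
  have [s Qs] := Wc _ bW bV gb.
  have [_ _ /(_ s)[n [y ey]]] := hsv_away bV gV (fun _ => conj id id).
  exists (b ^+ n.+1), (hsv_const f m V b * y).
  split; last by move=> /prime_exp; exact/xP.
  exists (unit_locus b), bV, s.
  split; [exact: gb|by move=> x'; rewrite germ_unitX|exact: Qs|].
  by rewrite rmorphM -ey !rmorphXn exprS -mulrA hsv_res_const.
- move=> a y a' y' [W [h [s [gW WE Qs e]]]] [W' [h' [s' [gW' WE' Qs' e']]]].
  have hh := osub_trans (@ocapl _ W W') h.
  have WWE x : ocap W W' x <-> germ_unit (a * a') x.
    by rewrite germ_unitM -WE -WE'.
  have gWW : good (ocap W W').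
    by rewrite (opens_ext (V := unit_locus (a * a')) WWE); exact: good_unit_locus.
  have [_ ker _] := hsv_away hh gV WWE.
  have [|N eN] := ker (hsv_const f m V a' * y - hsv_const f m V a * y').
    rewrite rmorphB !rmorphM !hsv_res_const.
    rewrite -{1}(hsv_res_comp h (@ocapl _ W W') hh) -e.
    rewrite -(hsv_res_comp h' (@ocapr _ W W') hh) -e' !rmorphM !hsv_res_const.
    rewrite !(res_comp _ _ hh).
    rewrite (Quniq _ _ _ gWW (Qres _ _ (@ocapl _ W W') _ gW gWW Qs)
       (Qres _ _ (@ocapr _ W W') _ gW' gWW Qs')).
    by apply/eqP; rewrite subr_eq0 mulrCA.
  by exists N; rewrite rmorphXn.
exists z => W h s gW Qs; apply: hsv_sep2 => // x Wx.
have [P Px] := affine_point_prime gV.1 (h x Wx).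
have [|a [y [[T [l [t [gT TE Qt e]]]] Pa [N eN]]]] := zP P.
  exact: prime_ideal_proper.
have ax := (Px a).2 Pa; have Tx := (TE x).2 ax.
(* on T the element y / a is z, as a is invertible there *)
have ezt : hsv_res f m l z = t.
  have [[v ev] _ _] := hsv_away l gV TE.
  have {}eN : hsv_const f m T (res l a) ^+ N * (hsv_const f m T (res l a) *
      hsv_res f m l z - hsv_const f m T (res l a) * t) = 0.
    rewrite e -[RHS](rmorph0 (hsv_res f m l)) -eN expr1n rmorph1 mul1r.
    by rewrite rmorphM rmorphB !rmorphM !rmorphXn !hsv_res_const.
  rewrite hsv_res_const in ev.
  apply: (@unit_exp_cancel _ _ _ N.+1 _ _ ev); apply/eqP.
  by rewrite -subr_eq0 -mulrBr exprSr -mulrA mulrBr eN.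
have [S [gS Sx SW]] := good_nbhd ((conj Wx Tx) : ocap W T x).
have hW := osub_trans SW (@ocapl _ W T); have hT := osub_trans SW (@ocapr _ W T).
exists S, hW; split; first exact: Sx.
rewrite (hsv_res_comp h hW (osub_trans hW h)).
rewrite (Prop_irrelevance (osub_trans hW h) (osub_trans hT l)) -(hsv_res_comp l hT) ezt.
exact: Quniq gS (Qres _ _ hT _ gT gS Qt) (Qres _ _ hW _ gW gS Qs).
Qed.
End Good.

(** * The sheaf *)

Section HSSections.
Variables (X Y : scheme) (f : scheme_morphism X Y) (m : option nat).
Implicit Types (V W : opens X).

Definition compatible W (s : forall V, good f V -> V ⊆ W -> HSV f m V) : Prop :=
  forall V V' (gV : good f V) (gV' : good f V') (VW : V ⊆ W) (V'W : V' ⊆ W)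
    (h : V' ⊆ V), hsv_res f m h (s V gV VW) = s V' gV' V'W.

(** The limit of the HSV f m V over the good opens V in W. This is the value at W
    of the sheaf that extends HSV from the basis of good opens. *)
Record hs_sect W := HsSect {
  hs_val :> forall V, good f V -> V ⊆ W -> HSV f m V;
  hs_compat : compatible hs_val }.

Lemma hs_sectP W (s t : hs_sect W) :
  (forall V (gV : good f V) (VW : V ⊆ W), s V gV VW = t V gV VW) -> s = t.
Proof.
case: s t => [s sP] [t tP] /= e.
have est : s = t.
  apply: functional_extensionality_dep => V; apply: functional_extensionality_dep => gV.
  by apply: functional_extensionality_dep => VW; exact: e.
by case: _ / est tP => tP; congr HsSect; exact: Prop_irrelevance.
Qed.

HB.instance Definition _ W := gen_eqMixin (hs_sect W).
HB.instance Definition _ W := gen_choiceMixin (hs_sect W).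

Section Ring.
Variable W : opens X.
Implicit Types s t : hs_sect W.

Lemma hs_zero_compat : @compatible W (fun V _ _ => 0).
Proof. by move=> V V' *; exact: rmorph0. Qed.
Definition hs_zero : hs_sect W := HsSect (hs_zero_compat).
Lemma hs_one_compat : @compatible W (fun V _ _ => 1).
Proof. by move=> V V' *; exact: rmorph1. Qed.
Definition hs_one : hs_sect W := HsSect (hs_one_compat).
Lemma hs_add_compat s t : @compatible W (fun V gV VW => s V gV VW + t V gV VW).
Proof.
by move=> V V' gV gV' VW V'W h; rewrite rmorphD !(hs_compat _ gV gV' VW V'W).
Qed.
Definition hs_add s t : hs_sect W := HsSect (hs_add_compat s t).
Lemma hs_mul_compat s t : @compatible W (fun V gV VW => s V gV VW * t V gV VW).
Proof.
by move=> V V' gV gV' VW V'W h; rewrite rmorphM !(hs_compat _ gV gV' VW V'W).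
Qed.
Definition hs_mul s t : hs_sect W := HsSect (hs_mul_compat s t).
Lemma hs_opp_compat s : @compatible W (fun V gV VW => - s V gV VW).
Proof.
by move=> V V' gV gV' VW V'W h; rewrite rmorphN (hs_compat _ gV gV' VW V'W).
Qed.
Definition hs_opp s : hs_sect W := HsSect (hs_opp_compat s).

Lemma hs_addA : associative hs_add.
Proof. by move=> s t u; apply: hs_sectP => V gV VW /=; rewrite addrA. Qed.
Lemma hs_addC : commutative hs_add.
Proof. by move=> s t; apply: hs_sectP => V gV VW /=; rewrite addrC. Qed.
Lemma hs_add0 : left_id hs_zero hs_add.
Proof. by move=> s; apply: hs_sectP => V gV VW /=; rewrite add0r. Qed.
Lemma hs_addN : left_inverse hs_zero hs_opp hs_add.
Proof. by move=> s; apply: hs_sectP => V gV VW /=; rewrite addNr. Qed.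
HB.instance Definition _ :=
  GRing.isZmodule.Build (hs_sect W) hs_addA hs_addC hs_add0 hs_addN.

Lemma hs_mulA : associative hs_mul.
Proof. by move=> s t u; apply: hs_sectP => V gV VW /=; rewrite mulrA. Qed.
Lemma hs_mulC : commutative hs_mul.
Proof. by move=> s t; apply: hs_sectP => V gV VW /=; rewrite mulrC. Qed.
Lemma hs_mul1 : left_id hs_one hs_mul.
Proof. by move=> s; apply: hs_sectP => V gV VW /=; rewrite mul1r. Qed.
Lemma hs_mulDl : left_distributive hs_mul +%R.
Proof. by move=> s t u; apply: hs_sectP => V gV VW /=; rewrite mulrDl. Qed.
HB.instance Definition _ := GRing.Zmodule_isComPzRing.Build (hs_sect W)
  hs_mulA hs_mulC hs_mul1 hs_mulDl.

Section Eval.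
Variables (V : opens X) (gV : good f V) (VW : V ⊆ W).
Definition hs_eval_fun (s : hs_sect W) : HSV f m V := s V gV VW.
Lemma hs_eval_is_additive : GRing.zmod_morphism hs_eval_fun.
Proof. by []. Qed.
Lemma hs_eval_is_multiplicative : GRing.monoid_morphism hs_eval_fun.
Proof. by []. Qed.
HB.instance Definition _ := GRing.isZmodMorphism.Build (hs_sect W) (HSV f m V)
  hs_eval_fun hs_eval_is_additive.
HB.instance Definition _ := GRing.isMonoidMorphism.Build (hs_sect W) (HSV f m V)
  hs_eval_fun hs_eval_is_multiplicative.
Definition hs_eval : {rmorphism hs_sect W -> HSV f m V} := hs_eval_fun.
End Eval.

Lemma hs_scalar_compat (a : O_ X W) :
  @compatible W (fun V gV VW => hsv_const f m V (res VW a)).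
Proof.
by move=> V V' gV gV' VW V'W h; rewrite hsv_res_const (res_comp VW h V'W).
Qed.
Definition hs_scalar_fun (a : O_ X W) : hs_sect W := HsSect (hs_scalar_compat a).
Lemma hs_scalar_is_additive : GRing.zmod_morphism hs_scalar_fun.
Proof. by move=> a b; apply: hs_sectP => V gV VW /=; rewrite !rmorphB. Qed.
Lemma hs_scalar_is_multiplicative : GRing.monoid_morphism hs_scalar_fun.
Proof.
by split=> [|a b]; apply: hs_sectP => V gV VW /=; rewrite ?rmorph1 ?rmorphM.
Qed.
HB.instance Definition _ := GRing.isZmodMorphism.Build (O_ X W) (hs_sect W)
  hs_scalar_fun hs_scalar_is_additive.
HB.instance Definition _ := GRing.isMonoidMorphism.Build (O_ X W) (hs_sect W)
  hs_scalar_fun hs_scalar_is_multiplicative.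
End Ring.

Section Res.
Variables (W W' : opens X) (h : W' ⊆ W).
Lemma hs_restrict_compat (s : hs_sect W) :
  @compatible W' (fun V gV VW => s V gV (osub_trans VW h)).
Proof. by move=> V V' gV gV' VW V'W k; exact: hs_compat. Qed.
Definition hs_restrict_fun (s : hs_sect W) : hs_sect W' :=
  HsSect (hs_restrict_compat s).
Lemma hs_restrict_is_additive : GRing.zmod_morphism hs_restrict_fun.
Proof. by move=> s t; apply: hs_sectP. Qed.
Lemma hs_restrict_is_multiplicative : GRing.monoid_morphism hs_restrict_fun.
Proof. by split=> [|s t]; apply: hs_sectP. Qed.
HB.instance Definition _ := GRing.isZmodMorphism.Build (hs_sect W) (hs_sect W')
  hs_restrict_fun hs_restrict_is_additive.
HB.instance Definition _ := GRing.isMonoidMorphism.Build (hs_sect W) (hs_sect W')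
  hs_restrict_fun hs_restrict_is_multiplicative.
End Res.

Lemma hs_val_irr W (s : hs_sect W) V (gV gV' : good f V) (VW VW' : V ⊆ W) :
  s V gV VW = s V gV' VW'.
Proof. by rewrite (Prop_irrelevance gV gV') (Prop_irrelevance VW VW'). Qed.

Lemma hs_restrict_id W (h : W ⊆ W) s : hs_restrict_fun h s = s.
Proof. by apply: hs_sectP => V gV VW; exact: (hs_val_irr s). Qed.
Lemma hs_restrict_comp W W' W'' (h : W' ⊆ W) (k : W'' ⊆ W') (l : W'' ⊆ W) s :
  hs_restrict_fun k (hs_restrict_fun h s) = hs_restrict_fun l s.
Proof. by apply: hs_sectP => V gV VW; exact: (hs_val_irr s). Qed.

Definition hs_presheaf : presheaf X :=
  @Presheaf X (fun W => hs_sect W : comPzRingType)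
    (fun W W' h => hs_restrict_fun h : {rmorphism _ -> _})
    hs_restrict_id hs_restrict_comp.

(** A family of local sections s determines, on each good V, a family of
    elements on the good opens of V that lie in a member of the cover; these are
    glued by [hsv_glue]. Compatibility of the results, and uniqueness, can be
    checked on such small opens by [hsv_sep2]. *)
Lemma hs_presheaf_is_sheaf : is_sheaf hs_presheaf.
Proof.
move=> I W C CW cov s agree.
pose Q V (z : HSV f m V) := exists i (VC : V ⊆ C i) (gV : good f V),
  z = (s i : hs_sect (C i)) V gV VC.
have Quniq V z z' : Q V z -> Q V z' -> z = z'.
  move=> [i [VC [gV ->]]] [j [VC' [gV' ->]]].
  have VCC : V ⊆ ocap (C i) (C j) by move=> x Vx; split; [exact: VC|exact: VC'].
  have /(congr1 (fun u : hs_sect (ocap (C i) (C j)) => u V gV VCC)) := agree i j.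
  rewrite /= => e; rewrite (hs_val_irr _ gV gV VC (osub_trans VCC (@ocapl _ _ _))) e.
  exact: hs_val_irr.
have Qres V V' (h : V' ⊆ V) z : good f V -> good f V' -> Q V z -> Q V' (hsv_res f m h z).
  move=> gV gV' [i [VC [gV2 ->]]]; exists i, (osub_trans h VC), gV'.
  exact: hs_compat.
have glue V : good f V -> V ⊆ W -> exists z : HSV f m V,
    forall V' (h : V' ⊆ V) z', good f V' -> Q V' z' -> hsv_res f m h z = z'.
  move=> gV VW; apply: (hsv_glue gV) => //; last by move=> V' z z' _; exact: Quniq.
  move=> x Vx; have [i Cx] := cov x (VW x Vx); exists (C i) => // V' V'C _ gV'.
  by exists ((s i : hs_sect (C i)) V' gV' V'C), i, V'C, gV'.
pose t0 V (gV : good f V) (VW : V ⊆ W) := sval (cid (glue V gV VW)).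
have t0P V gV VW : forall V' (h : V' ⊆ V) z', good f V' -> Q V' z' ->
    hsv_res f m h (@t0 V gV VW) = z' by rewrite /t0; case: cid.
have local V x : V ⊆ W -> V x -> exists V' (h : V' ⊆ V),
    [/\ V' x, good f V' & exists z, Q V' z].
  move=> VW Vx; have [i Cx] := cov x (VW x Vx).
  have [V' [gV' V'x V'VC]] := good_nbhd f (conj Vx Cx : ocap V (C i) x).
  exists V', (osub_trans V'VC (@ocapl _ _ _)); split=> //.
  pose V'C := osub_trans V'VC (@ocapr _ _ _).
  by exists ((s i : hs_sect (C i)) V' gV' V'C), i, V'C, gV'.
have t0C V V' (gV : good f V) (gV' : good f V') (VW : V ⊆ W) (V'W : V' ⊆ W)
    (h : V' ⊆ V) : hsv_res f m h (t0 V gV VW) = t0 V' gV' V'W.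
  apply: hsv_sep2 => // x V'x; have [T [k [Tx gT [z Qz]]]] := local V' x V'W V'x.
  exists T, k; split; first exact: Tx.
  rewrite (hsv_res_comp h k (osub_trans k h)) (t0P _ _ _ _ (osub_trans k h) z gT Qz).
  exact/esym/t0P.
exists (HsSect t0C); split.
  move=> i; apply: hs_sectP => V gV VC /=.
  rewrite -[LHS](hsv_res_id (@osub_refl _ V)); apply: t0P => //.
  by exists i, VC, gV.
move=> t tP; apply: hs_sectP => V gV VW /=.
apply: hsv_sep2 => // x Vx; have [T [k [Tx gT [z Qz]]]] := local V x VW Vx.
exists T, k; split; first exact: Tx.
rewrite (t0P _ _ _ _ k z gT Qz).
rewrite (hs_compat _ gV gT VW (osub_trans k VW)).
move: Qz => [i [TC [gT' ->]]]; rewrite -(tP i) /=; exact: hs_val_irr.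
Qed.

Definition hs_sheaf : sheaf X := Sheaf hs_presheaf_is_sheaf.

Lemma hs_scalar_res W W' (h : W' ⊆ W) a :
  hs_scalar_fun (res h a) = hs_restrict_fun h (hs_scalar_fun a).
Proof.
by apply: hs_sectP => V gV VW; congr (hsv_const f m V _); exact: res_comp.
Qed.

Definition hs_alg : sheaf_alg X :=
  @SheafAlg X hs_sheaf (fun W => @hs_scalar_fun W : {rmorphism O_ X W -> hs_sect W})
    hs_scalar_res.
End HSSections.

(** * Modules of sections that localize are quasi-coherent *)

Section Scalars.
Variables (A R : comPzRingType) (g : {rmorphism A -> R}).
(** Restriction of scalars along g. *)
Definition scalars of {rmorphism A -> R} : Type := R.
Local Notation M := (scalars g).
HB.instance Definition _ := GRing.ComPzRing.on M.
Definition scalars_scale (a : A) (x : M) : M := g a * x.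
Lemma scalars_scaleA a b x : scalars_scale a (scalars_scale b x) = scalars_scale (a * b) x.
Proof. by rewrite /scalars_scale rmorphM mulrA. Qed.
Lemma scalars_scale1 : left_id 1 scalars_scale.
Proof. by move=> x; rewrite /scalars_scale rmorph1 mul1r. Qed.
Lemma scalars_scaleDr : right_distributive scalars_scale +%R.
Proof. by move=> a x y; rewrite /scalars_scale mulrDr. Qed.
Lemma scalars_scaleDl x : {morph scalars_scale^~ x : a b / a + b}.
Proof. by move=> a b; rewrite /scalars_scale rmorphD mulrDl. Qed.
HB.instance Definition _ := GRing.Zmodule_isLmodule.Build A M
  scalars_scaleA scalars_scale1 scalars_scaleDr scalars_scaleDl.
End Scalars.

Section IsTilde.
Variables (X : scheme) (F : sheaf_alg X) (A : comPzRingType).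
Variables (i : ringed_morphism (Spec A) X) (V : opens X).
Hypotheses (iim : is_open_immersion i) (iV : range i = (V : set X)).
Variable alpha : {rmorphism A -> O_ X V}.
Hypothesis alphaE : forall a, comorph i V (alpha a) = sec (rpre i V) a.
Hypothesis Faway : forall (b : O_ X V) (W : opens X) (h : W ⊆ V),
  (forall x, W x <-> germ_unit b x) -> away (alg_const F V b) (@res _ F _ _ h).

Let gamma : {rmorphism A -> F V} := alg_const F V \o alpha.
Local Notation M := (scalars gamma).

Let gammaE W (h : W ⊆ V) a : res h (gamma a) = alg_const F W (res h (alpha a)).
Proof. by rewrite alg_const_res. Qed.

(** How a section of F defines an element of M_p: multiply s by a denominator a,
    invertible at p, so that near i p the product extends to V. *)
Definition is_germ W (s : F W) p (mu : locmod (pcompl p) M) : Prop :=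
  exists (W' : opens X) (h : W' ⊆ W) (k : W' ⊆ V) (x : M) a (pa : pcompl p a),
    [/\ W' (i p), mu = mfrac x pa & res k (gamma a) * res h s = res k (x : F V)].

Lemma germ_ex W (s : F W) p : W (i p) -> exists mu : locmod (pcompl p) M, is_germ s mu.
Proof.
move=> Wp; have Vp := chart_in iV p.
have [a [ap aWV]] := chart_basis iim iV alphaE Vp (conj Wp Vp : ocap W V (i p)).
have h := osub_trans aWV (@ocapl _ _ _); have k := osub_trans aWV (@ocapr _ _ _).
have pa := (chart_germ_unit iim iV alphaE a p).1 ap.
have [_ _ /(_ (res h s))[n [x e]]] := Faway k (fun _ => conj id id).
have pan : pcompl p (a ^+ n) by move=> /(@prime_exp _ p).
exists (@mfrac _ (pcompl p) M x _ pan), (unit_locus (alpha a)), h, k, x, (a ^+ n), pan.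
by split=> //; rewrite rmorphXn.
Qed.

(** If a s = x and b s = y near i p then b x - a y vanishes on some D(c)
    containing i p, so a power of c kills it and x / a = y / b. *)
Lemma germ_uniq W (s : F W) p (mu mu' : locmod (pcompl p) M) :
  is_germ s mu -> is_germ s mu' -> mu = mu'.
Proof.
move=> [W1 [h1 [k1 [x [a [pa [W1p -> e]]]]]]] [W2 [h2 [k2 [y [b [pb [W2p -> e']]]]]]].
have Vp := chart_in iV p.
have [c [cp cW]] := chart_basis iim iV alphaE Vp (conj W1p W2p : ocap W1 W2 (i p)).
have l1 := osub_trans cW (@ocapl _ _ _); have l2 := osub_trans cW (@ocapr _ _ _).
have pc := (chart_germ_unit iim iV alphaE c p).1 cp.
have k := osub_trans l1 k1; have h := osub_trans l1 h1.
have {}e : res k (gamma a) * res h s = res k (x : F V).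
  by move/(congr1 (res l1)): e; rewrite rmorphM !(res_comp _ _ k) (res_comp _ _ h).
have {}e' : res k (gamma b) * res h s = res k (y : F V).
  by move/(congr1 (res l2)): e'; rewrite rmorphM !(res_comp _ _ k) (res_comp _ _ h).
have [_ ker _] := Faway k (fun _ => conj id id).
have [|n en] := ker (gamma b * (x : F V) - gamma a * (y : F V)).
  by rewrite rmorphB !rmorphM -e -e'; ring.
apply/mfrac_eqP; exists (c ^+ n); split; first by move=> /(@prime_exp _ p).
by rewrite -[LHS]/(gamma (c ^+ n) * (gamma b * (x : F V) - gamma a * (y : F V))) rmorphXn.
Qed.

Definition germ W (s : F W) p (Wp : rpre i W p) : locmod (pcompl p) M :=
  sval (cid (germ_ex s Wp)).

Lemma germP W (s : F W) p (Wp : rpre i W p) : is_germ s (germ s Wp).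
Proof. by rewrite /germ; case: cid. Qed.

Lemma germ_eq W (s : F W) p (Wp : rpre i W p) (mu : locmod (pcompl p) M) :
  is_germ s mu -> germ s Wp = mu.
Proof. exact/germ_uniq/germP. Qed.

Lemma germ_local W (s : F W) : @locally_fraction A M (rpre i W) (@germ W s).
Proof.
move=> p Wp; have [W' [h [k [x [a [pa [W'p _ e]]]]]]] := germP s Wp.
pose N := ocap (rpre i W') (basic_open a).
have NW : N ⊆ rpre i W by move=> q [W'q _]; exact: (h _ W'q).
exists N, NW; split=> //; exists x, a => q [W'q qa]; exists qa.
by apply: germ_eq; exists W', h, k, x, a, qa.
Qed.

Definition germs W (s : F W) : tilde M (rpre i W) := Tilde (@germ_local W s).

Lemma is_germ_res W W' (h : W' ⊆ W) (s : F W) p (mu : locmod (pcompl p) M) :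
  is_germ (res h s) mu -> is_germ s mu.
Proof.
move=> [T [l [k [x [a [pa [Tp -> e]]]]]]]; exists T, (osub_trans l h), k, x, a, pa.
by split=> //; rewrite -(res_comp h l).
Qed.

Lemma germs_res W W' (h : W' ⊆ W) (s : F W) :
  germs (res h s) = tres (opreS (rmap_cont i) h) (germs s).
Proof.
apply: tildeP => p W'p; apply: esym; apply: germ_eq.
exact/(@is_germ_res _ _ h)/germP.
Qed.

Lemma germs_add W (s t : F W) : germs (s + t) = germs s + germs t.
Proof.
apply: tildeP => p Wp; apply: germ_eq.
have [W1 [h1 [k1 [x [a [pa [W1p e1 e]]]]]]] := germP s Wp.
have [W2 [h2 [k2 [y [b [pb [W2p e2 e']]]]]]] := germP t Wp.
have k := osub_trans (@ocapl _ W1 W2) k1; have h := osub_trans (@ocapl _ W1 W2) h1.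
exists (ocap W1 W2), h, k, (b *: x + a *: y), (a * b), (mulsetM pa pb); split=> //.
  by rewrite -[LHS]/(ladd (germ s Wp) (germ t Wp)) e1 e2 fracD.
move/(congr1 (res (@ocapl _ W1 W2))): e; move/(congr1 (res (@ocapr _ W1 W2))): e'.
rewrite !rmorphM !(res_comp _ _ k) !(res_comp _ _ h) => e' e.
rewrite -[X in _ = res k X]/(gamma b * (x : F V) + gamma a * (y : F V)).
by rewrite !rmorphD !rmorphM -e -e'; ring.
Qed.

Lemma germs_scale W (c : O_ X W) (s : F W) :
  germs (alg_const F W c * s) = tscale (comorph i W c) (germs s).
Proof.
apply: tildeP => p Wp; apply: germ_eq.
have [W1 [h1 [k1 [x [a [pa [W1p e1 e]]]]]]] := germP s Wp.
have [N [NW [Np [z [d zd]]]]] := tilde_loc (comorph i W c : tilde A^o _) Wp.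
have [pd ed] := zd p Np.
pose T := chart_image iim (ocap N (rpre i W1)).
have TW1 : T ⊆ W1 by move=> _ [q [_ W1q] <-].
have k := osub_trans TW1 k1; have h := osub_trans TW1 h1.
have Tp : T (i p) by exists p.
have zdT : res k (alpha d) * res h c = res k (alpha z).
  apply: (bij_inj (chart_comorph_bij iim iV k)).
  rewrite rmorphM !(comorph_alpha_res alphaE) comorph_res; apply: tildeP => q Tq.
  have [Nq _] := chart_image_pre Tq; have [qd eq] := zd q Nq.
  rewrite -[LHS]/(lscale (loc_const (pcompl q) d)
    ((comorph i W c : tilde A^o _) q (opreS (rmap_cont i) h q Tq))).
  rewrite (tilde_ap _ _ (NW q Nq)) eq fracZ; apply: fracE.
  by rewrite scale1r mul1r.
exists T, h, k, ((z : A) *: x), (d * a), (mulsetM pd pa); split=> //.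
  rewrite -[LHS]/(lscale ((comorph i W c : tilde A^o _) p Wp) (germ s Wp)).
  by rewrite (tilde_ap _ _ (NW p Np)) ed e1 fracZ.
move/(congr1 (res TW1)): e; rewrite rmorphM !(res_comp _ _ k) (res_comp _ _ h) => e.
rewrite -[X in _ = res k X]/(gamma z * (x : F V)).
rewrite !rmorphM -e !gammaE -zdT rmorphM -alg_const_res; ring.
Qed.

(** If x / a = 0 then u x = 0 for some u outside p, and where u and a are
    invertible a s = x gives s = 0. *)
Lemma germs_inj W : W ⊆ V -> injective (@germs W).
Proof.
move=> WV; suff ker : forall s : F W, germs s = 0 -> s = 0.
  have sub0 : germs (0 : F W) = 0 by apply: (addrI (germs 0)); rewrite -germs_add !addr0.
  move=> s t e; apply/eqP; rewrite -subr_eq0; apply/eqP/ker.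
  apply: (addIr (germs t)); rewrite -germs_add subrK add0r //.
move=> s e; apply: (@sheaf_sep _ F W s 0) => y Wy; have [p ep] := chart_point iV (WV y Wy).
have Wp : rpre i W p by rewrite /= ep.
have [W1 [h1 [k1 [x [a [pa [W1p e1 e2]]]]]]] := germP s Wp.
have {}e1 : mfrac x pa = @mfrac _ (pcompl p) M 0 1 (mulset1 _).
  by rewrite -e1; exact: (congr1 (fun u : tilde M (rpre i W) => u p Wp) e).
move/mfrac_eqP: e1 => [u [pu eu]].
have {}eu : gamma u * (x : F V) = 0 by move: eu; rewrite scaler0 subr0 scale1r.
pose T := chart_image iim (ocap (rpre i W1) (ocap (basic_open u) (basic_open a))).
have TW1 : T ⊆ W1 by move=> _ [q [W1q _] <-].
have k := osub_trans TW1 k1; have h := osub_trans TW1 h1.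
exists T, h; split; first by exists p.
have unit c : ~ p c -> (T ⊆ unit_locus (alpha c)) -> exists t, res k (gamma c) * t = 1.
  move=> pc Tc; have [|t et] := @germ_unit_global _ _ _ _ k (alpha c); first exact: Tc.
  by exists (alg_const F T t); rewrite gammaE -rmorphM et rmorph1.
have [|t et] := unit u pu.
  by move=> _ [q [_ [qu _]] <-]; exact/(chart_germ_unit iim iV alphaE).
have [|v ev] := unit a pa.
  by move=> _ [q [_ [_ qa]] <-]; exact/(chart_germ_unit iim iV alphaE).
move/(congr1 (res TW1)): e2; rewrite rmorphM !(res_comp _ _ k) (res_comp _ _ h) => e2.
rewrite rmorph0 -[LHS]mul1r -et -[X in _ * X]mul1r -ev.
transitivity (t * v * (res k (gamma u) * (res k (gamma a) * res h s))); first by ring.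
by rewrite e2 -rmorphM eu rmorph0 mulr0.
Qed.

(** Where t is the fraction x / a it is the germ of a^(-1) x; these sections
    agree on overlaps by [germs_inj]. *)
Lemma germs_surj W (t : tilde M (rpre i W)) : W ⊆ V -> exists s, germs s = t.
Proof.
move=> WV.
pose Q T (s : F T) := T ⊆ W /\
  forall p (Tp : rpre i T p) (Wp : rpre i W p), germ s Tp = t p Wp.
have cov y : W y -> exists (T : opens X) (s : F T), [/\ T ⊆ W, T y & Q T s].
  move=> Wy; have [p ep] := chart_point iV (WV y Wy).
  have Wp : rpre i W p by rewrite /= ep.
  have [N [NW [Np [x [a xa]]]]] := tilde_loc t Wp.
  pose T := chart_image iim N.
  have TW : T ⊆ W by move=> _ [q Nq <-]; exact: (NW q).
  have k := osub_trans TW WV.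
  have [|v ev] := @germ_unit_global _ _ _ _ k (alpha a).
    move=> _ [q Nq <-]; apply/(chart_germ_unit iim iV alphaE).
    by have [] := xa q Nq.
  exists T, (alg_const F T v * res k (x : F V)); split=> //; first by exists p.
  split=> // q Tq Wq; have Nq := chart_image_pre Tq; have [qa eq] := xa q Nq.
  rewrite (tilde_ap t Wq (NW q Nq)) eq; apply: germ_eq.
  exists T, (@osub_refl _ T), k, x, a, qa; split=> //.
  by rewrite res_id gammaE mulrA -rmorphM ev rmorph1 mul1r.
have [//||r rP] := @sheaf_glue _ F W Q.
  move=> T T' s s' [TW sP] [T'W s'P] y Ty T'y.
  exists (ocap T T'), (@ocapl _ _ _), (@ocapr _ _ _); split=> //.
  apply: (@germs_inj (ocap T T')); first by move=> z [Tz _]; exact: (WV _ (TW _ Tz)).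
  rewrite !germs_res; apply: tildeP => p [Tp T'p].
  by rewrite /= (sP p _ (TW _ Tp)) (s'P p _ (TW _ Tp)).
exists r; apply: tildeP => p Wp; have [T [s [TW Tp Qs]]] := cov (i p) Wp.
have := rP T TW s Qs; have [_ /(_ p Tp Wp) <-] := Qs => es.
by apply: germ_eq; apply: (@is_germ_res _ _ TW); rewrite es; exact: germP.
Qed.

Lemma restriction_germs : restriction_is_tilde F i M.
Proof.
exists germs; split.
- move=> W; rewrite iV => WV; apply: inj_surj_bijective; first exact: (germs_inj WV).
  by move=> t; exact: (germs_surj t WV).
- exact: germs_add.
- exact: germs_scale.
- exact: germs_res.
Qed.
End IsTilde.

Lemma quasi_coherent_away (X : scheme) (F : sheaf_alg X) :
  (forall x : X, exists V : opens X, [/\ affine_open V, V x &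
     forall (b : O_ X V) (W : opens X) (h : W ⊆ V),
       (forall y, W y <-> germ_unit b y) ->
       away (alg_const F V b) (@res _ F _ _ h)]) ->
  quasi_coherent F.
Proof.
move=> loc x; have [V [[A [i [iim iV]]] Vx Faway]] := loc x.
have [alpha [_ alphaE]] := chart_ring iim iV.
exists A, i, (scalars (alg_const F V \o alpha : {rmorphism _ -> _}) : lmodType A).
by split=> //; [rewrite iV|exact: restriction_germs].
Qed.

(** * The charts *)

Section Existence.
Variables (X Y : scheme) (f : scheme_morphism X Y) (m : option nat).
Implicit Types (U : opens Y) (V W : opens X).
Local Notation F := (hs_alg f m).

(** A good V is the largest of the good opens in V. *)
Lemma hs_eval_bij V (gV : good f V) : bijective (hs_eval m gV (@osub_refl _ V)).
Proof.
apply: inj_surj_bijective => [s t e|z].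
  apply: hs_sectP => W gW WV; rewrite -!(hs_compat _ gV gW (@osub_refl _ V) WV WV).
  by congr (hsv_res f m WV _); exact: e.
have zc : @compatible _ _ f m V (fun W gW WV => hsv_res f m WV z).
  by move=> W W' gW gW' WV W'V h; exact: hsv_res_comp.
by exists (HsSect zc); exact: hsv_res_id.
Qed.

Lemma hs_alg_away V W (h : W ⊆ V) (b : O_ X V) : good f V ->
  (forall x, W x <-> germ_unit b x) -> away (alg_const F V b) (@res _ F _ _ h).
Proof.
move=> gV WE.
have gW : good f W.
  by rewrite (opens_ext (V := unit_locus b) WE); exact: good_unit_locus.
have [v [ev ve]] := inverse_rmorphism (hs_eval_bij gV).
have [w [ew we]] := inverse_rmorphism (hs_eval_bij gW).
have -> : alg_const F V b = v (hsv_const f m V b).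
  apply: (can_inj ev); rewrite ve -[LHS]/(hsv_const f m V (res (@osub_refl _ V) b)).
  by rewrite res_id.
apply: (away_iso (g := hsv_res f m h) (u' := w)).
- by exists (hs_eval m gV (@osub_refl _ V)).
- by exists (hs_eval m gW (@osub_refl _ W)).
- move=> z; apply: (can_inj ew); rewrite we -{2}(ve z).
  rewrite -[RHS]/(hsv_res f m h (v z V gV (@osub_refl _ V))).
  by rewrite (hs_compat _ gV gW (@osub_refl _ V) h); exact: (hs_val_irr (v z)).
exact: hsv_away.
Qed.

Lemma hs_alg_quasi_coherent : quasi_coherent F.
Proof.
apply: quasi_coherent_away => x.
have [V [gV Vx _]] := good_nbhd f (I : Opens (@openT X) x).
exists V; split=> // [|b W h]; first exact: gV.1.
exact: hs_alg_away.
Qed.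

Definition good_of U V (aU : affine_open U) (aV : affine_open V)
  (k : V ⊆ rpre f U) : good f V := conj aV (ex_intro _ U (conj aU k)).

Lemma hs_chart_ex U V (aU : affine_open U) (aV : affine_open V) (k : V ⊆ rpre f U) :
  exists v : {rmorphism F V -> HS m (ring_map k)}, bijective v /\
    forall s : hs_sect f m V,
      hsv_chart m k (v s) = s V (good_of aU aV k) (@osub_refl _ V).
Proof.
have [w [cw wc]] := inverse_rmorphism (hsv_chart_bij m k aU aV).
exists (w \o hs_eval m (good_of aU aV k) (@osub_refl _ V)); split; last by move=> s; exact: wc.
by apply: bij_comp; [exists (hsv_chart m k)|exact: hs_eval_bij].
Qed.

Definition hs_chart : hs_charts m f F :=
  fun U V aU aV k => sval (cid (hs_chart_ex aU aV k)).

Lemma hs_chartE U V aU aV (k : V ⊆ rpre f U) (s : hs_sect f m V) :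
  hsv_chart m k (hs_chart aU aV k s) = s V (good_of aU aV k) (@osub_refl _ V).
Proof. by rewrite /hs_chart; case: cid => v [? E]; exact: E. Qed.

Lemma hs_chart_bij U V aU aV (k : V ⊆ rpre f U) : bijective (hs_chart aU aV k).
Proof. by rewrite /hs_chart; case: cid => v []. Qed.

Lemma hs_chart_const U V aU aV (k : V ⊆ rpre f U) b :
  hs_chart aU aV k (alg_const F V b) = hs_const m (ring_map k) b.
Proof.
apply: (bij_inj (hsv_chart_bij m k aU aV)); rewrite hs_chartE hsv_chart_const.
by rewrite -[LHS]/(hsv_const f m V (res (@osub_refl _ V) b)) res_id.
Qed.

Lemma hs_chart_res U V V' (aU : affine_open U) (aV : affine_open V)
  (aV' : affine_open V') (k : V ⊆ rpre f U) (k' : V' ⊆ rpre f U) (h : V' ⊆ V)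
  (z : F V) :
  hs_map m (ring_map_loc h k k') (hs_chart aU aV k z) = hs_chart aU aV' k' (res h z).
Proof.
apply: (bij_inj (hsv_chart_bij m k' aU aV')).
rewrite -hsv_chart_loc !hs_chartE (hs_compat _ _ (good_of aU aV' k') _ h).
exact: (hs_val_irr (z : hs_sect f m V)).
Qed.

Lemma hs_alg_is_hs_sheaf : is_hs_sheaf hs_chart.
Proof.
split; first exact: hs_alg_quasi_coherent.
- by move=> U V aU aV k; split; [exact: hs_chart_bij|exact: hs_chart_const].
- move=> U U' V aU aU' aV k k' U'U S _ z.
  apply: (bij_inj (hsv_chart_bij m k' aU' aV)).
  by rewrite hsv_chart_base !hs_chartE; exact: (hs_val_irr (z : hs_sect f m V)).
move=> U V V' aU aV aV' k k' V'V S VS z s Ss.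
apply: (loc_liftP _ erefl); rewrite hs_chart_res hs_map_const.
rewrite -(hs_chart_const aU aV') -rmorphM; congr (hs_chart aU aV' k' _).
rewrite alg_const_res; exact: loc_lift_frac.
Qed.
End Existence.

(** * Uniqueness *)

Lemma loc_lift_one (A A' : comPzRingType) (S : mulset A) (g : {rmorphism A -> A'})
  (gS : inverts S g) x s (hs : S s) : s = 1 -> loc_lift gS (loc_frac x hs) = g x.
Proof. by move=> es; apply: (loc_liftP gS erefl); rewrite es rmorph1 mul1r. Qed.

Section Model.
Variables (X Y : scheme) (f : scheme_morphism X Y) (m : option nat).
Implicit Types (U : opens Y) (V W : opens X).

(** What remains of the charts of a solution once the choice of U is removed; by
    [hs_model_iso] it determines the sheaf. *)
Definition hs_model (F : sheaf_alg X)
    (Phi : forall V, good f V -> {rmorphism F V -> HSV f m V}) : Prop :=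
  [/\ forall V gV, bijective (Phi V gV),
      forall V gV b, Phi V gV (alg_const F V b) = hsv_const f m V b &
      forall V W gV gW (h : W ⊆ V) z, hsv_res f m h (Phi V gV z) = Phi W gW (res h z)].

Section FromCharts.
Variables (F : sheaf_alg X) (phi : hs_charts m f F) (hphi : is_hs_sheaf phi).

Let Phi U V aU aV (k : V ⊆ rpre f U) (z : F V) : HSV f m V :=
  hsv_chart m k (phi aU aV k z).

(** Compatibility with localizations of O_X(V), read for the fraction z / 1. *)
Lemma chart_restrict U V W aU aV aW (k : V ⊆ rpre f U) (l : W ⊆ rpre f U)
  (h : W ⊆ V) (b : O_ X V) z : (forall x, W x <-> germ_unit b x) ->
  hsv_res f m h (Phi aU aV k z) = Phi aU aW l (res h z).
Proof.
move=> WE; have [_ _ _ hloc] := hphi; rewrite /Phi (hsv_chart_loc l).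
have VS := away_localization (affine_away aV h WE).
have E := hloc U V W aU aV aW k l h _ VS z 1 (mulset1 _).
congr (hsv_chart m l _); rewrite -[LHS](loc_lift_one (hs_inverts (m := m) l VS) _
  (mulset_image_in (hs_const m (ring_map k)) (mulset1 (powers b))) (rmorph1 _)).
rewrite [LHS]E; congr (phi aU aW l _).
exact: (loc_lift_one (sections_inverts VS) _ _ (rmorph1 _)).
Qed.

Lemma chart_change_base U U' V aU aU' aV (k : V ⊆ rpre f U) (l : V ⊆ rpre f U')
  (g : U' ⊆ U) (al : O_ Y U) z : (forall y, U' y <-> germ_unit al y) ->
  Phi aU aV k z = Phi aU' aV l z.
Proof.
move=> UE; have [_ _ hbase _] := hphi.
have LS := away_localization (affine_away aU g UE).
by rewrite /Phi -(hbase U U' V aU aU' aV k l g _ LS z) hsv_chart_base.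
Qed.

(** Both charts may be compared near a point x of V. Choose a basic open W1 of U
    inside U' containing f x, then a basic open W2 of U' inside W1. Then W2 is also
    a basic open of W1, so that U, W1, W2 and U', W2 are linked by localizations
    of rings of sections; U and U' themselves need not have an affine
    intersection. *)
Lemma chart_indep U U' V aU aU' aV (k : V ⊆ rpre f U) (l : V ⊆ rpre f U') z :
  Phi aU aV k z = Phi aU' aV l z.
Proof.
have gV : good f V by split=> //; exists U.
apply: (hsv_sep2 gV) => x Vx.
have [al [alx alU]] := @affine_basis _ _ (ocap U U') _ aU (k x Vx) (conj (k x Vx) (l x Vx)).
set W1 := unit_locus al in alU *; have aW1 : affine_open W1 := affine_unit_locus aU al.
have [be [bex beW]] := @affine_basis _ _ W1 _ aU' (l x Vx) alx.
set W2 := unit_locus be in beW *; have aW2 : affine_open W2 := affine_unit_locus aU' be.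
have [c [cx cW]] := @affine_basis _ _ (rpre f W2) _ aV Vx bex.
set T := unit_locus c in cW *; have aT : affine_open T := affine_unit_locus aV c.
have TV : T ⊆ V := @unit_locus_sub _ _ _ c.
have W1U : W1 ⊆ U := @unit_locus_sub _ _ _ al.
have W1U' : W1 ⊆ U' := osub_trans alU (@ocapr _ _ _).
have W2U' : W2 ⊆ U' := @unit_locus_sub _ _ _ be.
have T1 : T ⊆ rpre f W1 by move=> y Ty; exact: (beW _ (cW _ Ty)).
have W2E y : W2 y <-> germ_unit (res W1U' be) y.
  split=> [be_y|/[dup] [[S [hS [Sy _]]]]]; first exact/(germ_unit_res be W1U' (beW _ be_y)).
  by move/(germ_unit_res be W1U' (hS _ Sy)).
exists T, TV; split; first exact: cx.
have e1 := chart_restrict aU aV aT k (osub_trans TV k) TV z (b := c) (fun _ => conj id id).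
have e2 := chart_restrict aU' aV aT l (osub_trans TV l) TV z (b := c) (fun _ => conj id id).
have e3 := chart_change_base aU aW1 aT (osub_trans TV k) T1 W1U (al := al)
  (res TV z) (fun _ => conj id id).
have e4 := chart_change_base aW1 aW2 aT T1 cW beW (res TV z) W2E.
have e5 := chart_change_base aU' aW2 aT (osub_trans TV l) cW W2U' (al := be)
  (res TV z) (fun _ => conj id id).
exact: (etrans e1 (etrans e3 (etrans e4 (esym (etrans e2 e5))))).
Qed.

(** Naturality for W in V that is not a basic open of V follows in the same way:
    near each point there are W1, basic in V and contained in W, and W2, basic in
    W and contained in W1, hence basic in W1. *)
Lemma hs_model_of_charts :
  exists Psi : forall V, good f V -> {rmorphism F V -> HSV f m V},
    hs_model Psi /\ forall U V aU aV (k : V ⊆ rpre f U) (gV : good f V) z,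
      Psi V gV z = hsv_chart m k (phi aU aV k z).
Proof.
have ex V (gV : good f V) : exists u : {rmorphism F V -> HSV f m V},
    forall U aU aV (k : V ⊆ rpre f U) z, u z = Phi aU aV k z.
  have [aV [U [aU k]]] := gV.
  exists (hsv_chart m k \o phi aU aV k : {rmorphism _ -> _}) => U' aU' aV' k' z.
  by rewrite (Prop_irrelevance aV' aV) -(chart_indep aU aU' aV k k' z).
exists (fun V gV => sval (cid (ex V gV))).
have PE V gV : forall U aU aV (k : V ⊆ rpre f U) z,
  sval (cid (ex V gV)) z = Phi aU aV k z by case: cid.
split; last by move=> U V aU aV k gV z; exact: PE.
have [_ hiso _ _] := hphi; split.
- move=> V gV; have [aV [U [aU k]]] := gV.
  have [bij _] := hiso U V aU aV k; have bij' := hsv_chart_bij m k aU aV.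
  by apply: (eq_bij (bij_comp bij' bij)) => z; rewrite (PE V gV U aU aV k).
- move=> V gV b; have [aV [U [aU k]]] := gV.
  have [_ c] := hiso U V aU aV k.
  by rewrite (PE V gV U aU aV k) /Phi c hsv_chart_const.
move=> V W gV gW h z; have [aV [U [aU k]]] := gV; have [aW _] := gW.
have l := osub_trans h k; rewrite (PE V gV U aU aV k) (PE W gW U aU aW l).
apply: (hsv_sep2 gW) => x Wx.
have [b [bx bW]] := @affine_basis _ _ W _ aV (h x Wx) Wx.
set W1 := unit_locus b in bW *; have aW1 : affine_open W1 := affine_unit_locus aV b.
have [c [cx cW]] := @affine_basis _ _ W1 _ aW Wx bx.
set W2 := unit_locus c in cW *; have aW2 : affine_open W2 := affine_unit_locus aW c.
have W1V : W1 ⊆ V := @unit_locus_sub _ _ _ b.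
have W2W : W2 ⊆ W := @unit_locus_sub _ _ _ c.
have W2E y : W2 y <-> germ_unit (res bW c) y.
  split=> [cy|/[dup] [[S [hS [Sy _]]]]]; first exact/(germ_unit_res c bW (cW _ cy)).
  by move/(germ_unit_res c bW (hS _ Sy)).
exists W2, W2W; split; first exact: cx.
rewrite (chart_restrict aU aW aW2 l (osub_trans W2W l) W2W (b := c)) //.
rewrite (hsv_res_comp h W2W (osub_trans W2W h)).
rewrite (Prop_irrelevance (osub_trans W2W h) (osub_trans cW W1V)).
rewrite -(hsv_res_comp W1V cW).
rewrite (chart_restrict aU aV aW1 k (osub_trans W1V k) W1V z (b := b) (fun _ => conj id id)).
rewrite (chart_restrict aU aW1 aW2 _ (osub_trans W2W l) cW _ W2E).
by rewrite !(res_comp _ _ (osub_trans W2W h)).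
Qed.
End FromCharts.

Section Transfer.
Variables (F G : sheaf_alg X).
Variables (Phi : forall V, good f V -> {rmorphism F V -> HSV f m V}).
Variables (Psi : forall V, good f V -> {rmorphism G V -> HSV f m V}).
Hypotheses (hPhi : hs_model Phi) (hPsi : hs_model Psi).

(** t is the image of s under the isomorphism determined by the two models. *)
Definition matches W (s : F W) (t : G W) : Prop :=
  forall V (gV : good f V) (VW : V ⊆ W), Psi gV (res VW t) = Phi gV (res VW s).

Lemma matches_ex W (s : F W) : exists t, matches s t.
Proof.
have [bPhi _ nPhi] := hPhi; have [bPsi _ nPsi] := hPsi.
pose Q V (t : G V) := exists (gV : good f V) (VW : V ⊆ W), Psi gV t = Phi gV (res VW s).
have ex V (gV : good f V) (VW : V ⊆ W) : exists t, Q V t.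
  have [v _ vK] := bPsi V gV; exists (v (Phi gV (res VW s))), gV, VW; exact: vK.
have [||t tP] := @sheaf_glue _ G W Q.
- move=> x Wx; have [V [gV Vx VW]] := good_nbhd f Wx.
  by have [t Qt] := ex V gV VW; exists V, t.
- move=> V V' t t' [gV [VW e]] [gV' [VW' e']] x Vx V'x.
  have [T [gT Tx TV]] := good_nbhd f (conj Vx V'x : ocap V V' x).
  have h := osub_trans TV (@ocapl _ _ _); have h' := osub_trans TV (@ocapr _ _ _).
  exists T, h, h'; split=> //; apply: (bij_inj (bPsi T gT)).
  rewrite -!(nPsi _ _ _ gT) -?nPsi e e' !(nPhi _ _ _ gT).
  by rewrite !(res_comp _ _ (osub_trans h VW)).
exists t => V gV VW; have [u Qu] := ex V gV VW; rewrite (tP V VW u Qu).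
have [gV' [VW' e]] := Qu.
by rewrite (Prop_irrelevance gV gV') (Prop_irrelevance VW VW').
Qed.

Lemma matches_uniq W (s : F W) t t' : matches s t -> matches s t' -> t = t'.
Proof.
have [bPsi _ _] := hPsi; move=> e e'; apply: (@sheaf_sep _ G) => x Wx.
have [V [gV Vx VW]] := good_nbhd f Wx; exists V, VW; split=> //.
by apply: (bij_inj (bPsi V gV)); rewrite e e'.
Qed.

Lemma matches_res W W' (h : W' ⊆ W) s t : matches s t -> matches (res h s) (res h t).
Proof. by move=> e V gV VW; rewrite !(res_comp _ _ (osub_trans VW h)). Qed.

Lemma matches_rmorphism W : exists u : {rmorphism F W -> G W}, forall s, matches s (u s).
Proof.
pose u s := sval (cid (matches_ex (W := W) s)).
have uP s : matches s (u s) by rewrite /u; case: cid.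
have uE s t : matches s t -> u s = t by exact/matches_uniq/uP.
have uB : GRing.zmod_morphism u.
  by move=> x y; apply: uE => V gV VW; rewrite !rmorphB !uP.
have uM : GRing.monoid_morphism u.
  by split=> [|x y]; apply: uE => V gV VW; rewrite ?rmorph1 // !rmorphM !uP.
pose ua := GRing.isZmodMorphism.Build (F W) (G W) u uB.
pose um := GRing.isMonoidMorphism.Build (F W) (G W) u uM.
by exists (HB.pack u ua um : {rmorphism F W -> G W}).
Qed.
End Transfer.

Lemma hs_model_iso (F G : sheaf_alg X)
  (Phi : forall V, good f V -> {rmorphism F V -> HSV f m V})
  (Psi : forall V, good f V -> {rmorphism G V -> HSV f m V}) :
  hs_model Phi -> hs_model Psi ->
  exists theta : alg_iso F G, forall W s, matches Phi Psi s (aiso theta W s).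
Proof.
move=> hPhi hPsi.
pose th W := sval (cid (matches_rmorphism hPhi hPsi W)).
have thP W s : matches Phi Psi s (th W s) by rewrite /th; case: cid.
have bij W : bijective (th W).
  have [v vP] := matches_rmorphism hPsi hPhi W; exists v => s.
    by apply: (matches_uniq hPhi (vP _)) => V gV VW; rewrite thP.
  by apply: (matches_uniq hPsi (thP _ _)) => V gV VW; rewrite vP.
have cst W a : th W (alg_const F W a) = alg_const G W a.
  have [_ cPhi _] := hPhi; have [_ cPsi _] := hPsi.
  apply: (matches_uniq hPsi (thP _ _)) => V gV VW.
  by rewrite -!alg_const_res cPhi cPsi.
have nat W W' (h : W' ⊆ W) s : th W' (res h s) = res h (th W s).
  by apply: (matches_uniq hPsi (thP _ _)); exact: matches_res.
by exists (AlgIso bij cst nat).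
Qed.
End Model.

Theorem theorem4p3 (X Y : scheme) (f : scheme_morphism X Y) (m : option nat) :
  (exists (F : sheaf_alg X) (phi : hs_charts m f F), is_hs_sheaf phi) /\
  (forall (F G : sheaf_alg X) (phi : hs_charts m f F) (psi : hs_charts m f G),
     is_hs_sheaf phi -> is_hs_sheaf psi ->
     exists theta : alg_iso F G,
       hs_iso_compatible phi psi theta /\
       forall theta' : alg_iso F G, hs_iso_compatible phi psi theta' ->
         forall (U : opens X) (s : F U), aiso theta' U s = aiso theta U s).
Proof.
split; first by exists (hs_alg f m), (@hs_chart _ _ f m); exact: hs_alg_is_hs_sheaf.
move=> F G phi psi hphi hpsi.
have [Phi [hPhi PhiE]] := hs_model_of_charts hphi.
have [Psi [hPsi PsiE]] := hs_model_of_charts hpsi.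
have [theta thetaP] := hs_model_iso hPhi hPsi.
have chartE (th : alg_iso F G) : hs_iso_compatible phi psi th <->
    forall V (gV : good f V) z, Psi V gV (aiso th V z) = Phi V gV z.
  split=> [comp V gV z|comp U V aU aV k z].
    have [aV [U [aU k]]] := gV.
    by rewrite (PsiE U V aU aV k) comp (PhiE U V aU aV k).
  apply: (bij_inj (hsv_chart_bij m k aU aV)).
  by rewrite -(PsiE U V aU aV k (good_of aU aV k)) comp (PhiE U V aU aV k).
exists theta; split.
  apply/chartE => V gV z; have := thetaP V z V gV (@osub_refl _ V).
  by rewrite !res_id.
move=> theta' /chartE comp U s; apply: (matches_uniq hPsi _ (thetaP U s)) => V gV VU.
by rewrite -aiso_res comp.
Qed.
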